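(* Let $f\in L^1[0,\infty)$ be a function and let $\alpha,\beta\in\mathbb{C}$ be two parameters with $\mathrm{Re}(\alpha)>0$. The Mellin transform of the tempered fractional integral of $f$ is given by the following integral transform: $$\widehat{{}^{T}_{0}I^{(\alpha,\beta)}f}(s)=\frac{1}{\beta^{\alpha+s-1}\Gamma(\alpha)}\int_0^{\infty}\Gamma_{1-s}(\alpha,\beta u)\,f(u)\,du,$$ where $\Gamma_m(\cdot,\cdot)$ is the Kobayashi gamma function.
   Context: The tempered fractional integral, defined for $\mathrm{Re}(\alpha)>0$ and $\mathrm{Re}(\beta)\ge0$, is ${}^{T}_{0}I^{(\alpha,\beta)}_t f(t)=\frac{1}{\Gamma(\alpha)}\int_0^t (t-u)^{\alpha-1}e^{-\beta(t-u)}f(u)\,du$. The Mellin transform of a function $g(t)$ is the function $\widehat{g}(s)=\int_0^\infty t^{s-1}g(t)\,dt$. The Kobayashi gamma function is $\Gamma_m(p,v)=\int_0^\infty \frac{t^{p-1}e^{-t}}{(t+v)^m}\,dt$. *)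

(* Defs.v *)
From HB Require Import structures.
From mathcomp Require Import all_boot all_order all_algebra.
From mathcomp Require Import complex.
From mathcomp Require Import all_classical all_reals all_analysis.
Import Order.TTheory GRing.Theory Num.Theory.
Import numFieldNormedType.Exports.

Set Implicit Arguments.
Unset Strict Implicit.
Unset Printing Implicit Defensive.

Local Open Scope classical_set_scope.
Local Open Scope ring_scope.
Local Open Scope complex_scope.

Section ComplexPowers.
Variable R : realType.
Implicit Types z w : R[i].

Definition cexp z : R[i] :=
  let: x +i* y := z in (expR x * cos y) +i* (expR x * sin y).

Definition cmod z : R :=
  Num.sqrt (complex.Re z ^+ 2 + complex.Im z ^+ 2).

(* Principal argument, in ]-pi, pi] for z != 0. *)
Definition carg z : R :=
  let t := acos (complex.Re z / cmod z) in
  if 0 <= complex.Im z then t else - t.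

Definition clog z : R[i] := ln (cmod z) +i* carg z.

(* Principal branch of z ^ w; at z = 0 the convention is that of powR. *)
Definition cpow z w : R[i] :=
  if z == 0 then (w == 0)%:R else cexp (w * clog z).

End ComplexPowers.

Section ComplexIntegration.
Variable R : realType.
Implicit Types (D : set R) (f : R -> R[i]).

Definition cintegrable D f : Prop :=
  (@lebesgue_measure R).-integrable D (fun x => (complex.Re (f x))%:E) /\
  (@lebesgue_measure R).-integrable D (fun x => (complex.Im (f x))%:E).

(* Meaningful for cintegrable integrands only. *)
Definition cintegral D f : R[i] :=
  (\int[@lebesgue_measure R]_(x in D) complex.Re (f x)) +i*
  (\int[@lebesgue_measure R]_(x in D) complex.Im (f x)).

End ComplexIntegration.

Section Transforms.
Variable R : realType.
Implicit Types (a b m p s v : R[i]) (f g : R -> R[i]) (t u : R).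

Definition halfline : set R := `[0, +oo[.

(* Euler's integral; used for 0 < Re a only. *)
Definition cGamma a : R[i] :=
  cintegral halfline (fun t => cpow t%:C (a - 1) * cexp (- t%:C)).

Definition kobayashi_gamma m p v : R[i] :=
  cintegral halfline
    (fun t => cpow t%:C (p - 1) * cexp (- t%:C) / cpow (t%:C + v) m).

Definition tempered_integral a b f t : R[i] :=
  (cGamma a)^-1 *
  cintegral `[0, t]
    (fun u => cpow (t - u)%:C (a - 1) * cexp (- b * (t - u)%:C) * f u).

Definition mellin_integrand g s t : R[i] := cpow t%:C (s - 1) * g t.

Definition mellin g s : R[i] := cintegral halfline (mellin_integrand g s).

End Transforms.

(* Main.v *)
Require Import Defs.
From HB Require Import structures.
From mathcomp Require Import all_boot all_order all_algebra.
From mathcomp Require Import complex.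
From mathcomp Require Import all_classical all_reals all_analysis.
From mathcomp Require Import measurable_realfun ring lra.
Import Order.TTheory GRing.Theory Num.Theory.
Import numFieldNormedType.Exports.
Local Open Scope classical_set_scope.
Local Open Scope ring_scope.
Local Open Scope complex_scope.
Set Implicit Arguments.
Unset Strict Implicit.
Unset Printing Implicit Defensive.
Local Notation Re := (@complex.Re _).
Local Notation Im := (@complex.Im _).

(** The formula is an exchange of integrals. In the Mellin transform of the
    convolution with [k v = v ^ (al - 1) exp (- be v)], substitute [t = u + v]: the
    coefficient of [f u] becomes the Laplace type integral of
    [v ^ (al - 1) (u + v) ^ (s - 1) exp (- be v)] over [v > 0], and the substitution
    [w = be v] turns it into [be ^ (1 - al - s)] times the Kobayashi gamma function
    at [be u]. Two things stand in the way: the double integral need not converge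
    absolutely (each iterated integral is only assumed to exist), and for
    non-real [be] the substitution moves the ray of integration.

    The power [t ^ (s - 1)] is therefore replaced by [reg_weight], that is
    [exp (- e t) (t + d) ^ (s - 1)] with small [e, d]. The double integral then
    converges absolutely and [regularised_fubini] gives the identity with [be + e]
    in place of [be] and [u + d] in place of [u] in the kernel. Since
    [Re (be + e) > 0], the ray can be rotated: [kob_rotation] deforms it through
    a real parameter and shows that the integral has zero derivative in this
    parameter, a substitute for Cauchy's theorem.

    It remains to let [e] and [d] tend to zero by dominated convergence. On the
    left the weight is at most [|t ^ (s - 1)|], so the existence of the Mellin
    transform provides the majorant. On the right one has to bound the Kobayashi
    function at [(be + e) (u + d)], uniformly, by [C (1 + |.|)] of its value at
    [be u], which is [kob_dominated]. Since [|be| u <= |(be + e) (u + d)|], and this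
    is [O (u + 1)], such a bound follows from two-sided estimates of the
    Kobayashi function. At infinity it behaves like [Gamma al z ^ (s - 1)]
    ([kob_lower_infty]). At the origin it is bounded if [Re al + Re s > 1];
    if [Re al + Re s < 1] it is asymptotic to [z ^ (al + s - 1)] times a beta
    integral ([kob_lower_zero]), which is not zero by [cbeta_neq0]; and if
    [Re al + Re s = 1] it differs by a bounded amount from an explicit integral,
    which is bounded or equal to [- ln |z|] ([kob_crit_near]). *)

(** * Complex numbers, exponentials and principal powers *)

Section ComplexBasics.
Variable R : realType.
Implicit Types (z w : R[i]) (x y t : R).

Lemma ReD z w : Re (z + w) = Re z + Re w. Proof. by case: z; case: w. Qed.
Lemma ImD z w : Im (z + w) = Im z + Im w. Proof. by case: z; case: w. Qed.
Lemma ReN z : Re (- z) = - Re z. Proof. by case: z. Qed.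
Lemma ImN z : Im (- z) = - Im z. Proof. by case: z. Qed.
Lemma ReM z w : Re (z * w) = Re z * Re w - Im z * Im w.
Proof. by case: z; case: w. Qed.
Lemma ImM z w : Im (z * w) = Re z * Im w + Im z * Re w.
Proof. by case: z; case: w. Qed.
Lemma ReV z : Re z^-1 = Re z / (Re z ^+ 2 + Im z ^+ 2).
Proof. by case: z. Qed.
Lemma ImV z : Im z^-1 = - (Im z / (Re z ^+ 2 + Im z ^+ 2)).
Proof. by case: z. Qed.
Definition ReImE := (ReD, ImD, ReN, ImN, ReM, ImM, ReV, ImV).

Lemma complex_ext z w : Re z = Re w -> Im z = Im w -> z = w.
Proof. by case: z w => a b [c d] /= -> ->. Qed.

Lemma cmodE z : cmod z = ComplexField.Normc.normc z. Proof. by case: z. Qed.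
Lemma cmodM z w : cmod (z * w) = cmod z * cmod w.
Proof. by rewrite !cmodE ComplexField.Normc.normcM. Qed.
Lemma cmodV z : cmod z^-1 = (cmod z)^-1.
Proof. by rewrite !cmodE ComplexField.Normc.normcV. Qed.
Lemma cmodD z w : cmod (z + w) <= cmod z + cmod w.
Proof. by rewrite !cmodE; exact: le_normcD. Qed.
Lemma cmodN z : cmod (- z) = cmod z.
Proof. by rewrite /cmod !ReImE !sqrrN. Qed.
Lemma cmodB z w : cmod (z - w) <= cmod z + cmod w.
Proof. by rewrite (le_trans (cmodD _ _))// cmodN. Qed.
Lemma cmod_subC z w : cmod (z - w) = cmod (w - z).
Proof. by rewrite -cmodN opprB. Qed.
Lemma cmod_ge0 z : 0 <= cmod z. Proof. exact: sqrtr_ge0. Qed.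
Lemma cmod0 : cmod (0 : R[i]) = 0.
Proof. by rewrite /cmod /= expr0n/= addr0 sqrtr0. Qed.
Lemma cmod_eq0 z : (cmod z == 0) = (z == 0).
Proof.
apply/eqP/eqP => [|->]; last exact: cmod0.
by rewrite cmodE; exact: ComplexField.Normc.eq0_normc.
Qed.
Lemma cmod_gt0 z : (0 < cmod z) = (z != 0).
Proof. by rewrite lt_def cmod_ge0 andbT cmod_eq0. Qed.
Lemma cmod_sqr z : cmod z ^+ 2 = Re z ^+ 2 + Im z ^+ 2.
Proof. by rewrite sqr_sqrtr// addr_ge0// sqr_ge0. Qed.
Lemma cmod_real x : cmod x%:C = `|x|.
Proof. by rewrite /cmod /= expr0n addr0 sqrtr_sqr. Qed.
Lemma cmod1 : cmod (1 : R[i]) = 1.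
Proof. by rewrite (cmod_real 1) normr1. Qed.
Lemma normr_Re_le z : `|Re z| <= cmod z.
Proof. by rewrite -sqrtr_sqr ler_wsqrtr// lerDl sqr_ge0. Qed.
Lemma normr_Im_le z : `|Im z| <= cmod z.
Proof. by rewrite -sqrtr_sqr ler_wsqrtr// lerDr sqr_ge0. Qed.
Lemma Re_le_cmod z : Re z <= cmod z.
Proof. exact: le_trans (ler_norm _) (normr_Re_le z). Qed.
Lemma cmod_le_ReIm z : cmod z <= `|Re z| + `|Im z|.
Proof.
have -> : `|Re z| + `|Im z| = Num.sqrt ((`|Re z| + `|Im z|) ^+ 2).
  by rewrite sqrtr_sqr (ger0_norm (addr_ge0 _ _)).
rewrite /cmod ler_wsqrtr// sqrrD !real_normK ?num_real// lerD2r lerDl.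
by rewrite mulrn_wge0// mulr_ge0.
Qed.

(** Adding a nonnegative real number to a point of the closed right half plane
    moves it away from the origin; hence [(v + z) ^ (s - 1)] has no singularity
    for [v > 0] and [0 <= Re z], even on the imaginary axis. *)
Lemma cmod_addr_ge w z : 0 <= Re w -> Im w = 0 -> 0 <= Re z ->
  Re w <= cmod (w + z) /\ cmod z <= cmod (w + z).
Proof.
move=> w0 wi z0; split.
  by apply: le_trans (Re_le_cmod _); rewrite ReD lerDl.
rewrite ler_wsqrtr// !ReImE wi add0r lerD2r.
by rewrite lerXn2r ?nnegrE ?lerDr ?addr_ge0.
Qed.

Lemma cexpD z w : cexp (z + w) = cexp z * cexp w.
Proof.
by case: z w => a b [c d]; apply: complex_ext; rewrite /= expRD ?cosD ?sinD; ring.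
Qed.
Lemma cexp0 : cexp (0 : R[i]) = 1.
Proof. by rewrite /cexp/= expR0 cos0 sin0 mulr1 mulr0. Qed.
Lemma cmod_cexp z : cmod (cexp z) = expR (Re z).
Proof.
case: z => a b; rewrite /cmod /= !exprMn -mulrDr cos2Dsin2 mulr1 sqrtr_sqr.
by rewrite ger0_norm// expR_ge0.
Qed.
Lemma cexp_neq0 z : cexp z != 0.
Proof. by rewrite -cmod_gt0 cmod_cexp expR_gt0. Qed.
Lemma cexpN z : cexp (- z) = (cexp z)^-1.
Proof.
apply: (mulfI (cexp_neq0 z)).
by rewrite -cexpD subrr cexp0 mulfV// cexp_neq0.
Qed.
Lemma cexp_real x : cexp x%:C = (expR x)%:C.
Proof. by rewrite /cexp/= cos0 sin0 mulr1 mulr0. Qed.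

Lemma Re_cmod_itv z : z != 0 -> -1 <= Re z / cmod z <= 1.
Proof.
move=> z0; have m0 : 0 < cmod z by rewrite cmod_gt0.
by rewrite -ler_norml normrM normfV (ger0_norm (cmod_ge0 z)) ler_pdivrMr// mul1r normr_Re_le.
Qed.

Lemma normr_carg z : z != 0 -> `|carg z| <= pi.
Proof.
move=> /Re_cmod_itv z0.
by rewrite /carg; case: ifP => _; rewrite ?normrN ger0_norm ?acos_ge0 ?acos_lepi.
Qed.

Lemma cexp_clog z : z != 0 -> cexp (clog z) = z.
Proof.
move=> z0; have m0 : 0 < cmod z by rewrite cmod_gt0.
have zi := Re_cmod_itv z0.
have zi' : Re z / cmod z \in `[(-1), 1]%R by rewrite in_itv.
have hc : cos (carg z) = Re z / cmod z.
  by rewrite /carg; case: ifP => _; rewrite ?cosN acosK.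
have hs : sin (carg z) = Im z / cmod z.
  have h : 1 - (Re z / cmod z) ^+ 2 = (Im z / cmod z) ^+ 2.
    rewrite !exprMn exprVn cmod_sqr; field.
    by rewrite -cmod_sqr expf_eq0/= gt_eqF.
  rewrite /carg; case: ifPn => [i0|]; rewrite ?sinN sin_acos// h sqrtr_sqr normrM normfV.
    by rewrite !ger0_norm ?cmod_ge0.
  by rewrite -ltNge => i0; rewrite (ltr0_norm i0) (ger0_norm (cmod_ge0 _)) mulNr opprK.
rewrite /cexp /clog lnK ?posrE//= hc hs.
by apply: complex_ext => /=; rewrite mulrC divfK// gt_eqF.
Qed.

Lemma cpowE z w : z != 0 -> cpow z w = cexp (w * clog z).
Proof. by rewrite /cpow => /negbTE ->. Qed.

Lemma cpow_neq0 z w : z != 0 -> cpow z w != 0.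
Proof. by move=> z0; rewrite cpowE// cexp_neq0. Qed.

Lemma cpowD z w v : z != 0 -> cpow z (w + v) = cpow z w * cpow z v.
Proof. by move=> z0; rewrite !cpowE// mulrDl cexpD. Qed.

Lemma cpowN z w : z != 0 -> cpow z (- w) = (cpow z w)^-1.
Proof. by move=> z0; rewrite !cpowE// mulNr cexpN. Qed.

Lemma cpow1 z : z != 0 -> cpow z 1 = z.
Proof. by move=> z0; rewrite cpowE// mul1r cexp_clog. Qed.

Lemma real_neq0 x : 0 < x -> x%:C != 0.
Proof. by move=> x0; rewrite -cmod_gt0 cmod_real normr_gt0 gt_eqF. Qed.

Lemma clog_real x : 0 < x -> clog x%:C = (ln x)%:C.
Proof.
move=> x0; rewrite /clog cmod_real gtr0_norm// /carg /= lexx cmod_real.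
by rewrite gtr0_norm// divff ?gt_eqF// acos1.
Qed.

Lemma clogMr x z : 0 < x -> z != 0 -> clog (x%:C * z) = (ln x)%:C + clog z.
Proof.
move=> x0 z0; have m0 : 0 < cmod z by rewrite cmod_gt0.
rewrite /clog cmodM cmod_real gtr0_norm// lnM ?posrE//.
rewrite /carg cmodM cmod_real gtr0_norm// ReM ImM/= !mul0r addr0 subr0 -mulf_div.
rewrite divff ?gt_eqF// mul1r pmulr_rge0//.
by apply: complex_ext; rewrite /= ?add0r.
Qed.

Lemma cpow_real x w : 0 < x -> cpow x%:C w = cexp (w * (ln x)%:C).
Proof. by move=> x0; rewrite cpowE ?real_neq0// clog_real. Qed.

Lemma cpowMr x z w : 0 < x -> z != 0 -> cpow (x%:C * z) w = cpow x%:C w * cpow z w.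
Proof.
move=> x0 z0; rewrite cpowE ?mulf_neq0 ?real_neq0// clogMr// mulrDr cexpD.
by rewrite cpow_real// cpowE.
Qed.

Lemma cmod_cpow_real x w : 0 < x -> cmod (cpow x%:C w) = x `^ Re w.
Proof.
by move=> x0; rewrite cpow_real// cmod_cexp ReM/= mulr0 subr0 /powR gt_eqF.
Qed.

Lemma powR_exp x p : 0 < x -> x `^ p = expR (p * ln x).
Proof. by move=> x0; rewrite /powR gt_eqF. Qed.

Lemma cmod_cpow z w : z != 0 ->
  cmod (cpow z w) = expR (Re w * ln (cmod z) - Im w * carg z).
Proof. by move=> z0; rewrite cpowE// cmod_cexp ReM/=. Qed.

(** The argument lies in [[-pi, pi]], so up to the constant [exp (pi |Im w|)] a
    complex power has the size of a real one; all estimates of the kernels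
    reduce to real powers in this way. *)
Lemma cmod_cpow_le z w : z != 0 ->
  cmod (cpow z w) <= expR (pi * `|Im w|) * cmod z `^ Re w.
Proof.
move=> z0; rewrite cmod_cpow// powR_exp ?cmod_gt0// -expRD ler_expR addrC lerD2r.
rewrite (le_trans (ler_norm _))// normrN normrM mulrC ler_wpM2r//.
exact: normr_carg.
Qed.

Lemma cmod_cpow_ge z w : z != 0 ->
  expR (- (pi * `|Im w|)) * cmod z `^ Re w <= cmod (cpow z w).
Proof.
move=> z0; rewrite cmod_cpow// powR_exp ?cmod_gt0// -expRD ler_expR addrC lerD2l.
rewrite lerN2 (le_trans (ler_norm _))// normrM mulrC ler_wpM2r//.
exact: normr_carg.
Qed.

(** On the right half plane the principal logarithm is given by elementary
    functions that are differentiable everywhere they are needed, which the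
    definition through [acos] is not (it has a corner on the real axis). *)
Definition plog z : R[i] := (ln (Re z ^+ 2 + Im z ^+ 2) / 2) +i* atan (Im z / Re z).

Lemma clog_plog z : 0 < Re z -> clog z = plog z.
Proof.
move=> z0; have zn0 : z != 0.
  by rewrite -cmod_gt0 (lt_le_trans z0)// Re_le_cmod.
have m0 : 0 < cmod z by rewrite cmod_gt0.
apply: complex_ext => /=.
  by rewrite -cmod_sqr lnXn// mulr2n; field.
set q := Im z / Re z.
have hq : Re z / cmod z = cos (atan q).
  rewrite cos_atan /q.
  have -> : 1 + (Im z / Re z) ^+ 2 = (cmod z / Re z) ^+ 2.
    rewrite [RHS]exprMn cmod_sqr; field; exact: lt0r_neq0.
  by rewrite sqrtr_sqr ger0_norm ?divr_ge0 ?(ltW z0) ?cmod_ge0// invf_div.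
have p2 := atan_ltpi2 q; have p1 := atan_gtNpi2 q.
have pp := pi_gt0 R.
rewrite /carg hq; case: ifPn => [i0|].
  rewrite cosK// in_itv/=; apply/andP; split; last lra.
  by rewrite -(atan0 R) le_atan// /q divr_ge0// ltW.
rewrite -ltNge => i0; rewrite cosKN ?opprK//; apply/andP; split; first lra.
by rewrite -(atan0 R) le_atan// /q ltW// pmulr_llt0// invr_gt0.
Qed.

Lemma Re_mul_real z x : Re (z * x%:C) = Re z * x.
Proof. by rewrite ReM/= mulr0 subr0. Qed.

Lemma Re_mul_real_ge0 z x : 0 <= Re z -> 0 <= x -> 0 <= Re (z * x%:C).
Proof. by move=> z0 x0; rewrite Re_mul_real mulr_ge0. Qed.

Lemma cmod_mul_real z x : 0 <= x -> cmod (z * x%:C) = cmod z * x.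
Proof. by move=> x0; rewrite cmodM cmod_real ger0_norm. Qed.

End ComplexBasics.

(** * Differentiation and integration on the positive half line *)

Section RealCalculus.
Variable R : realType.
Implicit Types (f g : R -> R) (x y t : R).

Lemma is_derive_ext f g x (l l' : R) : is_derive x 1 f l -> f =1 g -> l = l' ->
  is_derive x 1 g l'.
Proof. by move=> fl /funext <- <-. Qed.

Lemma is_deriveM1 f g x (a b : R) : is_derive x 1 f a -> is_derive x 1 g b ->
  is_derive x 1 (fun t => f t * g t) (a * g x + f x * b).
Proof.
move=> fa gb; apply: is_derive_ext (is_deriveM fa gb) _ _ => //.
by rewrite /GRing.scale/= addrC; congr (_ + _); rewrite mulrC.
Qed.

Lemma is_deriveD1 f g x (a b : R) : is_derive x 1 f a -> is_derive x 1 g b ->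
  is_derive x 1 (fun t => f t + g t) (a + b).
Proof. by move=> fa gb; exact: is_derive_ext (is_deriveD fa gb) _ _. Qed.

Lemma is_deriveN1 f x (a : R) : is_derive x 1 f a ->
  is_derive x 1 (fun t => - f t) (- a).
Proof. by move=> fa; exact: is_derive_ext (is_deriveN fa) _ _. Qed.

Lemma is_deriveV1 f x (a : R) : f x != 0 -> is_derive x 1 f a ->
  is_derive x 1 (fun t => (f t)^-1) (- (a / f x ^+ 2)).
Proof.
move=> f0 fa; apply: is_derive_ext (is_deriveV f0 fa) _ _ => //.
by rewrite /GRing.scale/= mulNr mulrC.
Qed.

Lemma is_derive_comp1 g f x (a b : R) :
  is_derive (f x) 1 g a -> is_derive x 1 f b ->
  is_derive x 1 (fun t => g (f t)) (a * b).
Proof. by move=> ga fb; exact: is_derive_ext (is_derive1_comp ga fb) _ _. Qed.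

Lemma is_derive_cst1 (c : R) x : is_derive x 1 (fun=> c) 0.
Proof. exact: is_derive_cst. Qed.

Lemma is_derive_id1 x : is_derive x 1 (fun t : R => t) 1.
Proof. exact: is_derive_id. Qed.

Lemma is_derive_continuous f x (l : R) : is_derive x 1 f l -> {for x, continuous f}.
Proof. by case=> fd _; apply: differentiable_continuous; exact/derivable1_diffP. Qed.

(** The positive half line is exhausted by compact intervals, on which the
    fundamental theorem of calculus applies. *)
Definition exhaust (n : nat) : set R := `[n.+2%:R^-1, n.+2%:R]%classic.

Lemma exhaust_bounds n : (0 : R) < n.+2%:R^-1 /\ (n.+2%:R^-1 : R) < n.+2%:R.
Proof.
have h : (1 : R) < n.+2%:R by rewrite ltr1n.
split; first by rewrite invr_gt0 ltr0n.
by rewrite (lt_trans _ h)// invf_lt1// (lt_trans _ h).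
Qed.

Lemma exhaust_sub n : exhaust n `<=` `]0, +oo[%classic.
Proof.
move=> x; rewrite /exhaust/= !in_itv/= => /andP[h _]; rewrite andbT.
by apply: lt_le_trans h; case: (exhaust_bounds n).
Qed.

Lemma exhaust_mono : {homo exhaust : n m / (n <= m)%N >-> (n <= m)%O}.
Proof.
move=> n m nm; apply/subsetPset => x; rewrite /exhaust/= !in_itv/= => /andP[h1 h2].
rewrite (le_trans _ h1) ?(le_trans h2)// ?ler_nat// lef_pV2 ?posrE// ?ltr0n//.
by rewrite ler_nat.
Qed.

Lemma exhaust_ex x : 0 < x -> exists n, exhaust n x.
Proof.
move=> x0; exists (Num.truncn (x + x^-1)).
have h := truncnS_gt (x + x^-1).
have xi : 0 < x^-1 by rewrite invr_gt0.
have h2 : x + x^-1 < (Num.truncn (x + x^-1)).+2%:R.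
  by rewrite (lt_trans h)// ltr_nat.
rewrite /exhaust/= in_itv/= -[X in _ <= X <= _]invrK lef_pV2 ?posrE ?ltr0n//.
rewrite invrK; apply/andP; split; lra.
Qed.

Lemma exhaust_bigcup : \bigcup_n exhaust n = `]0, +oo[%classic.
Proof.
apply/seteqP; split=> [x [n _]|x]; first exact: exhaust_sub.
by rewrite /= in_itv/= andbT => /exhaust_ex[n nx]; exists n.
Qed.

Lemma FTC_exhaust f F n : (forall x, 0 < x -> is_derive x 1 F (f x)) ->
  (forall x, 0 < x -> {for x, continuous f}) ->
  (\int[lebesgue_measure]_(x in exhaust n) (f x)%:E =
   (F n.+2%:R)%:E - (F n.+2%:R^-1)%:E)%E.
Proof.
move=> dF cf; have [n0 n1] := exhaust_bounds n.
apply: continuous_FTC2 => //.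
- apply: continuous_in_subspaceT => x; rewrite inE/= in_itv/= => /andP[h _].
  by apply: cf; exact: lt_le_trans h.
- split.
  + by move=> x; rewrite in_itv/= => /andP[h _]; case: (dF x (lt_trans n0 h)).
  + by apply: cvg_at_right_filter; apply: is_derive_continuous (dF _ n0).
  + by apply: cvg_at_left_filter; apply: is_derive_continuous (dF _ (lt_trans n0 n1)).
- move=> x; rewrite in_itv/= => /andP[h _].
  by rewrite derive1E; case: (dF x (lt_trans n0 h)).
Qed.

Lemma measurable_continuous_pos f : (forall x, 0 < x -> {for x, continuous f}) ->
  measurable_fun (`]0, +oo[%classic : set R) f.
Proof.
move=> cf; apply: open_continuous_measurable_fun => [|x]; first exact: interval_open.
by rewrite inE/= in_itv/= andbT; exact: cf.
Qed.

(** Monotone convergence along the exhausting intervals; the integrand may be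
    singular at both ends. *)
Lemma ge0_integrable_of_primitive f F (M : R) :
  (forall x, 0 < x -> is_derive x 1 F (f x)) ->
  (forall x, 0 < x -> {for x, continuous f}) ->
  (forall x, 0 < x -> 0 <= f x) ->
  (forall x, 0 < x -> 0 <= F x <= M) ->
  (@lebesgue_measure R).-integrable `]0, +oo[ (EFin \o f) /\
  \int[@lebesgue_measure R]_(x in `]0, +oo[) f x <= M.
Proof.
move=> dF cf f0 FM.
have mf := measurable_continuous_pos cf.
have le_n n : (\int[lebesgue_measure]_(x in exhaust n) (f x)%:E <= M%:E)%E.
  have [n0 n1] := exhaust_bounds n.
  rewrite (FTC_exhaust n dF cf) -EFinB lee_fin.
  have /andP[_ h1] := FM _ (lt_trans n0 n1); have /andP[h2 _] := FM _ n0.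
  lra.
have lim : (\int[lebesgue_measure]_(x in exhaust n) (f x)%:E @[n --> \oo] -->
   \int[lebesgue_measure]_(x in `]0%R, +oo[) (f x)%:E)%E.
  rewrite -exhaust_bigcup; apply: ge0_nondecreasing_set_cvg_integral => //.
  - exact: exhaust_mono.
  - by move=> n; exact: measurable_itv.
  - move=> n; apply/measurable_EFinP; apply: measurable_funS mf => //.
    exact: exhaust_sub.
  - move=> n x /exhaust_sub; rewrite /= in_itv/= andbT => x0.
    by rewrite lee_fin f0.
have leM : (\int[lebesgue_measure]_(x in `]0%R, +oo[) (f x)%:E <= M%:E)%E.
  rewrite -(cvg_lim _ lim)//; apply: lime_le; first exact: cvgP lim.
  exact: nearW.
have ge0 : (0 <= \int[lebesgue_measure]_(x in `]0%R, +oo[) (f x)%:E)%E.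
  by apply: integral_ge0 => x; rewrite /= in_itv/= andbT => x0; rewrite lee_fin f0.
split.
  apply/integrableP; split; first exact/measurable_EFinP.
  apply: le_lt_trans (ltry M); apply: le_trans (leM).
  rewrite le_eqVlt; apply/orP; left; apply/eqP.
  apply: eq_integral => x; rewrite inE/= in_itv/= andbT => x0.
  by rewrite /= ger0_norm// f0.
rewrite /Rintegral -lee_fin fineK// ge0_fin_numE//.
exact: le_lt_trans leM (ltry _).
Qed.

(** The primitive is only evaluated along [n^-1] and [n], which suffices because
    the integral over the half line is the limit of the integrals over the
    exhausting intervals. *)
Lemma integral_of_primitive f F (p q : R) :
  (forall x, 0 < x -> is_derive x 1 F (f x)) ->
  (forall x, 0 < x -> {for x, continuous f}) ->
  (@lebesgue_measure R).-integrable `]0, +oo[ (EFin \o f) ->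
  F n.+2%:R^-1 @[n --> \oo] --> p -> F n.+2%:R @[n --> \oo] --> q ->
  \int[@lebesgue_measure R]_(x in `]0, +oo[) f x = q - p.
Proof.
move=> dF cf fi Fp Fq.
have mf := measurable_continuous_pos cf.
have [] := @dominated_convergence _ _ R lebesgue_measure (`]0%R, +oo[%classic : set R)
  (measurable_itv _) (fun n => (EFin \o f) \_ (exhaust n)) (EFin \o f) (abse \o (EFin \o f)).
- move=> n; apply/(measurable_restrict _ _ _).1 => //; first exact: measurable_itv.
  by apply/measurable_EFinP; apply: measurable_funS mf => // x [].
- exact/measurable_EFinP.
- apply: aeW => x /=; rewrite in_itv/= andbT => /exhaust_ex[n nx].
  apply: cvg_near_cst; exists n => // m /= nm.
  rewrite patchE mem_set//.
  by have /subsetPset := exhaust_mono nm; apply.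
- exact: integrable_abse.
- apply: aeW => x n _ /=; rewrite patchE; case: ifPn => // _.
  by rewrite (_ : point = 0%E)// abse0 lee_fin.
move=> _ _ lim.
have e : (fun n => \int[lebesgue_measure]_(x in `]0%R, +oo[) ((EFin \o f) \_ (exhaust n)) x)%E
  = fun n => ((F n.+2%:R - F n.+2%:R^-1)%:E).
  apply/funext => n; rewrite -integral_mkcondr setIidr; last exact: exhaust_sub.
  by rewrite (FTC_exhaust n dF cf) EFinB.
rewrite e in lim.
rewrite /Rintegral.
suff -> : (\int[lebesgue_measure]_(x in `]0%R, +oo[) (f x)%:E = (q - p)%:E)%E by [].
apply: cvg_unique lim _ => //.
by apply: cvg_EFin; [exact: nearW|apply: cvgB].
Qed.

End RealCalculus.

Section ComplexCalculus.
Variable R : realType.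
Implicit Types (f g : R -> R[i]) (x y t : R) (l : R[i]).

(** Differentiation along a real parameter, componentwise: contour arguments are
    replaced by differentiation in a real parameter throughout. *)
Definition cderiv f x l : Prop :=
  is_derive x 1 (fun t => Re (f t)) (Re l) /\ is_derive x 1 (fun t => Im (f t)) (Im l).

Definition ccont f x : Prop :=
  {for x, continuous (fun t => Re (f t))} /\ {for x, continuous (fun t => Im (f t))}.

Lemma cderiv_ccont f x l : cderiv f x l -> ccont f x.
Proof. by move=> [a b]; split; [exact: is_derive_continuous a|exact: is_derive_continuous b]. Qed.

Lemma cderiv_ext f g x l l' : cderiv f x l -> f =1 g -> l = l' -> cderiv g x l'.
Proof. by move=> fl /funext <- <-. Qed.

Lemma cderiv_cst (c : R[i]) x : cderiv (fun=> c) x 0.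
Proof. by split; exact: is_derive_cst1. Qed.

Lemma cderiv_real (f : R -> R) x (l : R) : is_derive x 1 f l ->
  cderiv (fun t => (f t)%:C) x l%:C.
Proof. by move=> fl; split=> //=; exact: is_derive_cst1. Qed.

Lemma cderiv_id x : cderiv (fun t => t%:C) x 1.
Proof. exact: (@cderiv_real (fun t => t) x 1 (is_derive_id1 x)). Qed.

Lemma cderivD f g x l l' : cderiv f x l -> cderiv g x l' ->
  cderiv (fun t => f t + g t) x (l + l').
Proof.
move=> [f1 f2] [g1 g2]; split.
  by apply: is_derive_ext (is_deriveD1 f1 g1) _ _ => [t|]; rewrite ReD.
by apply: is_derive_ext (is_deriveD1 f2 g2) _ _ => [t|]; rewrite ImD.
Qed.

Lemma cderivM f g x l l' : cderiv f x l -> cderiv g x l' ->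
  cderiv (fun t => f t * g t) x (l * g x + f x * l').
Proof.
move=> [f1 f2] [g1 g2]; split.
  apply: is_derive_ext (is_deriveD1 (is_deriveM1 f1 g1) (is_deriveN1 (is_deriveM1 f2 g2))) _ _.
    by move=> t; rewrite ReM.
  by rewrite ReD !ReM; ring.
apply: is_derive_ext (is_deriveD1 (is_deriveM1 f1 g2) (is_deriveM1 f2 g1)) _ _.
  by move=> t; rewrite ImM.
by rewrite ImD !ImM; ring.
Qed.

Lemma cderivZ (c : R[i]) f x l : cderiv f x l -> cderiv (fun t => c * f t) x (c * l).
Proof.
move=> fl; apply: cderiv_ext (cderivM (cderiv_cst c x) fl) _ _ => //.
by rewrite mul0r add0r.
Qed.

Lemma cderiv_cexp f x l : cderiv f x l ->
  cderiv (fun t => cexp (f t)) x (l * cexp (f x)).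
Proof.
move=> [f1 f2].
have e1 := is_derive_comp1 (is_derive_expR (Re (f x))) f1.
have c1 := is_derive_comp1 (is_derive_cos (Im (f x))) f2.
have s1 := is_derive_comp1 (is_derive_sin (Im (f x))) f2.
split.
  apply: is_derive_ext (is_deriveM1 e1 c1) _ _; first by move=> t; case: (f t).
  by rewrite ReM; case: (f x) => a b /=; ring.
apply: is_derive_ext (is_deriveM1 e1 s1) _ _; first by move=> t; case: (f t).
by rewrite ImM; case: (f x) => a b /=; ring.
Qed.

Lemma cderiv_plog f x l : 0 < Re (f x) -> cderiv f x l ->
  cderiv (fun t => plog (f t)) x (l / f x).
Proof.
move=> f0 [f1 f2].
have n0 : 0 < Re (f x) * Re (f x) + Im (f x) * Im (f x).
  by rewrite ltr_pwDl ?mulr_gt0// -expr2 sqr_ge0.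
split.
  have n1 := is_deriveD1 (is_deriveM1 f1 f1) (is_deriveM1 f2 f2).
  have l1 := @is_derive_comp1 _ _ (fun t => Re (f t) * Re (f t) + Im (f t) * Im (f t)) _ _ _
    (is_derive1_ln n0) n1.
  apply: is_derive_ext (is_deriveM1 l1 (is_derive_cst1 (2^-1 : R) x)) _ _.
    by move=> t; rewrite /plog/= !expr2.
  rewrite ReM ReV ImV !expr2; field; exact: lt0r_neq0.
have q1 := is_deriveM1 f2 (is_deriveV1 (lt0r_neq0 f0) f1).
have a1 := @is_derive_comp1 _ _ (fun t => Im (f t) * (Re (f t))^-1) _ _ _
  (is_derive1_atan _) q1.
apply: is_derive_ext a1 _ _; first by move=> t.
rewrite ImM ReV ImV; field.
by rewrite (lt0r_neq0 f0) !expr2 lt0r_neq0.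
Qed.

Lemma ccontM f g x : ccont f x -> ccont g x -> ccont (fun t => f t * g t) x.
Proof.
move=> [a b] [c d]; split.
  have -> : (fun t => Re (f t * g t)) =
    (fun t => Re (f t)) * (fun t => Re (g t)) - (fun t => Im (f t)) * (fun t => Im (g t)).
    by apply/funext => t; rewrite ReM.
  by apply: continuousB; apply: continuousM.
have -> : (fun t => Im (f t * g t)) =
    (fun t => Re (f t)) * (fun t => Im (g t)) + (fun t => Im (f t)) * (fun t => Re (g t)).
  by apply/funext => t; rewrite ImM.
by apply: continuousD; apply: continuousM.
Qed.

Lemma ccontD f g x : ccont f x -> ccont g x ->
  ccont (fun t => f t + g t) x.
Proof.
move=> [f1 f2] [g1 g2]; split.
  rewrite /prop_for /continuous_at ReD; under eq_fun do rewrite ReD; exact: cvgD.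
rewrite /prop_for /continuous_at ImD; under eq_fun do rewrite ImD; exact: cvgD.
Qed.

Lemma ccont_cst (k : R[i]) x : ccont (fun=> k) x.
Proof. exact: cderiv_ccont (cderiv_cst k x). Qed.

Lemma ccontV f x : f x != 0 -> ccont f x ->
  ccont (fun t => (f t)^-1) x.
Proof.
move=> f0 [a b].
have n0 : Re (f x) ^+ 2 + Im (f x) ^+ 2 != 0.
  by rewrite -cmod_sqr expf_eq0/= cmod_eq0.
have c2 : {for x, continuous (fun t => Re (f t) ^+ 2 + Im (f t) ^+ 2)}.
  apply: cvgD; rewrite expr2; under eq_fun do rewrite expr2; exact: cvgM.
have ci : {for x, continuous (fun t => (Re (f t) ^+ 2 + Im (f t) ^+ 2)^-1)}.
  exact: cvgV.
split.
  by rewrite /prop_for /continuous_at ReV; under eq_fun do rewrite ReV; exact: cvgM.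
rewrite /prop_for /continuous_at ImV; under eq_fun do rewrite ImV.
by apply: cvgN; exact: cvgM.
Qed.

End ComplexCalculus.

(** * Limits and integrals of complex functions *)

Definition posline (R : realType) : set (measurableTypeR R) := `]0, +oo[.
Arguments posline : clear implicits.

Lemma poslineP (R : realType) (x : R) : posline R x <-> 0 < x.
Proof. by rewrite /posline/= in_itv/= andbT. Qed.

Lemma posline_out (R : realType) (x : R) : x <= 0 -> ~ posline R x.
Proof. by move=> x0 /poslineP; rewrite ltNge x0. Qed.

Section ComplexConvergence.
Variable R : realType.
Implicit Types (u v : nat -> R[i]) (l : R[i]).

Definition ccvg u l : Prop :=
  (fun n => Re (u n)) @ \oo --> Re l /\ (fun n => Im (u n)) @ \oo --> Im l.

Lemma ccvg_cst l : ccvg (fun=> l) l. Proof. by split; exact: cvg_cst. Qed.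

Lemma ccvg_ext u v l : ccvg u l -> u =1 v -> ccvg v l.
Proof. by move=> ul /funext <-. Qed.

Lemma ccvgD u v l l' : ccvg u l -> ccvg v l' -> ccvg (fun n => u n + v n) (l + l').
Proof.
move=> [a b] [c d]; split.
  by under eq_fun do rewrite ReD; rewrite ReD; exact: cvgD.
by under eq_fun do rewrite ImD; rewrite ImD; exact: cvgD.
Qed.

Lemma ccvgM u v l l' : ccvg u l -> ccvg v l' -> ccvg (fun n => u n * v n) (l * l').
Proof.
move=> [a b] [c d]; split.
  by under eq_fun do rewrite ReM; rewrite ReM; apply: cvgB; exact: cvgM.
by under eq_fun do rewrite ImM; rewrite ImM; apply: cvgD; exact: cvgM.
Qed.

Lemma ccvg_real (u : nat -> R) (l : R) : u @ \oo --> l ->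
  ccvg (fun n => (u n)%:C) l%:C.
Proof. by move=> ul; split=> //=; exact: cvg_cst. Qed.

Lemma ccvg_unique u l l' : ccvg u l -> ccvg u l' -> l = l'.
Proof.
move=> [a b] [c d]; apply: complex_ext.
  exact: cvg_unique a c.
exact: cvg_unique b d.
Qed.

Lemma ccvg_cexp u l : ccvg u l -> ccvg (fun n => cexp (u n)) (cexp l).
Proof.
have E (z : R[i]) : cexp z = (expR (Re z) * cos (Im z)) +i* (expR (Re z) * sin (Im z)).
  by case: z.
move=> [a b].
have ea : (fun n => expR (Re (u n))) @ \oo --> expR (Re l).
  exact: continuous_cvg _ (@continuous_expR R _) a.
have cb : (fun n => cos (Im (u n))) @ \oo --> cos (Im l).
  exact: continuous_cvg _ (@continuous_cos R _) b.
have sb : (fun n => sin (Im (u n))) @ \oo --> sin (Im l).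
  exact: continuous_cvg _ (@continuous_sin R _) b.
by rewrite /ccvg E; split; under eq_fun do rewrite E; exact: cvgM.
Qed.

Lemma ccvg_cmod u l : ccvg u l -> (fun n => cmod (u n)) @ \oo --> cmod l.
Proof.
move=> [a b]; rewrite /cmod.
have h : (fun n => Re (u n) ^+ 2 + Im (u n) ^+ 2) @ \oo --> Re l ^+ 2 + Im l ^+ 2.
  by rewrite !expr2; under eq_fun do rewrite !expr2; apply: cvgD; exact: cvgM.
exact: continuous_cvg _ (@sqrt_continuous R _) h.
Qed.

Lemma ccvg_squeeze u (v : nat -> R) : (forall n, cmod (u n) <= v n) ->
  v @ \oo --> 0 -> ccvg u 0.
Proof.
move=> uv v0; split; apply: norm_cvg0.
  apply: (squeeze_cvgr _ (cvg_cst 0) v0); apply: nearW => n.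
  by rewrite normr_ge0 (le_trans (normr_Re_le _)).
apply: (squeeze_cvgr _ (cvg_cst 0) v0); apply: nearW => n.
by rewrite normr_ge0 (le_trans (normr_Im_le _)).
Qed.

Lemma ccont_ccvg (f : R -> R[i]) x (v : nat -> R) : ccont f x ->
  v @ \oo --> x -> ccvg (fun n => f (v n)) (f x).
Proof.
move=> [a b] vx; split.
  exact: (@continuous_cvg _ _ _ _ _ v (fun t => Re (f t)) x).
exact: (@continuous_cvg _ _ _ _ _ v (fun t => Im (f t)) x).
Qed.

End ComplexConvergence.

Section ComplexMeasurability.
Context d (T : measurableType d) (R : realType).
Implicit Types (D : set T) (f g : T -> R[i]).

Definition cmeas D f : Prop :=
  measurable_fun D (fun x => Re (f x)) /\ measurable_fun D (fun x => Im (f x)).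

Lemma cmeas_ext D f g : cmeas D f -> (forall x, D x -> f x = g x) -> cmeas D g.
Proof.
by move=> [a b] fg; split; [apply: eq_measurable_fun a|apply: eq_measurable_fun b];
  move=> x /[1!inE] /fg ->.
Qed.

Lemma cmeas_cst D (c : R[i]) : cmeas D (fun=> c). Proof. by split; exact: measurable_cst. Qed.

Lemma cmeasD D f g : cmeas D f -> cmeas D g -> cmeas D (fun x => f x + g x).
Proof.
move=> [a b] [c e]; split.
  by under eq_fun do rewrite ReD; exact: measurable_funD.
by under eq_fun do rewrite ImD; exact: measurable_funD.
Qed.

Lemma cmeasM D f g : cmeas D f -> cmeas D g -> cmeas D (fun x => f x * g x).
Proof.
move=> [a b] [c e]; split.
  by under eq_fun do rewrite ReM; apply: measurable_funB; exact: measurable_funM.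
by under eq_fun do rewrite ImM; apply: measurable_funD; exact: measurable_funM.
Qed.

Lemma cmeas_real D (f : T -> R) : measurable_fun D f -> cmeas D (fun x => (f x)%:C).
Proof. by move=> mf; split=> //; exact: measurable_cst. Qed.

Lemma cmeas_cexp D f : cmeas D f -> cmeas D (fun x => cexp (f x)).
Proof.
have E z : cexp z = (expR (Re z) * cos (Im z)) +i* (expR (Re z) * sin (Im z)) :> R[i].
  by case: z.
have mc : measurable_fun [set: R] (@cos R).
  by apply: continuous_measurable_fun; exact: continuous_cos.
have ms : measurable_fun [set: R] (@sin R).
  by apply: continuous_measurable_fun; exact: continuous_sin.
move=> [a b]; split; under eq_fun do rewrite E/=; apply: measurable_funM;
  exact: measurableT_comp.
Qed.

Lemma measurable_cmod D f : cmeas D f -> measurable_fun D (fun x => cmod (f x)).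
Proof.
have ms : measurable_fun [set: R] (@Num.sqrt R).
  by apply: continuous_measurable_fun; exact: sqrt_continuous.
move=> [a b]; apply: (measurableT_comp ms) => //.
by apply: measurable_funD; exact: measurable_funX.
Qed.

Lemma cmeas_sub (D E : set T) f : measurable E -> D `<=` E -> cmeas E f -> cmeas D f.
Proof. by move=> mE DE [a b]; split; exact: measurable_funS DE _. Qed.

End ComplexMeasurability.

Lemma cmeas_comp d (T : measurableType d) (R : realType) (f : R -> R[i]) (g : T -> R) (D : set T) :
  cmeas setT f -> measurable_fun D g -> cmeas D (fun x => f (g x)).
Proof.
move=> [a b] mg; split.
  exact: (measurableT_comp (f := fun t => Re (f t))).
exact: (measurableT_comp (f := fun t => Im (f t))).
Qed.

Lemma ccont_cmeas (R : realType) (f : R -> R[i]) : (forall x, 0 < x -> ccont f x) ->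
  cmeas (posline R) f.
Proof. by move=> cf; split; apply: measurable_continuous_pos => x /cf[]. Qed.

Section ComplexIntegralTheory.
Variable R : realType.
Local Notation mu := (@lebesgue_measure R).
Implicit Types (D : set (measurableTypeR R)) (f g : R -> R[i]).

Lemma cintegrable_cmeas D f : cintegrable D f -> cmeas D f.
Proof.
by move=> [a b]; split; apply/measurable_EFinP;
  [have := measurable_int _ a|have := measurable_int _ b].
Qed.

Lemma cintegrable_le D f (g : R -> R) : measurable D -> cmeas D f ->
  mu.-integrable D (EFin \o g) -> (forall x, D x -> cmod (f x) <= g x) ->
  cintegrable D f.
Proof.
move=> mD [a b] ig fg; split; apply: le_integrable ig => //.
- exact/measurable_EFinP.
- move=> x Dx /=; rewrite lee_fin (le_trans (normr_Re_le _))//.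
  by rewrite (le_trans (fg _ Dx))// ler_norm.
- exact/measurable_EFinP.
- move=> x Dx /=; rewrite lee_fin (le_trans (normr_Im_le _))//.
  by rewrite (le_trans (fg _ Dx))// ler_norm.
Qed.

Lemma cintegrable_cmod D f : measurable D -> cintegrable D f ->
  mu.-integrable D (EFin \o (fun x => cmod (f x))).
Proof.
move=> mD fi; have mf := cintegrable_cmeas fi; have [a b] := fi.
have := integrableD mD (integrable_abse a) (integrable_abse b).
apply: le_integrable => //.
  by apply/measurable_EFinP; exact: measurable_cmod.
move=> x Dx /=; rewrite lee_fin (ger0_norm (cmod_ge0 _)).
by rewrite ger0_norm ?addr_ge0// cmod_le_ReIm.
Qed.

Lemma cintegral_ext D f g : (forall x, D x -> f x = g x) ->
  cintegral D f = cintegral D g.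
Proof.
move=> fg; rewrite /cintegral; congr (_ +i* _); apply: eq_Rintegral => x /[1!inE] Dx;
  by rewrite fg.
Qed.

Lemma cintegrable_ext D f g : measurable D -> cintegrable D f ->
  (forall x, D x -> f x = g x) -> cintegrable D g.
Proof.
by move=> mD [a b] fg; split; [apply: eq_integrable a|apply: eq_integrable b] => //;
  move=> x /[1!inE] Dx; rewrite fg.
Qed.

Lemma cintegralD D f g : measurable D -> cintegrable D f -> cintegrable D g ->
  cintegral D (fun x => f x + g x) = cintegral D f + cintegral D g.
Proof.
move=> mD [a b] [c d]; apply: complex_ext => /=.
  by under eq_Rintegral do rewrite ReD; rewrite RintegralD.
by under eq_Rintegral do rewrite ImD; rewrite RintegralD.
Qed.

Lemma cintegrableD D f g : measurable D -> cintegrable D f -> cintegrable D g ->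
  cintegrable D (fun x => f x + g x).
Proof.
move=> mD [a b] [c d]; split.
  apply: eq_integrable (integrableD mD a c) => // x _ /=; by rewrite ReD.
apply: eq_integrable (integrableD mD b d) => // x _ /=; by rewrite ImD.
Qed.

Lemma cintegrableZ D (c : R[i]) f : measurable D -> cintegrable D f ->
  cintegrable D (fun x => c * f x).
Proof.
move=> mD fi; have ci := integrableZl mD (cmod c) (cintegrable_cmod mD fi).
apply: (@cintegrable_le _ _ (fun x => cmod c * cmod (f x))) => //.
  by apply: cmeasM; [exact: cmeas_cst|exact: cintegrable_cmeas].
by move=> x _; rewrite cmodM.
Qed.

Lemma cintegralZ D (c : R[i]) f : measurable D -> cintegrable D f ->
  cintegral D (fun x => c * f x) = c * cintegral D f.
Proof.
move=> mD [a b].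
have rl (r : R) h : mu.-integrable D (EFin \o h) -> mu.-integrable D (EFin \o (fun x => r * h x)).
  exact: integrableZl.
apply: complex_ext; rewrite ?ReM ?ImM /=.
  by under eq_Rintegral do rewrite ReM; rewrite RintegralB ?RintegralZl//; exact: rl.
by under eq_Rintegral do rewrite ImM; rewrite RintegralD ?RintegralZl//; exact: rl.
Qed.

(** The factor [2] comes from estimating the real and the imaginary part
    separately; it is harmless since only the existence of constants matters. *)
Lemma cmod_cintegral_le D f (g : R -> R) : measurable D -> cintegrable D f ->
  mu.-integrable D (EFin \o g) -> (forall x, D x -> cmod (f x) <= g x) ->
  cmod (cintegral D f) <= 2 * \int[mu]_(x in D) g x.
Proof.
move=> mD [a b] ig fg.
have h p : mu.-integrable D (EFin \o p) -> (forall x, D x -> `|p x| <= g x) ->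
    `|\int[mu]_(x in D) p x| <= \int[mu]_(x in D) g x.
  move=> ip pg; rewrite (le_trans (le_normr_Rintegral mD ip))//.
  by apply: le_Rintegral => //; exact: integrable_norm.
have h1 := h _ a (fun x Dx => le_trans (normr_Re_le _) (fg x Dx)).
have h2 := h _ b (fun x Dx => le_trans (normr_Im_le _) (fg x Dx)).
rewrite (le_trans (cmod_le_ReIm _))//= mulrDl mul1r.
exact: lerD.
Qed.

Lemma cdominated D (f_ : nat -> R -> R[i]) f (g : R -> R) : measurable D ->
  (forall n, cmeas D (f_ n)) ->
  (forall x, D x -> ccvg (f_ ^~ x) (f x)) ->
  mu.-integrable D (EFin \o g) ->
  (forall n x, D x -> cmod (f_ n x) <= g x) ->
  cintegrable D f /\ ccvg (fun n => cintegral D (f_ n)) (cintegral D f).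
Proof.
move=> mD mf cf ig fg.
have H (p_ : nat -> R -> R) p : (forall n, measurable_fun D (p_ n)) ->
  (forall x, D x -> p_ ^~ x @ \oo --> p x) -> (forall n x, D x -> `|p_ n x| <= g x) ->
  mu.-integrable D (EFin \o p) /\
  \int[mu]_(x in D) p_ n x @[n --> \oo] --> \int[mu]_(x in D) p x.
  move=> mp cp pg.
  have [] := @dominated_convergence _ _ R mu D mD (fun n => EFin \o p_ n) (EFin \o p) (EFin \o g).
  - by move=> n; exact/measurable_EFinP.
  - by apply/measurable_EFinP; apply: (measurable_fun_cvg mp) => x; exact: cp.
  - by apply: aeW => x Dx; apply: cvg_EFin; [exact: nearW|exact: cp].
  - exact: ig.
  - by apply: aeW => x n Dx /=; rewrite lee_fin pg.
  move=> ip _ lim; split => //.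
  rewrite /Rintegral; apply: fine_cvg; rewrite fineK//.
  by apply: integrable_fin_num.
have [i1 c1] := H (fun n x => Re (f_ n x)) (fun x => Re (f x)) (fun n => (mf n).1)
  (fun x Dx => (cf x Dx).1) (fun n x Dx => le_trans (normr_Re_le _) (fg n x Dx)).
have [i2 c2] := H (fun n x => Im (f_ n x)) (fun x => Im (f x)) (fun n => (mf n).2)
  (fun x Dx => (cf x Dx).2) (fun n x Dx => le_trans (normr_Im_le _) (fg n x Dx)).
by split; split.
Qed.

Lemma measurable_posline : measurable (posline R).
Proof. exact: measurable_itv. Qed.

Lemma halfline_measurable : measurable (@halfline R).
Proof. exact: measurable_itv. Qed.

Lemma pos_halfline : posline R `<=` @halfline R.
Proof. by move=> x /poslineP x0; rewrite /halfline/= in_itv/= ltW. Qed.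

Lemma cintegrable_pos f : cintegrable (@halfline R) f -> cintegrable (posline R) f.
Proof.
by move=> [a b]; split; [apply: integrableS a|apply: integrableS b] => //;
  first [exact: halfline_measurable|exact: measurable_posline|exact: pos_halfline].
Qed.

Lemma cintegral_halfline f : cmeas (posline R) f ->
  cintegral (@halfline R) f = cintegral (posline R) f.
Proof.
move=> [a b]; rewrite /cintegral /Rintegral; congr (fine _ +i* fine _);
  by rewrite /halfline integral_itv_obnd_cbnd//; exact/measurable_EFinP.
Qed.

Lemma cintegral_of_primitive f (F : R -> R[i]) (p q : R[i]) :
  (forall x, 0 < x -> cderiv F x (f x)) ->
  (forall x, 0 < x -> ccont f x) ->
  cintegrable (posline R) f ->
  ccvg (fun n => F n.+2%:R^-1) p -> ccvg (fun n => F n.+2%:R) q ->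
  cintegral (posline R) f = q - p.
Proof.
move=> dF cf [a b] [p1 p2] [q1 q2]; apply: complex_ext; rewrite ?ReD ?ImD ?ReN ?ImN/=.
  apply: (integral_of_primitive (F := fun x => Re (F x))) p1 q1 => //.
    by move=> x /dF[].
  by move=> x /cf[].
apply: (integral_of_primitive (F := fun x => Im (F x))) p2 q2 => //.
  by move=> x /dF[].
by move=> x /cf[].
Qed.

End ComplexIntegralTheory.
Arguments measurable_posline R : clear implicits.

(** * Integrable power densities *)

Section PowerDensities.
Variable R : realType.
Local Notation mu := (@lebesgue_measure R).
Implicit Types (a c p q r w x : R) (D : set (measurableTypeR R)).

Definition rint (D : set (measurableTypeR R)) (g : R -> R) : Prop :=
  mu.-integrable D (EFin \o g).

Lemma rintZ D c (f : R -> R) : measurable D -> rint D f -> rint D (fun x => c * f x).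
Proof. by move=> mD; exact: integrableZl. Qed.

Lemma rintD D (f g : R -> R) : measurable D -> rint D f -> rint D g ->
  rint D (fun x => f x + g x).
Proof. by move=> mD; exact: integrableD. Qed.

Lemma rint_le D (f g : R -> R) : measurable D -> measurable_fun D f ->
  rint D g -> (forall x, D x -> `|f x| <= g x) -> rint D f.
Proof.
move=> mD mf ig fg; apply: le_integrable ig => //; first exact/measurable_EFinP.
by move=> x Dx; rewrite /= lee_fin (le_trans (fg x Dx))// ler_norm.
Qed.

Lemma is_derive_powR p x : 0 < x -> is_derive x 1 (fun t => t `^ p) (p * x `^ (p - 1)).
Proof.
move=> x0; have xi : x \in `]0, +oo[ by rewrite in_itv/= x0.
have := @powR_derive1 R p x xi; rewrite derive1E => <-.
exact/derivableP/derivable_powR.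
Qed.

Lemma is_derive_powR_comp (f : R -> R) p x (b : R) : 0 < f x -> is_derive x 1 f b ->
  is_derive x 1 (fun t => f t `^ p) (p * f x `^ (p - 1) * b).
Proof.
move=> f0 fb.
exact: (@is_derive_comp1 _ (fun u => u `^ p) f x _ _ (is_derive_powR p f0) fb).
Qed.

Lemma is_derive_shift1 r x : is_derive x 1 (fun t : R => t + r) 1.
Proof.
by apply: is_derive_ext (is_deriveD1 (is_derive_id1 x) (is_derive_cst1 r x)) _ _ => //;
  rewrite addr0.
Qed.

(** The derivative of [(w / (w + r)) ^ a / a]: a density whose total mass
    does not depend on [r], with the singularity [w ^ (a - 1)] at the origin. *)
Definition ratio_density a r w : R := (w / (w + r)) `^ a * (r / (w * (w + r))).

Lemma ratio_density_int a r : 0 < a -> 0 < r ->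
  rint (posline R) (ratio_density a r) /\
  \int[mu]_(w in posline R) ratio_density a r w <= a^-1.
Proof.
move=> a0 r0.
have W w : 0 < w -> 0 < w + r by move=> w0; rewrite addr_gt0.
have Q w : 0 < w -> 0 < w / (w + r) by move=> w0; rewrite divr_gt0// W.
have dinv w : 0 < w -> is_derive w 1 (fun t => (t + r)^-1) (- (1 / (w + r) ^+ 2)).
  move=> w0; exact: (@is_deriveV1 _ (fun t => t + r) _ _ (lt0r_neq0 (W _ w0)) (is_derive_shift1 r w)).
have dq w : 0 < w -> is_derive w 1 (fun t => t / (t + r)) (r / (w + r) ^+ 2).
  move=> w0; apply: is_derive_ext (is_deriveM1 (is_derive_id1 w) (dinv _ w0)) _ _ => //.
  by field; exact: lt0r_neq0 (W _ w0).
have dp b w : 0 < w -> is_derive w 1 (fun t => (t / (t + r)) `^ b)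
    (b * (w / (w + r)) `^ (b - 1) * (r / (w + r) ^+ 2)).
  move=> w0; exact: (@is_derive_powR_comp (fun t => t / (t + r)) b w _ (Q _ w0) (dq _ w0)).
apply: (@ge0_integrable_of_primitive _ _ (fun w => a^-1 * (w / (w + r)) `^ a)).
- move=> w w0; apply: is_derive_ext (is_deriveM1 (is_derive_cst1 a^-1 w) (dp a w w0)) _ _ => //.
  have e : (w / (w + r)) `^ a = (w / (w + r)) `^ (a - 1) * (w / (w + r)).
    rewrite -{3}(powRr1 (ltW (Q _ w0))) -powRD ?subrK//.
    by apply/implyP => _; exact: lt0r_neq0 (Q _ w0).
  rewrite /ratio_density e mul0r add0r; field.
  by rewrite !lt0r_neq0// W.
- move=> w w0.
  have d1 := @is_deriveV1 _ (fun t => t * (t + r)) _ _ (lt0r_neq0 (mulr_gt0 w0 (W _ w0)))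
    (is_deriveM1 (is_derive_id1 w) (is_derive_shift1 r w)).
  have d2 := is_deriveM1 (dp a w w0) (is_deriveM1 (is_derive_cst1 r w) d1).
  exact: is_derive_continuous d2.
- by move=> w w0; rewrite mulr_ge0 ?powR_ge0// divr_ge0 ?ltW// mulr_gt0// W.
- move=> w w0; rewrite mulr_ge0 ?powR_ge0 ?invr_ge0 ?(ltW a0)//=.
  rewrite ler_piMr ?invr_ge0 ?(ltW a0)// -[leRHS](powRr0 (w / (w + r))).
  rewrite ger_powR ?(ltW a0)// Q//= ler_pdivrMr ?W// mul1r lerDl ltW//.
Qed.

Lemma ratio_density_ge0 a r w : 0 < r -> 0 < w -> 0 <= ratio_density a r w.
Proof. by move=> r0 w0; rewrite mulr_ge0 ?powR_ge0// divr_ge0 ?mulr_ge0 ?addr_ge0 ?ltW. Qed.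

Lemma ratio_densityE a r w : 0 < r -> 0 < w ->
  ratio_density a r w = w `^ (a - 1) * r * (w + r) `^ (- a - 1).
Proof.
move=> r0 w0; have W : 0 < w + r by rewrite addr_gt0.
rewrite /ratio_density !powR_exp ?divr_gt0// ln_div ?posrE//.
have -> : r / (w * (w + r)) = r * (expR (- ln w) * expR (- ln (w + r))).
  by rewrite !expRN !lnK ?posrE// -invfM.
rewrite mulrCA -!expRD [RHS]mulrAC -expRD mulrC.
by congr (expR _ * _); ring.
Qed.

(** [- (v + 1) ^ (- q) / q] is a bounded primitive. *)
Lemma tail_density_int q : 0 < q ->
  rint (posline R) (fun w => (w + 1) `^ (- q - 1)).
Proof.
move=> q0.
have W w : 0 < w -> 0 < w + 1 by move=> w0; rewrite addr_gt0.
have dp b w : 0 < w -> is_derive w 1 (fun t => (t + 1) `^ b) (b * (w + 1) `^ (b - 1) * 1).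
  by move=> w0; exact: (@is_derive_powR_comp (fun t => t + 1) b w _ (W _ w0) (is_derive_shift1 1 w)).
suff [] : rint (posline R) (fun w => (w + 1) `^ (- q - 1)) /\
  \int[mu]_(w in posline R) (w + 1) `^ (- q - 1) <= q^-1 by [].
apply: (@ge0_integrable_of_primitive _ _ (fun w => q^-1 + (- q^-1) * (w + 1) `^ (- q))).
- move=> w w0; apply: is_derive_ext (is_deriveD1 (is_derive_cst1 _ w)
    (is_deriveM1 (is_derive_cst1 _ w) (dp _ w w0))) _ _ => //.
  by rewrite mul0r !add0r mulr1; field; exact: lt0r_neq0.
- by move=> w w0; exact: is_derive_continuous (dp _ w w0).
- by move=> w w0; exact: powR_ge0.
- move=> w w0; rewrite mulNr; apply/andP; split; last first.
    by rewrite gerBl mulr_ge0 ?powR_ge0// invr_ge0 ltW.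
  rewrite subr_ge0 ler_piMr ?invr_ge0 ?(ltW q0)// powRN invf_le1 ?powR_gt0 ?W//.
  by rewrite -[leLHS](powRr0 (w + 1)) ler_powR ?(ltW q0)// lerDr ltW.
Qed.

Lemma exp_decay_powR p c : 0 < c ->
  exists2 C, 0 < C & forall w, 0 <= w -> (w + 1) `^ p * expR (- (c * w)) <= C.
Proof.
move=> c0; have [p0|p0] := leP p 0.
  exists 1 => // w w0; rewrite mulr_ile1 ?powR_ge0 ?expR_ge0//.
    by rewrite -[leRHS](powRr0 (w + 1)) ler_powR// lerDr.
  by rewrite -expR0 ler_expR oppr_le0 mulr_ge0// ltW.
exists (expR (c - p * ln (c / p))); first exact: expR_gt0.
move=> w w0; have W : 0 < w + 1 by rewrite ltr_wpDl.
have cp : 0 < c / p by rewrite divr_gt0.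
rewrite powR_exp// -expRD ler_expR.
have h : ln (w + 1) + ln (c / p) <= (w + 1) * (c / p).
  by rewrite -lnM ?posrE// ltW// ln_sublinear// mulr_gt0.
have h2 : p * (ln (w + 1) + ln (c / p)) <= c * (w + 1).
  rewrite -ler_pdivlMl//; apply: le_trans h _; rewrite le_eqVlt; apply/orP; left; apply/eqP.
  by field; exact: lt0r_neq0.
by move: h2; rewrite !mulrDr mulr1; lra.
Qed.

Lemma measurable_powR_pos p (f : R -> R) :
  (forall x, 0 < x -> 0 < f x) -> (forall x, 0 < x -> {for x, continuous f}) ->
  measurable_fun (posline R) (fun w => f w `^ p).
Proof.
move=> f0 cf; apply: measurable_continuous_pos => x x0.
apply: (@continuous_comp _ _ _ f (fun t => t `^ p)); first exact: cf.
exact: is_derive_continuous (is_derive_powR p (f0 _ x0)).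
Qed.

Lemma gamma_density_int a c : 0 < a -> 0 < c ->
  rint (posline R) (fun w => w `^ (a - 1) * expR (- (c * w))).
Proof.
move=> a0 c0; have [C C0 hC] := exp_decay_powR (a + 1) c0.
have [i _] := ratio_density_int a0 (@ltr01 R).
apply: (rint_le (measurable_posline R) _ (rintZ C (measurable_posline R) i)).
  apply: measurable_funM.
    apply: (@measurable_powR_pos _ (fun t => t)) => //.
    by move=> x _; exact: (is_derive_continuous (is_derive_id1 x)).
  apply: measurableT_comp => //; apply: measurableT_comp => //.
move=> w /poslineP w0; have W : 0 < w + 1 by rewrite addr_gt0.
have d0 := ratio_density_ge0 a (@ltr01 R) w0.
rewrite ger0_norm ?mulr_ge0 ?powR_ge0 ?expR_ge0//.
have -> : w `^ (a - 1) = ratio_density a 1 w * (w + 1) `^ (a + 1).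
  rewrite ratio_densityE// mulr1 -mulrA -powRD; last by rewrite (lt0r_neq0 W) implybT.
  by rewrite (_ : - a - 1 + (a + 1) = 0) ?powRr0 ?mulr1//; ring.
by rewrite -mulrA mulrC ler_wpM2r// hC// ltW.
Qed.

(** Near the origin the integrand is comparable to [ratio_density a 1], near
    infinity to the tail density with exponent [- q - 1]. *)
Lemma beta_density_int a q : 0 < a -> 0 < q ->
  rint (posline R) (fun v => v `^ (a - 1) * (v + 1) `^ (- (a + q))).
Proof.
move=> a0 q0.
have [i _] := ratio_density_int a0 (@ltr01 R).
have j := tail_density_int q0.
set C := (1 + 1 : R) `^ (1 + `|a - 1|).
have C0 : 0 <= C by exact: powR_ge0.
have mp := measurable_posline R.
apply: (rint_le mp _ (rintZ C mp (rintD mp i j))).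
  apply: measurable_funM; apply: measurable_powR_pos.
  - by move=> x.
  - by move=> x _; exact: (is_derive_continuous (is_derive_id1 x)).
  - by move=> x x0; rewrite addr_gt0.
  - by move=> x _; exact: (is_derive_continuous (is_derive_shift1 1 x)).
move=> w /poslineP w0; have W : 0 < w + 1 by rewrite addr_gt0.
have d0 := ratio_density_ge0 a (@ltr01 R) w0.
have t0 : 0 <= (w + 1) `^ (- q - 1) by exact: powR_ge0.
rewrite ger0_norm ?mulr_ge0 ?powR_ge0//.
have [w1|w1] := leP w 1.
  apply: (@le_trans _ _ (C * ratio_density a 1 w)); last first.
    by rewrite ler_wpM2l// lerDl.
  rewrite ratio_densityE// mulr1 mulrCA ler_wpM2l ?powR_ge0//.
  have -> : - (a + q) = (- a - 1) + (1 - q) by ring.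
  rewrite powRD ?(lt0r_neq0 W) ?implybT// mulrC ler_wpM2r ?powR_ge0//.
  apply: (@le_trans _ _ ((w + 1) `^ (1 + `|a - 1|))).
    by rewrite ler_powR ?lerDr ?(ltW w0)// lerD2l; have := normr_ge0 (a - 1); lra.
  by rewrite ge0_ler_powR ?nnegrE ?addr_ge0 ?(ltW w0)// ?lerD2r.
apply: (@le_trans _ _ (C * (w + 1) `^ (- q - 1))); last first.
  by rewrite ler_wpM2l// lerDr.
have -> : - (a + q) = (1 - a) + (- q - 1) by ring.
rewrite [(w + 1) `^ (1 - a + _)]powRD ?(lt0r_neq0 W) ?implybT// mulrA.
rewrite ler_wpM2r ?powR_ge0//.
rewrite /C !powR_exp ?addr_gt0// -expRD ler_expR.
have e : ln (w + 1) - ln w <= ln (1 + 1).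
  by rewrite -ln_div ?posrE// ler_ln ?posrE ?divr_gt0// ler_pdivrMr// mulrDl mul1r lerD2l ltW.
have e0 : 0 <= ln (w + 1) - ln w.
  by rewrite subr_ge0 ler_ln ?posrE// lerDl.
have -> : (a - 1) * ln w + (1 - a) * ln (w + 1) = - (a - 1) * (ln (w + 1) - ln w) by ring.
have l2 : 0 <= ln (1 + 1 : R) by exact: le_trans e.
apply: (@le_trans _ _ (`|a - 1| * (ln (w + 1) - ln w))).
  by rewrite ler_wpM2r// (le_trans (ler_norm _))// normrN.
apply: (@le_trans _ _ (`|a - 1| * ln (1 + 1))); first by rewrite ler_wpM2l.
by rewrite mulrDl mul1r lerDr.
Qed.

End PowerDensities.

(** * The kernels of the Kobayashi and Laplace type *)

Section PowerLimits.
Variable R : realType.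
Implicit Types (a c p x y l u v t : R).

(** Both monotonicity directions of [y ^ p] are covered at once, so the sign of
    the exponent never has to be discussed. *)
Lemma powR_between p l y u : 0 < l -> l <= y -> y <= u -> y `^ p <= l `^ p + u `^ p.
Proof.
move=> l0 ly yu; have y0 := lt_le_trans l0 ly; have u0 := lt_le_trans y0 yu.
have [p0|p0] := leP 0 p.
  apply: (@le_trans _ _ (u `^ p)); last by rewrite lerDr powR_ge0.
  by rewrite ge0_ler_powR ?nnegrE// ltW.
apply: (@le_trans _ _ (l `^ p)); last by rewrite lerDl powR_ge0.
by rewrite !powR_exp// ler_expR ler_wnM2l ?(ltW p0)// ler_ln ?posrE.
Qed.

Lemma powR_between_mul p l u t y : 0 < l -> 0 < t -> l * t <= y -> y <= u * t ->
  y `^ p <= (l `^ p + u `^ p) * t `^ p.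
Proof.
move=> l0 t0 ly yu; have u0 : 0 < u.
  by rewrite -(pmulr_lgt0 _ t0) (lt_le_trans _ (le_trans ly yu))// mulr_gt0.
rewrite mulrDl -!powRM ?(ltW l0) ?(ltW t0) ?(ltW u0)//.
by apply: powR_between => //; rewrite mulr_gt0.
Qed.

Lemma powR_shift_le p x : 0 < x ->
  exists2 C, 0 <= C & forall v, 0 <= v -> (v + x) `^ p <= C * (v + 1) `^ p.
Proof.
move=> x0; exists ((Num.min 1 x) `^ p + (Num.max 1 x) `^ p).
  by rewrite addr_ge0 ?powR_ge0.
move=> v v0; have v1 : 0 < v + 1 by rewrite ltr_wpDl.
have m0 : 0 < Num.min 1 x by rewrite lt_min ltr01.
have M0 : 0 < Num.max 1 x by rewrite lt_max ltr01.
apply: powR_between_mul => //.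
  by rewrite minElt; case: ifP => h; nra.
by rewrite maxElt; case: ifP => h; nra.
Qed.

Lemma invn_cvg0 : (fun n => n.+2%:R^-1 : R) @ \oo --> 0.
Proof. by have := @cvg_harmonic R; rewrite -cvg_shiftS. Qed.

Lemma invn_powR_cvg0 a : 0 < a -> (fun n => (n.+2%:R^-1 : R) `^ a) @ \oo --> 0.
Proof.
move=> a0; have /cvg_at_rightP := powR_cvg0 a0; apply.
by split; [move=> n; rewrite invr_gt0 ltr0n|exact: invn_cvg0].
Qed.

Lemma powR_exp_cvg0 a c : 0 < a -> 0 < c ->
  (fun n => (n.+2%:R^-1 : R) `^ a * expR (- (c * n.+2%:R^-1))) @ \oo --> 0 /\
  (fun n => (n.+2%:R : R) `^ a * expR (- (c * n.+2%:R))) @ \oo --> 0.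
Proof.
move=> a0 c0; split.
  apply: (squeeze_cvgr _ (cvg_cst 0) (invn_powR_cvg0 a0)); apply: nearW => n.
  rewrite mulr_ge0 ?powR_ge0 ?expR_ge0//= ler_piMr ?powR_ge0//.
  by rewrite -expR0 ler_expR oppr_le0 mulr_ge0 ?invr_ge0// ltW.
have [C C0 hC] := exp_decay_powR (a + 1) c0.
have l0 : (fun n => C * n.+2%:R^-1) @ \oo --> 0.
  by rewrite -(mulr0 C); apply: cvgMr => //; exact: invn_cvg0.
apply: (squeeze_cvgr _ (cvg_cst 0) l0); apply: nearW => n.
rewrite mulr_ge0 ?powR_ge0 ?expR_ge0//=.
have n0 : (0 : R) < n.+2%:R by rewrite ltr0n.
rewrite ler_pdivlMr// mulrAC; apply: le_trans (hC n.+2%:R (ltW n0)).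
rewrite ler_wpM2r ?expR_ge0// powRD ?(gt_eqF (addr_gt0 n0 ltr01)) ?implybT//.
have n1 : (0 : R) <= n.+2%:R + 1 by rewrite addr_ge0// ltW.
rewrite powRr1// ler_pM ?powR_ge0 ?lerDl ?ler01 ?(ltW n0)//.
by rewrite ge0_ler_powR ?nnegrE ?(ltW a0) ?(ltW n0) ?lerDl ?ler01.
Qed.

End PowerLimits.

Section Kernels.
Variable R : realType.
Local Notation mu := (@lebesgue_measure R).
Implicit Types (al s z w B : R[i]) (x v t : R).

(** The integrand [w ^ (al - 1) exp (- w) (w + z) ^ (s - 1)] of the Kobayashi
    gamma function with index [1 - s], for a complex variable [w] of the right
    half plane, so that it can be integrated along any ray of this half plane. *)
Definition kob_fun al s z w : R[i] :=
  cexp ((al - 1) * plog w - w + (s - 1) * plog (w + z)).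

Definition kob al s z : R[i] := cintegral (posline R) (fun t => kob_fun al s z t%:C).

Lemma Re_gt0_neq0 w : 0 < Re w -> w != 0.
Proof. by move=> w0; rewrite -cmod_gt0 (lt_le_trans w0)// Re_le_cmod. Qed.

Lemma kob_funE al s z w : 0 < Re w -> 0 < Re (w + z) ->
  kob_fun al s z w = cpow w (al - 1) * cexp (- w) * cpow (w + z) (s - 1).
Proof.
move=> w0 wz0; rewrite !cpowE ?Re_gt0_neq0// (clog_plog w0) (clog_plog wz0).
by rewrite /kob_fun !cexpD.
Qed.

Lemma cderiv_kob_fun al s z (f : R -> R[i]) t l : 0 < Re (f t) -> 0 < Re (f t + z) ->
  cderiv f t l ->
  cderiv (fun t => kob_fun al s z (f t)) t
    (l * ((al - 1) / f t - 1 + (s - 1) / (f t + z)) * kob_fun al s z (f t)).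
Proof.
move=> f0 fz0 fl.
have d1 := cderivZ (al - 1) (cderiv_plog f0 fl).
have d2 := cderivZ (- 1) fl.
have fz : cderiv (fun t => f t + z) t l.
  by apply: cderiv_ext (cderivD fl (cderiv_cst z t)) _ _ => //; rewrite addr0.
have d3 := cderivZ (s - 1) (@cderiv_plog _ (fun t => f t + z) _ _ fz0 fz).
have d := cderiv_cexp (cderivD (cderivD d1 d2) d3).
apply: cderiv_ext d _ _ => [u|]; first by rewrite /kob_fun mulN1r.
by rewrite /kob_fun !mulN1r; congr (_ * _); ring.
Qed.

Lemma Re_real_add v z : 0 < v -> 0 <= Re z -> 0 < Re (v%:C + z).
Proof. by move=> v0 z0; rewrite ReD/= ltr_pwDl. Qed.

Lemma cmeas_kob_fun al s z : 0 <= Re z -> cmeas (posline R) (fun t => kob_fun al s z t%:C).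
Proof.
move=> z0; apply: ccont_cmeas => v v0.
exact: cderiv_ccont (@cderiv_kob_fun al s z (fun t => t%:C) v 1 v0
  (Re_real_add v0 z0) (cderiv_id v)).
Qed.

Lemma kobayashi_gammaE al s z : 0 <= Re z ->
  kobayashi_gamma (1 - s) al z = kob al s z.
Proof.
move=> z0; rewrite /kobayashi_gamma.
have e v : posline R v -> kob_fun al s z v%:C =
    cpow v%:C (al - 1) * cexp (- v%:C) / cpow (v%:C + z) (1 - s).
  move=> /poslineP v0; rewrite kob_funE ?Re_real_add//.
  by rewrite -cpowN ?Re_gt0_neq0 ?Re_real_add// opprB.
rewrite cintegral_halfline; last exact: cmeas_ext (cmeas_kob_fun al s z0) e.
by apply: cintegral_ext => v /e ->.
Qed.

(** The constant [exp (pi |Im p|)] bounds the contribution of the argument to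
    the modulus of a complex power. *)
Definition arg_bound al s : R := expR (pi * `|Im al|) * expR (pi * `|Im s|).

Lemma arg_bound_gt0 al s : 0 < arg_bound al s.
Proof. by rewrite mulr_gt0 ?expR_gt0. Qed.

Lemma cmod_kob_fun_le al s z w : 0 < Re w -> 0 < Re (w + z) ->
  cmod (kob_fun al s z w) <= arg_bound al s *
    (cmod w `^ (Re al - 1) * expR (- Re w) * cmod (w + z) `^ (Re s - 1)).
Proof.
move=> w0 wz0; rewrite kob_funE// !cmodM cmod_cexp ReN.
have h1 := cmod_cpow_le (al - 1) (Re_gt0_neq0 w0).
have h2 := cmod_cpow_le (s - 1) (Re_gt0_neq0 wz0).
rewrite !ReD !ReN !ImD !ImN /= !subr0 in h1 h2.
have -> : arg_bound al s *
    (cmod w `^ (Re al - 1) * expR (- Re w) * cmod (w + z) `^ (Re s - 1)) =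
  (expR (pi * `|Im al|) * cmod w `^ (Re al - 1)) * expR (- Re w) *
  (expR (pi * `|Im s|) * cmod (w + z) `^ (Re s - 1)) by rewrite /arg_bound; ring.
apply: ler_pM; rewrite ?mulr_ge0 ?cmod_ge0 ?expR_ge0//.
by rewrite ler_wpM2r ?expR_ge0.
Qed.

(** The Laplace-type kernel that the substitution [w = B v] turns into
    [kob_fun]. *)
Definition lap_fun al s B x v : R[i] :=
  cexp ((al - 1) * (ln v)%:C - B * v%:C + (s - 1) * (ln (v + x))%:C).

Lemma cmod_lap_fun al s B x v : 0 < v -> 0 < v + x ->
  cmod (lap_fun al s B x v) =
  v `^ (Re al - 1) * expR (- (Re B * v)) * (v + x) `^ (Re s - 1).
Proof.
move=> v0 vx0; rewrite cmod_cexp !ReImE /= !mulr0 !subr0 !expRD.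
by rewrite !powR_exp.
Qed.

Lemma lap_funE al s B x v : 0 < v -> 0 < v + x ->
  lap_fun al s B x v = cpow v%:C (al - 1) * cexp (- (B * v%:C)) * cpow (v + x)%:C (s - 1).
Proof. by move=> v0 vx0; rewrite /lap_fun !cexpD !cpow_real. Qed.

Lemma cmeas_ln (p : R[i]) (f : R -> R) D : measurable_fun D f ->
  cmeas D (fun v => p * (ln (f v))%:C).
Proof.
move=> mf; apply: cmeasM; first exact: cmeas_cst.
by apply: cmeas_real; exact: measurableT_comp.
Qed.

Lemma cmeas_lap_fun al s B x D : measurable D -> cmeas D (lap_fun al s B x).
Proof.
move=> mD; apply: cmeas_cexp; apply: cmeasD; last first.
  by apply: cmeas_ln; exact: measurable_funD.
apply: cmeasD; first exact: cmeas_ln.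
apply: (@cmeas_ext _ _ _ _ (fun v => - B * v%:C)); last by move=> v _; rewrite mulNr.
by apply: cmeasM; [exact: cmeas_cst|exact: cmeas_real].
Qed.

End Kernels.

(** * Rotation of the ray of integration *)

Section Rotation.
Variable R : realType.
Local Notation mu := (@lebesgue_measure R).
Variables (al s B : R[i]) (x : R).
Hypotheses (al0 : 0 < Re al) (B0 : 0 < Re B) (x0 : 0 < x).
Implicit Types (v th : R) (w : R[i]).

Definition rot_min : R := Num.min 1 (Re B).
Definition rot_max : R := 1 + cmod (B - 1).

(** A path from [1] (at [0]) to [B] (at [pi / 2]) that stays on the segment
    between them for every value of its parameter, so that differentiating in
    the parameter needs no boundary discussion. *)
Definition rot_path th : R[i] := 1 + (B - 1) * (sin th * sin th)%:C.

Lemma rot_min_gt0 : 0 < rot_min. Proof. by rewrite lt_min ltr01. Qed.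
#[local] Hint Resolve rot_min_gt0 : core.
Lemma rot_max_ge1 : 1 <= rot_max. Proof. by rewrite lerDl cmod_ge0. Qed.
Lemma rot_max_gt0 : 0 < rot_max. Proof. exact: lt_le_trans rot_max_ge1. Qed.
#[local] Hint Resolve rot_max_ge1 rot_max_gt0 : core.

Lemma sin_sqr_itv th : 0 <= sin th * sin th <= 1.
Proof. by rewrite -expr2 sqr_ge0/= -(cos2Dsin2 th) lerDr sqr_ge0. Qed.

Lemma Re_rot_path_ge th : rot_min <= Re (rot_path th).
Proof.
have /andP[h1 h2] := sin_sqr_itv th.
rewrite !ReImE/= mulr0 subr0.
have a1 : rot_min <= 1 by rewrite ge_min lexx.
have a2 : rot_min <= Re B by rewrite ge_min lexx orbT.
nra.
Qed.

Lemma cmod_rot_path_le th : cmod (rot_path th) <= rot_max.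
Proof.
have /andP[h1 h2] := sin_sqr_itv th.
rewrite (le_trans (cmodD _ _))// cmod1 lerD2l cmodM cmod_real ger0_norm//.
by rewrite ler_piMr// cmod_ge0.
Qed.

Lemma Re_shift_gt0 : 0 < Re (B * x%:C).
Proof. by rewrite ReM/= mulr0 subr0 mulr_gt0. Qed.
#[local] Hint Resolve Re_shift_gt0 : core.

Definition rot_point th v : R[i] := rot_path th * v%:C.

Lemma Re_rot_point_ge th v : 0 < v -> rot_min * v <= Re (rot_point th v).
Proof. by move=> v0; rewrite ReM/= mulr0 subr0 ler_wpM2r ?(ltW v0) ?Re_rot_path_ge. Qed.
Lemma Re_rot_point_gt0 th v : 0 < v -> 0 < Re (rot_point th v).
Proof. by move=> v0; apply: lt_le_trans (Re_rot_point_ge th v0); rewrite mulr_gt0. Qed.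
Lemma Re_rot_point_shift_gt0 th v : 0 < v -> 0 < Re (rot_point th v + B * x%:C).
Proof. by move=> v0; rewrite ReD addr_gt0// Re_rot_point_gt0. Qed.
Lemma cmod_rot_point_le th v : 0 < v -> cmod (rot_point th v) <= rot_max * v.
Proof. by move=> v0; rewrite cmodM cmod_real gtr0_norm// ler_wpM2r ?(ltW v0) ?cmod_rot_path_le. Qed.

Definition rot_rate : R := rot_min / 2.
Lemma rot_rate_gt0 : 0 < rot_rate. Proof. by rewrite divr_gt0. Qed.
#[local] Hint Resolve rot_rate_gt0 : core.

(** The extra factor [v + 1] absorbs the growth of the logarithmic derivative
    that appears when the integrand is differentiated in [th]. *)
Lemma cmod_kob_rot_le : exists2 K, 0 <= K & forall th v, 0 < v ->
  cmod (kob_fun al s (B * x%:C) (rot_point th v)) * (v + 1) <=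
    K * (v `^ (Re al - 1) * expR (- (rot_rate * v))).
Proof.
set a := Re al - 1; set p := Re s - 1.
set u := rot_max + cmod B.
have u0 : 0 < u by rewrite ltr_pwDl// cmod_ge0.
have [C3 C30 h3] := powR_shift_le p x0.
have [C4 C40 h4] := exp_decay_powR (Re s) rot_rate_gt0.
set C1 := rot_min `^ a + rot_max `^ a; set C2 := rot_min `^ p + u `^ p.
have C10 : 0 <= C1 by rewrite addr_ge0 ?powR_ge0.
have C20 : 0 <= C2 by rewrite addr_ge0 ?powR_ge0.
exists (arg_bound al s * (C1 * (C2 * C3) * C4)).
  by rewrite !mulr_ge0 ?(ltW C40) ?(ltW (arg_bound_gt0 _ _)).
move=> th v v0; have v1 : 0 < v + 1 by rewrite addr_gt0.
have vx : 0 < v + x by rewrite addr_gt0.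
have h := cmod_kob_fun_le al s (Re_rot_point_gt0 th v0) (Re_rot_point_shift_gt0 th v0).
have k1 : cmod (rot_point th v) `^ a <= C1 * v `^ a.
  apply: (powR_between_mul _ rot_min_gt0 v0).
    exact: le_trans (Re_rot_point_ge th v0) (Re_le_cmod _).
  exact: cmod_rot_point_le.
have k2 : cmod (rot_point th v + B * x%:C) `^ p <= C2 * (C3 * (v + 1) `^ p).
  apply: (@le_trans _ _ (C2 * (v + x) `^ p)); last by rewrite ler_wpM2l// h3// ltW.
  apply: (powR_between_mul _ rot_min_gt0 vx).
    apply: le_trans (Re_le_cmod _); rewrite ReD mulrDr; apply: lerD; first exact: Re_rot_point_ge.
    by rewrite ReM/= mulr0 subr0 ler_wpM2r ?(ltW x0)// ge_min lexx orbT.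
  rewrite (le_trans (cmodD _ _))// /u mulrDl mulrDr [cmod B * _]mulrDr.
  have h5 := cmod_rot_point_le th v0.
  have -> : cmod (B * x%:C) = cmod B * x by rewrite cmodM cmod_real gtr0_norm.
  have : 0 <= rot_max * x by rewrite mulr_ge0// ltW.
  have : 0 <= cmod B * v by rewrite mulr_ge0 ?cmod_ge0// ltW.
  lra.
have k3 : expR (- Re (rot_point th v)) <= expR (- (rot_rate * v)) * expR (- (rot_rate * v)).
  by rewrite -expRD ler_expR; have := Re_rot_point_ge th v0; rewrite /rot_rate; lra.
have k4 : (v + 1) `^ p * (v + 1) = (v + 1) `^ Re s.
  rewrite -{2}[v + 1]powRr1 ?(ltW v1)// -powRD ?subrK//.
  by rewrite (lt0r_neq0 v1) implybT.
have k5 := h4 v (ltW v0).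
apply: (@le_trans _ _ (arg_bound al s * ((C1 * v `^ a) * (expR (- (rot_rate * v)) *
  expR (- (rot_rate * v))) *
  (C2 * (C3 * (v + 1) `^ p))) * (v + 1))).
  rewrite ler_wpM2r ?(ltW v1)// (le_trans h)// ler_wpM2l ?(ltW (arg_bound_gt0 _ _))//.
  by apply: ler_pM; rewrite ?mulr_ge0 ?powR_ge0 ?expR_ge0//; apply: ler_pM;
    rewrite ?powR_ge0 ?expR_ge0.
have -> : arg_bound al s * ((C1 * v `^ a) * (expR (- (rot_rate * v)) * expR (- (rot_rate * v))) *
  (C2 * (C3 * (v + 1) `^ p))) * (v + 1) =
  arg_bound al s * (C1 * (C2 * C3)) * (v `^ a * expR (- (rot_rate * v))) *
  ((v + 1) `^ p * (v + 1) * expR (- (rot_rate * v))) by ring.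
have -> : arg_bound al s * (C1 * (C2 * C3) * C4) * (v `^ a * expR (- (rot_rate * v))) =
  arg_bound al s * (C1 * (C2 * C3)) * (v `^ a * expR (- (rot_rate * v))) * C4 by ring.
rewrite k4 ler_wpM2l//.
by rewrite !mulr_ge0 ?powR_ge0 ?expR_ge0 ?(ltW (arg_bound_gt0 _ _)).
Qed.

(** The derivative in [v] of [v h (g v)], where [h] is the integrand and [g] the
    point of the path; up to the speed of the path it is also the derivative in
    [th] of [g h (g v)]. *)
Definition rot_deriv th v : R[i] :=
  kob_fun al s (B * x%:C) (rot_point th v) * (al - rot_point th v + (s - 1) *
    (rot_point th v / (rot_point th v + B * x%:C))).

Lemma cmod_rot_logderiv_le : exists2 K, 0 <= K & forall th v, 0 < v ->
  cmod (al - rot_point th v + (s - 1) * (rot_point th v / (rot_point th v + B * x%:C))) <= K * (v + 1).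
Proof.
exists (cmod al + rot_max + cmod (s - 1) * (rot_max / rot_min)).
  by rewrite !addr_ge0 ?mulr_ge0 ?invr_ge0 ?cmod_ge0// ltW.
move=> th v v0.
have q : cmod (rot_point th v / (rot_point th v + B * x%:C)) <= rot_max / rot_min.
  rewrite cmodM cmodV.
  have wz : rot_min * v <= cmod (rot_point th v + B * x%:C).
    apply: le_trans (Re_le_cmod _); rewrite ReD.
    by apply: le_trans (Re_rot_point_ge th v0) _; rewrite lerDl ltW.
  have wz0 : 0 < cmod (rot_point th v + B * x%:C) by apply: lt_le_trans wz; rewrite mulr_gt0.
  rewrite ler_pdivrMr// (le_trans (cmod_rot_point_le th v0))//.
  have -> : rot_max * v = rot_max / rot_min * (rot_min * v) by field; exact: lt0r_neq0.
  by rewrite ler_wpM2l// divr_ge0 ?ltW.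
apply: (le_trans (cmodD _ _)).
have h1 : cmod (al - rot_point th v) <= cmod al + rot_max * v.
  by apply: le_trans (cmodB _ _) _; rewrite lerD2l cmod_rot_point_le.
have h2 : cmod ((s - 1) * (rot_point th v / (rot_point th v + B * x%:C))) <=
  cmod (s - 1) * (rot_max / rot_min).
  by rewrite cmodM ler_wpM2l ?cmod_ge0.
have p1 : 0 <= cmod al * v by rewrite mulr_ge0 ?cmod_ge0 ?ltW.
have p2 : 0 <= cmod (s - 1) * (rot_max / rot_min) * v.
  by rewrite !mulr_ge0 ?cmod_ge0 ?invr_ge0 ?ltW.
apply: le_trans (lerD h1 h2) _; rewrite -subr_ge0.
have -> : (cmod al + rot_max + cmod (s - 1) * (rot_max / rot_min)) * (v + 1) -
    (cmod al + rot_max * v + cmod (s - 1) * (rot_max / rot_min)) =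
  cmod al * v + rot_max + cmod (s - 1) * (rot_max / rot_min) * v by ring.
exact: addr_ge0 (addr_ge0 p1 (ltW rot_max_gt0)) p2.
Qed.

Definition rot_density v := v `^ (Re al - 1) * expR (- (rot_rate * v)).
Lemma rot_density_ge0 v : 0 <= rot_density v. Proof. by rewrite mulr_ge0 ?powR_ge0 ?expR_ge0. Qed.
#[local] Hint Resolve rot_density_ge0 : core.

Lemma cmod_rot_deriv_le : exists2 K, 0 <= K & forall th v, 0 < v ->
  cmod (rot_deriv th v) <= K * rot_density v.
Proof.
have [K K0 hK] := cmod_kob_rot_le; have [L L0 hL] := cmod_rot_logderiv_le.
exists (K * L); first exact: mulr_ge0.
move=> th v v0; rewrite cmodM.
apply: (@le_trans _ _ (cmod (kob_fun al s (B * x%:C) (rot_point th v)) * (L * (v + 1)))).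
  by rewrite ler_wpM2l ?cmod_ge0// hL.
rewrite mulrCA [K * L]mulrC -mulrA ler_wpM2l//.
exact: hK.
Qed.

Lemma cmod_kob_rot_le_density : exists2 K, 0 <= K & forall th v, 0 < v ->
  cmod (kob_fun al s (B * x%:C) (rot_point th v)) <= K * rot_density v.
Proof.
have [K K0 hK] := cmod_kob_rot_le; exists K => // th v v0.
by apply: le_trans (hK th v v0); rewrite ler_peMr ?cmod_ge0// lerDr ltW.
Qed.

Lemma cderiv_rot_point th v : cderiv (fun v => rot_point th v) v (rot_path th).
Proof. by apply: cderiv_ext (cderivZ (rot_path th) (cderiv_id v)) _ _ => //; rewrite mulr1. Qed.

Lemma cderiv_rot_primitive th v : 0 < v ->
  cderiv (fun v => v%:C * kob_fun al s (B * x%:C) (rot_point th v)) v (rot_deriv th v).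
Proof.
move=> v0.
have d := @cderiv_kob_fun _ al s (B * x%:C) _ _ _ (Re_rot_point_gt0 th v0)
  (Re_rot_point_shift_gt0 th v0) (cderiv_rot_point th v).
apply: cderiv_ext (cderivM (cderiv_id v) d) _ _ => //.
rewrite mul1r /rot_deriv.
have -> : rot_path th = rot_point th v / v%:C by rewrite /rot_point mulfK// real_neq0.
field.
by rewrite (real_neq0 v0) (Re_gt0_neq0 (Re_rot_point_gt0 th v0))
  (Re_gt0_neq0 (Re_rot_point_shift_gt0 th v0)).
Qed.

Definition rot_speed th : R[i] := (B - 1) * (cos th * sin th + sin th * cos th)%:C.

Lemma cderiv_rot_path th : cderiv rot_path th (rot_speed th).
Proof.
have d := cderiv_real (is_deriveM1 (is_derive_sin th) (is_derive_sin th)).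
apply: cderiv_ext (cderivD (cderiv_cst 1 th) (cderivZ (B - 1) d)) _ _ => //.
by rewrite add0r.
Qed.

Definition rot_fun th v : R[i] := rot_path th * kob_fun al s (B * x%:C) (rot_point th v).

Lemma cderiv_rot_fun th v : 0 < v -> cderiv (fun th => rot_fun th v) th (rot_speed th * rot_deriv th v).
Proof.
move=> v0.
have dw : cderiv (fun th => rot_point th v) th (rot_speed th * v%:C).
  by apply: cderiv_ext (cderivM (cderiv_rot_path th)
    (cderiv_cst v%:C th)) _ _ => //; rewrite mulr0 addr0.
have d := @cderiv_kob_fun _ al s (B * x%:C)
  (fun th => rot_point th v) _ _ (Re_rot_point_gt0 th v0) (Re_rot_point_shift_gt0 th v0) dw.
apply: cderiv_ext (cderivM (cderiv_rot_path th) d) _ _ => //.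
rewrite /rot_deriv.
have -> : rot_path th = rot_point th v / v%:C by rewrite /rot_point mulfK// real_neq0.
field.
by rewrite (real_neq0 v0) (Re_gt0_neq0 (Re_rot_point_gt0 th v0))
  (Re_gt0_neq0 (Re_rot_point_shift_gt0 th v0)).
Qed.

Lemma ccont_rot_point th v : ccont (fun v => rot_point th v) v.
Proof. exact: cderiv_ccont (cderiv_rot_point th v). Qed.

Lemma ccont_kob_rot th v : 0 < v -> ccont (fun v => kob_fun al s (B * x%:C) (rot_point th v)) v.
Proof.
move=> v0; exact: cderiv_ccont (@cderiv_kob_fun _ al s (B * x%:C) _ _ _ (Re_rot_point_gt0 th v0)
  (Re_rot_point_shift_gt0 th v0) (cderiv_rot_point th v)).
Qed.

Lemma ccont_rot_deriv th v : 0 < v -> ccont (rot_deriv th) v.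
Proof.
move=> v0; apply: ccontM; first exact: ccont_kob_rot.
apply: ccontD; last first.
  apply: ccontM; first exact: ccont_cst.
  apply: ccontM; first exact: ccont_rot_point.
  apply: ccontV; first exact: Re_gt0_neq0 (Re_rot_point_shift_gt0 th v0).
  by apply: ccontD; [exact: ccont_rot_point|exact: ccont_cst].
apply: ccontD; first exact: ccont_cst.
exact: cderiv_ccont (cderiv_ext (cderivZ (-1) (cderiv_rot_point th v)) (fun t => mulN1r _) erefl).
Qed.

Lemma rot_density_int : rint (posline R) rot_density.
Proof. exact: gamma_density_int. Qed.

Lemma rot_deriv_int th : cintegrable (posline R) (rot_deriv th).
Proof.
have [K K0 hK] := cmod_rot_deriv_le.
apply: (cintegrable_le (measurable_posline R) _ (rintZ K (measurable_posline R) rot_density_int)).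
  by apply: ccont_cmeas => v v0; exact: ccont_rot_deriv.
by move=> v /poslineP v0; exact: hK.
Qed.

Lemma rot_fun_int th : cintegrable (posline R) (rot_fun th).
Proof.
have [K K0 hK] := cmod_kob_rot_le_density.
apply: cintegrableZ; first exact: measurable_posline.
apply: (cintegrable_le (measurable_posline R) _ (rintZ K (measurable_posline R) rot_density_int)).
  by apply: ccont_cmeas => v v0; exact: ccont_kob_rot.
by move=> v /poslineP v0; exact: hK.
Qed.

(** The primitive [v h (g v)] vanishes at both ends of the half line, at the
    origin because of [0 < Re al]. *)
Lemma cintegral_rot_deriv th : cintegral (posline R) (rot_deriv th) = 0.
Proof.
have [K K0 hK] := cmod_kob_rot_le_density.
have [l1 l2] := powR_exp_cvg0 al0 rot_rate_gt0.
have bE v : 0 < v -> cmod (v%:C * kob_fun al s (B * x%:C) (rot_point th v)) <=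
  K * (v `^ Re al * expR (- (rot_rate * v))).
  move=> v0; rewrite cmodM cmod_real gtr0_norm//.
  apply: le_trans (ler_wpM2l (ltW v0) (hK th v v0)) _.
  by rewrite /rot_density -(mulr_powRB1 (ltW v0) al0) mulrCA !mulrA.
rewrite (@cintegral_of_primitive _ _ (fun v => v%:C * kob_fun al s (B * x%:C) (rot_point th v)) 0 0).
- by rewrite subrr.
- by move=> v v0; exact: cderiv_rot_primitive.
- by move=> v v0; exact: ccont_rot_deriv.
- exact: rot_deriv_int.
- apply: (@ccvg_squeeze _ _ (fun n => K * (n.+2%:R^-1 `^ Re al * expR (- (rot_rate * n.+2%:R^-1))))).
    by move=> n; apply: bE; rewrite invr_gt0 ltr0n.
  by rewrite -(mulr0 K); exact: cvgMr.
- apply: (@ccvg_squeeze _ _ (fun n => K * (n.+2%:R `^ Re al * expR (- (rot_rate * n.+2%:R))))).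
    by move=> n; apply: bE; rewrite ltr0n.
  by rewrite -(mulr0 K); exact: cvgMr.
Qed.

Lemma cmod_rot_speed_le th : cmod (rot_speed th) <= cmod (B - 1) * 2.
Proof.
rewrite cmodM ler_wpM2l ?cmod_ge0// cmod_real.
have := cos_max th; have := sin_max th => h1 h2.
apply: (le_trans (ler_normD _ _)); rewrite !normrM.
have : `|cos th| * `|sin th| <= 1 by rewrite mulr_ile1.
have : `|sin th| * `|cos th| <= 1 by rewrite mulr_ile1.
lra.
Qed.

(** Replaces Cauchy's theorem: differentiating in the direction [g] of the ray
    amounts to differentiating in [v], so that after differentiation under the
    integral sign a total derivative remains. The statement is made for either
    component [pr] because the differentiation theorem concerns real integrands. *)
Lemma is_derive_rot_integral th (pr : R[i] -> R) (prE : pr = Re \/ pr = Im) :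
  is_derive th 1 (fun th => \int[mu]_(v in posline R) pr (rot_fun th v)) 0.
Proof.
have [K K0 hK] := cmod_rot_deriv_le.
have mp := measurable_posline R.
have dp (t v : R) : 0 < v -> is_derive t 1 (fun th => pr (rot_fun th v)) (pr (rot_speed t *
  rot_deriv t v)).
  by move=> v0; have [] := cderiv_rot_fun t v0; case: prE => ->.
have ip (t : R) : rint (posline R) (fun v => pr (rot_fun t v)).
  by have [] := rot_fun_int t; case: prE => ->.
have pr_le w : `|pr w| <= cmod w.
  by case: prE => ->; [exact: normr_Re_le|exact: normr_Im_le].
have I0 : (`]th - 1, th + 1[%classic : set R) th.
  by rewrite /= in_itv/= ltrBlDr !ltrDl ltr01.
set G := fun v => cmod (B - 1) * 2 * (K * rot_density v).
have iG : rint (posline R) G by do 2 apply: rintZ => //; exact: rot_density_int.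
have G0 v : 0 <= G v.
  exact: mulr_ge0 (mulr_ge0 (cmod_ge0 _) (ler0n R 2)) (mulr_ge0 K0 (rot_density_ge0 v)).
have d1E (t v : R) : 0 < v -> partial1of2 (fun th v => pr (rot_fun th v)) t v =
  pr (rot_speed t * rot_deriv t v).
  by move=> v0; rewrite partial1of2E; have [] := dp t v v0.
have H := @derivable_under_integral R _ (measurableTypeR R) mu (fun th v => pr (rot_fun th v))
  (posline R) mp th (th - 1) (th + 1) I0 (fun t _ => ip t)
  (fun t v _ Pv => @ex_derive _ _ _ _ _ _ _ (dp t v ((poslineP v).1 Pv))) G G0 iG.
have H' := @differentiation_under_integral R _ (measurableTypeR R) mu (fun th v => pr (rot_fun th v))
  (posline R) mp th (th - 1) (th + 1) I0 (fun t _ => ip t)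
  (fun t v _ Pv => @ex_derive _ _ _ _ _ _ _ (dp t v ((poslineP v).1 Pv))) G G0 iG.
have hG (t v : R) : (`]th - 1, th + 1[%classic : set R) t -> posline R v ->
    `|partial1of2 (fun th v => pr (rot_fun th v)) t v| <= G v.
  move=> _ /poslineP v0; rewrite d1E// (le_trans (pr_le _))// cmodM.
  by apply: ler_pM; rewrite ?cmod_ge0 ?cmod_rot_speed_le ?hK.
apply: DeriveDef; first exact: H.
rewrite -derive1E H'//.
have : pr (cintegral (posline R) (fun v => rot_speed th * rot_deriv th v)) = 0.
  rewrite cintegralZ; [|exact: mp|exact: rot_deriv_int].
  by rewrite cintegral_rot_deriv mulr0; case: prE => ->.
rewrite (_ : \int[mu]_(v in posline R) partial1of2 (fun th v => pr (rot_fun th v)) th v =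
  \int[mu]_(v in posline R) pr (rot_speed th * rot_deriv th v)); last first.
  by apply: eq_Rintegral => v; rewrite inE => /poslineP v0; exact: d1E.
by case: prE => ->.
Qed.

(** The integral of [rot_fun th] is [kob] at [th = 0], where the path is at [1],
    and becomes after the substitution [w = B v] the Laplace integral at
    [th = pi / 2], where the path is at [B]; it is independent of [th]. *)
Lemma kob_rotation :
  kob al s (B * x%:C) = cpow B (al + s - 1) * cintegral (posline R) (lap_fun al s B x).
Proof.
have [th1 r1] : exists th1, rot_path th1 = B.
  by exists (pi / 2); rewrite /rot_path sin_pihalf mul1r mulr1 addrC subrK.
have [th0 r0] : exists th0, rot_path th0 = 1.
  by exists 0; rewrite /rot_path sin0 mul0r mulr0 addr0.
have e : cintegral (posline R) (rot_fun th0) = cintegral (posline R) (rot_fun th1).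
  apply: complex_ext.
    exact: (is_derive_0_is_cst th0 th1 (fun th => is_derive_rot_integral th (or_introl erefl))).
  exact: (is_derive_0_is_cst th0 th1 (fun th => is_derive_rot_integral th (or_intror erefl))).
have Bn0 : B != 0 by exact: Re_gt0_neq0.
rewrite /kob; transitivity (cintegral (posline R) (rot_fun th0)).
  by apply: cintegral_ext => v _; rewrite /rot_fun /rot_point r0 !mul1r.
have mp := measurable_posline R.
have pE v : posline R v -> rot_fun th1 v = cpow B (al + s - 1) * lap_fun al s B x v.
  move=> /poslineP v0; have vx : 0 < v + x by rewrite addr_gt0.
  have h1 := Re_rot_point_gt0 th1 v0; have h2 := Re_rot_point_shift_gt0 th1 v0.
  rewrite /rot_fun (kob_funE _ _ h1 h2) (lap_funE _ _ _ v0 vx).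
  have -> : rot_point th1 v + B * x%:C = (v + x)%:C * B.
    by rewrite /rot_point r1 rmorphD/=; ring.
  rewrite /rot_point r1 (cpowMr _ vx Bn0) [B * v%:C]mulrC (cpowMr _ v0 Bn0).
  have -> : al + s - 1 = 1 + (al - 1) + (s - 1) by ring.
  by rewrite !(cpowD _ _ Bn0) (cpow1 Bn0); ring.
have i := cintegrable_ext mp (rot_fun_int th1) pE.
have cn0 := cpow_neq0 (al + s - 1) Bn0.
have il : cintegrable (posline R) (lap_fun al s B x).
  apply: (cintegrable_ext mp (cintegrableZ (cpow B (al + s - 1))^-1 mp i)) => v _.
  exact: mulKf.
by rewrite e (cintegral_ext pE) (cintegralZ _ mp il).
Qed.

End Rotation.

(** * Beta integrals do not vanish *)

Section BetaNonvanishing.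
Variable R : realType.
Local Notation mu := (@lebesgue_measure R).
Implicit Types (p q : R[i]) (v : R).

(** Euler's beta integral over the half line. *)
Definition beta_fun p q v : R[i] :=
  cexp ((p - 1) * (ln v)%:C - (p + q) * (ln (v + 1))%:C).

Definition cbeta p q : R[i] := cintegral (posline R) (beta_fun p q).

Lemma cmod_beta_fun p q v : 0 < v ->
  cmod (beta_fun p q v) = v `^ (Re p - 1) * (v + 1) `^ (- (Re p + Re q)).
Proof.
move=> v0; have v1 : 0 < v + 1 by rewrite addr_gt0.
rewrite cmod_cexp !ReImE /= !mulr0 !subr0 expRD !powR_exp//.
by rewrite mulNr.
Qed.

Lemma cmeas_beta_fun p q D : measurable D -> cmeas D (beta_fun p q).
Proof.
move=> mD; apply: cmeas_cexp; apply: cmeasD; first exact: cmeas_ln.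
apply: (@cmeas_ext _ _ _ _ (fun v => - (p + q) * (ln (v + 1))%:C)).
  by apply: cmeas_ln; exact: measurable_funD.
by move=> v _; rewrite mulNr.
Qed.

Lemma beta_fun_int p q : 0 < Re p -> 0 < Re q -> cintegrable (posline R) (beta_fun p q).
Proof.
move=> p0 q0; apply: (cintegrable_le (measurable_posline R) _ (beta_density_int p0 q0)).
  exact: cmeas_beta_fun (measurable_posline R).
by move=> v /poslineP v0; rewrite cmod_beta_fun.
Qed.

Lemma cexp_ln v : 0 < v -> cexp (ln v)%:C = v%:C.
Proof. by move=> v0; rewrite cexp_real lnK. Qed.

Lemma beta_funSl p q v : 0 < v -> v%:C * beta_fun p (q + 1) v = beta_fun (p + 1) q v.
Proof.
by move=> v0; rewrite -[v%:C in LHS]cexp_ln// -cexpD; congr cexp; ring.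
Qed.

Lemma beta_funSr p q v : 0 < v -> (v + 1)%:C * beta_fun p (q + 1) v = beta_fun p q v.
Proof.
move=> v0; have v1 : 0 < v + 1 by rewrite addr_gt0.
by rewrite -[(v + 1)%:C in LHS]cexp_ln// -cexpD; congr cexp; ring.
Qed.

Lemma cderiv_beta_primitive p q v : 0 < v ->
  cderiv (fun v => cexp (p * (ln v)%:C - (p + q) * (ln (v + 1))%:C)) v
    (p * beta_fun p q v - (p + q) * beta_fun (p + 1) q v).
Proof.
move=> v0; have v1 : 0 < v + 1 by rewrite addr_gt0.
have d1 := cderivZ p (cderiv_real (is_derive1_ln v0)).
have d2 := cderivZ (- (p + q)) (cderiv_real
  (@is_derive_comp1 _ (@ln R) (fun v => v + 1) _ _ _ (is_derive1_ln v1) (is_derive_shift1 1 v))).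
apply: cderiv_ext (cderiv_cexp (cderivD d1 d2)) _ _.
  by move=> t; rewrite mulNr.
set F := cexp _.
have h1 : v%:C * beta_fun p q v = F.
  by rewrite -[v%:C in LHS]cexp_ln// -cexpD /F; congr cexp; ring.
have h2 : (v + 1)%:C * beta_fun (p + 1) q v = F.
  by rewrite -[(v + 1)%:C in LHS]cexp_ln// -cexpD /F; congr cexp; ring.
rewrite mulr1 mulrDl; congr (_ + _).
  rewrite -h1 -mulrA; congr (_ * _); rewrite mulrA (_ : v^-1%:C * v%:C = 1) ?mul1r//.
  by rewrite -rmorphM/= mulVf ?gt_eqF.
rewrite -h2 -mulrA mulNr; congr (- (_ * _)).
rewrite mulrA (_ : (v + 1)^-1%:C * (v + 1)%:C = 1) ?mul1r//.
by rewrite -rmorphM/= mulVf ?gt_eqF.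
Qed.

Lemma ccont_beta_fun p q v : 0 < v -> ccont (beta_fun p q) v.
Proof.
move=> v0; have v1 : 0 < v + 1 by rewrite addr_gt0.
have d1 := cderivZ (p - 1) (cderiv_real (is_derive1_ln v0)).
have d2 := cderivZ (- (p + q)) (cderiv_real
  (@is_derive_comp1 _ (@ln R) (fun v => v + 1) _ _ _ (is_derive1_ln v1) (is_derive_shift1 1 v))).
apply: cderiv_ccont; apply: cderiv_ext (cderiv_cexp (cderivD d1 d2)) _ erefl.
by move=> t; rewrite mulNr.
Qed.

(** Integration by parts. *)
Lemma cbetaSl p q : 0 < Re p -> 0 < Re q -> p * cbeta p q = (p + q) * cbeta (p + 1) q.
Proof.
move=> p0 q0; have mp := measurable_posline R.
have p1 : 0 < Re (p + 1) by rewrite ReD/= addr_gt0.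
have i1 := cintegrableZ p mp (beta_fun_int p0 q0).
have i2 := cintegrableZ (- (p + q)) mp (beta_fun_int p1 q0).
apply/eqP; rewrite -subr_eq0 -mulNr; apply/eqP.
rewrite /cbeta -!cintegralZ//; [|exact: beta_fun_int..].
rewrite -cintegralD//.
have bE v : 0 < v -> cmod (cexp (p * (ln v)%:C - (p + q) * (ln (v + 1))%:C)) =
    v `^ Re p * (v + 1) `^ (- Re p) * (v + 1) `^ (- Re q).
  move=> v0; have v1 : 0 < v + 1 by rewrite addr_gt0.
  rewrite cmod_cexp !ReImE /= !mulr0 !subr0 !powR_exp// -!expRD; congr expR; ring.
rewrite (@cintegral_of_primitive _ _
  (fun v => cexp (p * (ln v)%:C - (p + q) * (ln (v + 1))%:C)) 0 0).
- by rewrite subrr.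
- by move=> v v0; rewrite mulNr; exact: cderiv_beta_primitive.
- move=> v v0; have c1 := ccontM (cderiv_ccont (cderiv_cst p v)) (ccont_beta_fun p q v0).
  have c2 := ccontM (cderiv_ccont (cderiv_cst (- (p + q)) v)) (ccont_beta_fun (p + 1) q v0).
  case: c1 c2 => [a b] [c d]; split.
    rewrite /prop_for /continuous_at ReD; under eq_fun do rewrite ReD; exact: cvgD.
  rewrite /prop_for /continuous_at ImD; under eq_fun do rewrite ImD; exact: cvgD.
- exact: cintegrableD.
- apply: (@ccvg_squeeze _ _ (fun n => n.+2%:R^-1 `^ Re p)); last exact: invn_powR_cvg0.
  move=> n; have n0 : (0 : R) < n.+2%:R^-1 by rewrite invr_gt0 ltr0n.
  have n1 : (1 : R) <= n.+2%:R^-1 + 1 by rewrite lerDr ltW.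
  rewrite bE// -mulrA ler_piMr ?powR_ge0// mulr_ile1 ?powR_ge0//.
    by rewrite -[leRHS](powRr0 (n.+2%:R^-1 + 1)) ler_powR// oppr_le0 ltW.
  by rewrite -[leRHS](powRr0 (n.+2%:R^-1 + 1)) ler_powR// oppr_le0 ltW.
- apply: (@ccvg_squeeze _ _ (fun n => n.+2%:R^-1 `^ Re q)); last exact: invn_powR_cvg0.
  move=> n; have n0 : (0 : R) < n.+2%:R by rewrite ltr0n.
  have n1 : (0 : R) < n.+2%:R + 1 by rewrite addr_gt0.
  have l1 : ln (n.+2%:R : R) <= ln (n.+2%:R + 1) by rewrite ler_ln ?posrE// lerDl.
  rewrite bE// !powR_exp ?invr_gt0// -!expRD ler_expR lnV ?posrE//.
  by nra.
Qed.

Lemma cbetaS p q : 0 < Re p -> 0 < Re q -> cbeta p q = cbeta p (q + 1) + cbeta (p + 1) q.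
Proof.
move=> p0 q0.
have p1 : 0 < Re (p + 1) by rewrite ReD/= addr_gt0.
have q1 : 0 < Re (q + 1) by rewrite ReD/= addr_gt0.
rewrite /cbeta -cintegralD; [|exact: measurable_posline|exact: beta_fun_int..].
apply: cintegral_ext => v /poslineP v0.
by rewrite -(beta_funSr p q v0) -(beta_funSl p q v0) rmorphD/= mulrDl mul1r addrC.
Qed.

Lemma cbeta_eq0_shift p q : 0 < Re p -> 0 < Re q -> cbeta p q = 0 ->
  forall n, cbeta (p + n%:R) (q + n%:R) = 0.
Proof.
move=> p0 q0 b0.
have step p' q' : 0 < Re p' -> 0 < Re q' -> cbeta p' q' = 0 -> cbeta (p' + 1) (q' + 1) = 0.
  move=> hp hq hb.
  have pq : p' + q' != 0 by apply: Re_gt0_neq0; rewrite ReD addr_gt0.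
  have s1 p'' : 0 < Re p'' -> cbeta p'' q' = 0 -> cbeta (p'' + 1) q' = 0.
    move=> h'' e; apply/eqP; have := cbetaSl h'' hq; rewrite e mulr0 => /esym/eqP.
    rewrite mulf_eq0 => /orP[/eqP h|//].
    by have := addr_gt0 h'' hq; rewrite -ReD h ltxx.
  have h1 := s1 _ hp hb.
  have hp1 : 0 < Re (p' + 1) by rewrite ReD/= addr_gt0.
  by have := cbetaS hp1 hq; rewrite h1 (s1 _ hp1 h1) addr0 => /esym.
have Ren (z : R[i]) n : 0 < Re z -> 0 < Re (z + n%:R).
  move=> z0; elim: n => [|n ih]; first by rewrite addr0.
  by rewrite -natr1 addrA ReD/= addr_gt0.
elim=> [|n ih]; first by rewrite !addr0.
by rewrite -natr1 !addrA; apply: step; rewrite ?Ren.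
Qed.

(** [4 v / (v + 1) ^ 2] attains its maximum [1] at [v = 1] only. *)
Definition beta_peak v : R := 4 * v / (v + 1) ^+ 2.

Lemma beta_peakE v : 0 < v -> beta_peak v = 1 - ((v - 1) / (v + 1)) ^+ 2.
Proof.
move=> v0; rewrite /beta_peak; field.
by rewrite gt_eqF// addr_gt0.
Qed.

Lemma beta_fun_addn p q n v : 0 < v ->
  (4 ^+ n)%:C * beta_fun (p + n%:R) (q + n%:R) v = (beta_peak v ^+ n)%:C * beta_fun p q v.
Proof.
move=> v0; have v1 : 0 < v + 1 by rewrite addr_gt0.
elim: n p q => [|n ih] p q; first by rewrite !addr0 !expr0.
have e1 (y : R) : (y ^+ n.+1)%:C = y%:C * (y ^+ n)%:C :> R[i] by rewrite exprS rmorphM.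
have e2 (w : R[i]) : w + n.+1%:R = w + 1 + n%:R by rewrite -nat1r addrA.
rewrite !e1 !e2 -mulrA ih mulrCA -[RHS]mulrA [RHS]mulrCA; congr (_ * _).
rewrite -(beta_funSr p q v0) -(beta_funSr p (q + 1) v0) -(beta_funSl p (q + 1) v0).
rewrite !mulrA -!rmorphM/=; congr (_ %:C * _).
by rewrite /beta_peak; field; exact: lt0r_neq0.
Qed.

(** If the beta integral vanished, so would all its integer shifts. Up to the
    factor [4 ^ n] these are the integrals of [beta_fun p q] against the powers
    [beta_peak ^ n], which concentrate at [v = 1]; there the phase of
    [beta_fun p q] is nearly constant, so that the integrals cannot vanish for
    large [n]. *)
Lemma cbeta_neq0 p q : 0 < Re p -> 0 < Re q -> cbeta p q != 0.
Proof.
move=> p0 q0; apply/eqP => b0.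
have mp := measurable_posline R.
have z1 := cbeta_eq0_shift p0 q0 b0.
set c0 := beta_fun p q 1.
have c0n : c0 != 0 by exact: cexp_neq0.
pose psi v := Re (c0^-1 * beta_fun p q v).
have psi1 : psi 1 = 1 by rewrite /psi mulVf.
have [psic _] : ccont (fun v => c0^-1 * beta_fun p q v) 1.
  exact: ccontM (cderiv_ccont (cderiv_cst _ _)) (ccont_beta_fun p q ltr01).
have ipsi : rint (posline R) psi.
  by have [] := cintegrableZ c0^-1 mp (beta_fun_int p0 q0).
have peak01 v : 0 < v -> 0 <= beta_peak v <= 1.
  move=> v0; rewrite {2}beta_peakE// gerBl sqr_ge0 andbT.
  by rewrite /beta_peak divr_ge0 ?sqr_ge0// mulr_ge0// ltW.
have inpsi n : rint (posline R) (fun v => psi v * beta_peak v ^+ n) /\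
    \int[mu]_(v in posline R) (psi v * beta_peak v ^+ n) = 0.
  have Ren (z : R[i]) : 0 < Re z -> 0 < Re (z + n%:R).
    elim: n => [|n ih] z0; first by rewrite addr0.
    by rewrite -natr1 addrA ReD/= addr_gt0// ih.
  have i := beta_fun_int (Ren _ p0) (Ren _ q0).
  set k := c0^-1 * (4 ^+ n)%:C.
  have e v : posline R v -> k * beta_fun (p + n%:R) (q + n%:R) v =
      (beta_peak v ^+ n)%:C * (c0^-1 * beta_fun p q v).
    by move=> /poslineP v0; rewrite /k -mulrA beta_fun_addn// mulrCA.
  have := cintegralZ k mp i; rewrite -/(cbeta _ _) z1 mulr0 (cintegral_ext e) => h.
  have [h1 _] := cintegrable_ext mp (cintegrableZ k mp i) e.
  have e' v : Re ((beta_peak v ^+ n)%:C * (c0^-1 * beta_fun p q v)) = psi v * beta_peak v ^+ n.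
    by rewrite ReM/= mul0r subr0 mulrC.
  split; first by apply: eq_integrable h1 => // v _; rewrite /= e'.
  have : Re (0 : R[i]) = 0 by []; rewrite -h /= => <-.
  by apply: eq_Rintegral => v _; rewrite e'.
have /cvgrPdist_le := psic; rewrite -/(psi 1) psi1 => /(_ (1 / 2)) [|eta0 /= e00 heta0]; first lra.
pose eta := Num.min eta0 1 / 2.
have min0 : 0 < Num.min eta0 1 by rewrite lt_min e00 ltr01.
have minl : Num.min eta0 1 <= eta0 by rewrite ge_min lexx.
have minr : Num.min eta0 1 <= 1 by rewrite ge_min lexx orbT.
have eta_gt0 : 0 < eta by rewrite /eta; lra.
have eta_lt1 : eta < 1 by rewrite /eta; lra.
(* psi is the real part after the phase at 1 has been divided out; it is at
   least 1/2 on the eta-neighbourhood of 1. *)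
have near1 v : `|v - 1| <= eta -> 1 / 2 <= psi v.
  move=> h; have h1 : `|1 - v| < eta0.
    by rewrite distrC; apply: le_lt_trans h _; rewrite /eta; lra.
  have := heta0 v h1; rewrite /= -/(psi v) => h2; have := ler_norm (1 - psi v); lra.
(* |v - 1| >= eta forces |v - 1| / (v + 1) >= r0, the worst case being
   v = 1 + eta; hence the peak is at most A there, and at least A' > A on the
   smaller neighbourhood of radius r0 / 2. *)
pose r0 := eta / (2 + eta).
have r00 : 0 < r0 by rewrite divr_gt0//; lra.
have r0e : r0 * (2 + eta) = eta by rewrite /r0 divfK// gt_eqF//; lra.
have r01 : r0 < 1 / 2 by nra.
have r0eta : r0 <= eta by nra.
pose A := 1 - r0 ^+ 2; pose A' := 1 - (r0 / 2) ^+ 2.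
have A0 : 0 < A by rewrite /A expr2; nra.
have AA' : A < A' by rewrite /A /A' !expr2; nra.
have far v : 0 < v -> eta < `|v - 1| -> beta_peak v <= A.
  move=> v0 h; rewrite beta_peakE// lerD2l lerN2 -[leRHS]real_normK ?num_real//.
  rewrite lerXn2r ?nnegrE ?(ltW r00)// normrM normfV (gtr0_norm (addr_gt0 v0 ltr01)).
  rewrite ler_pdivlMr ?addr_gt0//.
  have [v1|v1] := leP 1 v.
    move: h; rewrite ger0_norm ?subr_ge0// => h.
    have : 0 <= (v - 1 - eta) * (1 - r0) by rewrite mulr_ge0//; lra.
    by move: r0e; nra.
  move: h; rewrite ltr0_norm ?subr_lt0// => h.
  have : 0 <= r0 * (1 - v) by rewrite mulr_ge0//; lra.
  have : 0 <= r0 * eta by rewrite mulr_ge0 ?ltW.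
  by move: r0e; nra.
have nearA v : 0 < v -> `|v - 1| <= r0 / 2 -> A' <= beta_peak v.
  move=> v0 h; rewrite beta_peakE// lerD2l lerN2 -[leLHS]real_normK ?num_real//.
  have r2 : 0 <= r0 / 2 by lra.
  rewrite lerXn2r ?nnegrE// normrM normfV (gtr0_norm (addr_gt0 v0 ltr01)).
  rewrite ler_pdivrMr ?addr_gt0//; apply: le_trans h _.
  by rewrite ler_peMr// lerDr ltW.
pose I : set (measurableTypeR R) := (`[1 - r0 / 2, 1 + r0 / 2]%classic : set R).
have Ipos : I `<=` posline R.
  by move=> v; rewrite /I/= in_itv/= => /andP[h _]; apply/poslineP; lra.
have mI : measurable I by exact: measurable_itv.
have muI : mu I = r0%:E.
  rewrite /I lebesgue_measure_itv/= lte_fin ifT; last lra.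
  by rewrite -EFinB; congr (_%:E); field.
pose L := \int[mu]_(v in posline R) `|psi v|.
(* If the integral is zero, the contribution of the neighbourhood I is bounded
   by that of the points far from 1, which decays like the smaller power A ^ n. *)
have key n : 1 / 2 * A' ^+ n * r0 <= A ^+ n * L.
  have [i1 i2] := inpsi n.
  have ic : rint (posline R) ((fun=> 1 / 2 * A' ^+ n) \_ I).
    rewrite /rint -restrict_EFin; apply/integrable_restrict => //.
    rewrite setIidr//; apply: measurable_bounded_integrable => //.
      by apply: le_lt_trans (ltry r0); rewrite -muI.
    by exists `|1 / 2 * A' ^+ n|; split; [exact: num_real|move=> y /ltW h v _ /=; exact: h].
  have ia : rint (posline R) (fun v => A ^+ n * `|psi v|).
    by apply: rintZ => //; exact: integrable_norm.
  have : \int[mu]_(v in posline R) (((fun=> 1 / 2 * A' ^+ n) \_ I) v) <=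
      \int[mu]_(v in posline R) (psi v * beta_peak v ^+ n + A ^+ n * `|psi v|).
    apply: le_Rintegral => //; first exact: rintD.
    move=> v /poslineP v0; have /andP[k0 k1] := peak01 v v0.
    have An : 0 <= A ^+ n * `|psi v| by rewrite mulr_ge0// exprn_ge0// ltW.
    rewrite patchE; case: ifPn => [|_].
      rewrite inE /I/= in_itv/= -ler_distlC distrC => h.
      have h1 := near1 v (le_trans h (le_trans _ r0eta)).
      rewrite -[leLHS]addr0; apply: lerD => //; apply: ler_pM => //.
      - by rewrite exprn_ge0// ltW// (lt_trans A0).
      - by apply: h1; lra.
      - by rewrite lerXn2r ?nnegrE ?(ltW (lt_trans A0 AA'))// nearA.
    have [h|h] := leP `|v - 1| eta.
      by rewrite addr_ge0// mulr_ge0 ?exprn_ge0//; have := near1 v h; lra.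
    rewrite -lerBlDr sub0r.
    apply: (@le_trans _ _ (- (`|psi v| * beta_peak v ^+ n))).
      rewrite lerN2 [leRHS]mulrC ler_wpM2l// lerXn2r ?nnegrE ?(ltW A0)//.
      exact: far.
    rewrite -mulNr ler_wpM2r ?exprn_ge0// lerNl.
    by rewrite -[leRHS]normrN ler_norm.
  rewrite RintegralD// i2 add0r RintegralZl//; last exact: integrable_norm.
  rewrite -Rintegral_mkcondr setIidr// Rintegral_cst// (_ : fine _ = r0)//.
  by rewrite -[RHS]/(fine r0%:E) -muI.
have L0 : 0 <= L by apply: Rintegral_ge0.
pose tt := A' / A.
have t1 : 1 < tt by rewrite /tt ltr_pdivlMr// mul1r.
have bnd n : tt ^+ n * r0 <= 2 * L.
  rewrite exprMn exprVn mulrAC ler_pdivrMr ?exprn_gt0//.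
  by have := key n; lra.
have bern n : 1 + (tt - 1) *+ n <= tt ^+ n.
  elim: n => [|n ih]; first by rewrite mulr0n addr0 expr0.
  have h0 : 0 <= (tt - 1) *+ n by rewrite mulrn_wge0// subr_ge0 ltW.
  rewrite exprS mulrSr; nra.
pose n := (Num.truncn (2 * L / ((tt - 1) * r0))).+1.
have hn : 2 * L / ((tt - 1) * r0) < n%:R by exact: truncnS_gt.
have tr : 0 < (tt - 1) * r0 by rewrite mulr_gt0// subr_gt0.
move: hn; rewrite ltr_pdivrMr// => hn.
have h1 := le_trans (ler_wpM2r (ltW r00) (bern n)) (bnd n).
have e : (1 + (tt - 1) *+ n) * r0 = r0 + n%:R * ((tt - 1) * r0).
  by rewrite -mulr_natr; ring.
by move: h1; rewrite e; lra.
Qed.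

End BetaNonvanishing.

(** * Continuity of the Kobayashi gamma function *)

Section KobContinuity.
Variable R : realType.
Local Notation mu := (@lebesgue_measure R).
Implicit Types (z b w : R[i]) (v r M : R).

Lemma ccvg_plog (u : nat -> R[i]) l : 0 < Re l -> ccvg u l ->
  ccvg (fun n => plog (u n)) (plog l).
Proof.
move=> l0 [a b]; split => /=.
  have h : (fun n => Re (u n) ^+ 2 + Im (u n) ^+ 2) @ \oo --> Re l ^+ 2 + Im l ^+ 2.
    by rewrite !expr2; under eq_fun do rewrite !expr2; apply: cvgD; exact: cvgM.
  apply: cvgM; last exact: cvg_cst.
  apply: continuous_cvg h; apply: continuous_ln.
  by rewrite ltr_pwDl ?sqr_ge0// exprn_gt0.
have h : (fun n => Im (u n) / Re (u n)) @ \oo --> Im l / Re l.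
  by apply: cvgM => //; apply: cvgV => //; exact: lt0r_neq0.
by apply: continuous_cvg h; exact: continuous_atan.
Qed.

Lemma ccvg_addr_real b (e : nat -> R) : e @ \oo --> 0 ->
  ccvg (fun n => b + (e n)%:C) b.
Proof.
by move=> e0; have := ccvgD (ccvg_cst b) (ccvg_real e0); rewrite addr0.
Qed.

(** On the imaginary axis [clog] is not given by [plog], but a horizontal
    approach does not change the sign of the imaginary part, which selects the
    branch of [carg]. *)
Lemma ccvg_clog_right b (e : nat -> R) : 0 <= Re b -> b != 0 ->
  (forall n, 0 <= e n) -> e @ \oo --> 0 ->
  ccvg (fun n => clog (b + (e n)%:C)) (clog b).
Proof.
move=> b0 bn0 e0 ce; have cb := ccvg_addr_real b ce.
have Re_n n : Re (b + (e n)%:C) = Re b + e n by rewrite ReD.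
have Im_n n : Im (b + (e n)%:C) = Im b by rewrite ImD addr0.
have [b1|b1] := ltP 0 (Re b).
  rewrite clog_plog//; apply: ccvg_ext (ccvg_plog b1 cb) _ => n.
  by rewrite clog_plog// Re_n ltr_pwDl.
have {b0 b1} rb : Re b = 0 by apply/eqP; rewrite eq_le b1 b0.
have ib : Im b != 0.
  by apply: contra bn0 => /eqP ib; apply/eqP; apply: complex_ext.
have m0 : 0 < cmod b by rewrite cmod_gt0.
have cm := ccvg_cmod cb.
split => /=; first by apply: continuous_cvg cm; exact: continuous_ln.
have q : (fun n => Re (b + (e n)%:C) / cmod (b + (e n)%:C)) @ \oo --> Re b / cmod b.
  by apply: cvgM; [exact: cb.1|apply: cvgV => //; exact: lt0r_neq0].
have ac : (fun n => acos (Re (b + (e n)%:C) / cmod (b + (e n)%:C))) @ \oo -->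
    acos (Re b / cmod b).
  apply: continuous_cvg q; apply: continuous_acos.
  by rewrite rb mul0r; apply/andP; split; lra.
rewrite /carg; case: ifPn => ib0; under eq_fun do rewrite Im_n ?ib0 ?(negbTE ib0)//.
  exact: ac.
exact: (cvgN ac).
Qed.

Lemma addr_real_neq0 b (e : R) : 0 <= Re b -> b != 0 -> 0 <= e -> b + e%:C != 0.
Proof.
move=> b0 bn0 e0; have [b1|b1] := ltP 0 (Re b).
  by apply: Re_gt0_neq0; rewrite ReD/= ltr_pwDl.
have rb : Re b = 0 by apply/eqP; rewrite eq_le b1 b0.
apply: contra bn0 => /eqP h; apply/eqP; apply: complex_ext => //.
by have := congr1 (@complex.Im R) h; rewrite ImD/= addr0.
Qed.

Lemma ccvg_cpow_right b p (e : nat -> R) : 0 <= Re b -> b != 0 ->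
  (forall n, 0 <= e n) -> e @ \oo --> 0 ->
  ccvg (fun n => cpow (b + (e n)%:C) p) (cpow b p).
Proof.
move=> b0 bn0 e0 ce; rewrite cpowE//.
apply: ccvg_ext (ccvg_cexp (ccvgM (ccvg_cst p) (ccvg_clog_right b0 bn0 e0 ce))) _ => n.
by rewrite cpowE// addr_real_neq0.
Qed.

Variables (al s : R[i]).
Hypothesis al0 : 0 < Re al.

Lemma cmod_kob_fun_real_le z v : 0 < v -> 0 <= Re z ->
  cmod (kob_fun al s z v%:C) <= arg_bound al s *
    (v `^ (Re al - 1) * expR (- v) * cmod (v%:C + z) `^ (Re s - 1)).
Proof.
move=> v0 z0; apply: le_trans (@cmod_kob_fun_le _ al s z v%:C v0 (Re_real_add v0 z0)) _.
by rewrite cmod_real gtr0_norm.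
Qed.

(** The majorant that makes [kob] continuous up to the imaginary axis. *)
Lemma kob_fun_majorant r M : 0 < r -> exists2 C, 0 <= C &
  forall z, 0 <= Re z -> r <= cmod z -> cmod z <= M -> forall v, 0 < v ->
  cmod (kob_fun al s z v%:C) <= C * (v `^ (Re al - 1) * expR (- (2^-1 * v))).
Proof.
move=> r0; set p := Re s - 1.
have h2 : (0 : R) < 2^-1 by rewrite invr_gt0.
have [C C0 hC] := exp_decay_powR `|p| h2.
exists (arg_bound al s * ((r `^ p + (1 + M) `^ p) * C)).
  by rewrite !mulr_ge0 ?addr_ge0 ?powR_ge0 ?(ltW C0) ?(ltW (arg_bound_gt0 _ _)).
move=> z z0 rz zM v v0; apply: le_trans (cmod_kob_fun_real_le v0 z0) _.
have M0 : 0 < M by apply: lt_le_trans zM; apply: lt_le_trans rz.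
have v1 : 0 < v + 1 by rewrite addr_gt0.
have [h1 h3] := @cmod_addr_ge _ v%:C z (ltW v0) erefl z0.
have k : cmod (v%:C + z) `^ p <= (r `^ p + (1 + M) `^ p) * (v + 1) `^ `|p|.
  apply: (@le_trans _ _ (r `^ p + ((1 + M) * (v + 1)) `^ p)).
    apply: powR_between => //; first exact: le_trans h3.
    apply: le_trans (cmodD _ _) _; rewrite cmod_real gtr0_norm//; nra.
  have g1 : 1 <= (v + 1) `^ `|p|.
    by rewrite -[leLHS](powRr0 (v + 1)) ler_powR// lerDr ltW.
  rewrite [leRHS]mulrDl powRM ?(ltW v1) ?addr_ge0 ?(ltW M0)//; apply: lerD.
    by rewrite ler_peMr ?powR_ge0.
  by rewrite ler_wpM2l ?powR_ge0// ler_powR ?ler_norm// lerDr ltW.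
rewrite -[leRHS]mulrA ler_wpM2l ?(ltW (arg_bound_gt0 _ _))//.
have -> : expR (- v) = expR (- (2^-1 * v)) * expR (- (2^-1 * v)).
  by rewrite -expRD; congr expR; field.
have e0 := expR_ge0 (- (2^-1 * v)).
have w0 := powR_ge0 v (Re al - 1).
apply: (@le_trans _ _ (v `^ (Re al - 1) * (expR (- (2^-1 * v)) * expR (- (2^-1 * v))) *
  ((r `^ p + (1 + M) `^ p) * (v + 1) `^ `|p|))).
  by rewrite ler_wpM2l// !mulr_ge0.
have -> : v `^ (Re al - 1) * (expR (- (2^-1 * v)) * expR (- (2^-1 * v))) *
  ((r `^ p + (1 + M) `^ p) * (v + 1) `^ `|p|) =
  (v `^ (Re al - 1) * expR (- (2^-1 * v))) * (r `^ p + (1 + M) `^ p) *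
  ((v + 1) `^ `|p| * expR (- (2^-1 * v))) by ring.
have -> : (r `^ p + (1 + M) `^ p) * C * (v `^ (Re al - 1) * expR (- (2^-1 * v))) =
  (v `^ (Re al - 1) * expR (- (2^-1 * v))) * (r `^ p + (1 + M) `^ p) * C by ring.
by rewrite ler_wpM2l ?hC ?(ltW v0)// !mulr_ge0 ?addr_ge0 ?powR_ge0.
Qed.

Lemma half_gt0 : (0 : R) < 2^-1. Proof. by rewrite invr_gt0. Qed.

Lemma kob_fun_int z : 0 <= Re z -> z != 0 ->
  cintegrable (posline R) (fun v => kob_fun al s z v%:C).
Proof.
move=> z0 zn0; have mp := measurable_posline R.
have r0 : 0 < cmod z by rewrite cmod_gt0.
have [C C0 hC] := kob_fun_majorant (cmod z) r0.
apply: (cintegrable_le mp (cmeas_kob_fun al s z0) (rintZ C mp (gamma_density_int al0 half_gt0))).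
by move=> v /poslineP v0; exact: hC.
Qed.

(** Continuity is only needed along sequences whose modulus does not fall below
    that of the limit, which keeps them away from the singularity at the origin. *)
Lemma kob_cvg (z_ : nat -> R[i]) z : 0 <= Re z -> z != 0 ->
  (forall n, 0 <= Re (z_ n)) -> (forall n, cmod z <= cmod (z_ n)) ->
  (exists M, forall n, cmod (z_ n) <= M) -> ccvg z_ z ->
  ccvg (fun n => kob al s (z_ n)) (kob al s z).
Proof.
move=> z0 zn0 zn zr [M zM] cz; have mp := measurable_posline R.
have r0 : 0 < cmod z by rewrite cmod_gt0.
have [C C0 hC] := kob_fun_majorant M r0.
apply: (cdominated mp _ _ (rintZ C mp (gamma_density_int al0 half_gt0)) _).2.
- by move=> n; exact: cmeas_kob_fun.
- move=> v /poslineP v0; apply: ccvg_cexp.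
  apply: ccvgD; first exact: ccvg_cst.
  apply: ccvgM; first exact: ccvg_cst.
  apply: ccvg_plog; first exact: Re_real_add.
  by apply: ccvgD => //; exact: ccvg_cst.
- by move=> n v /poslineP v0; exact: hC.
Qed.

End KobContinuity.

(** * Asymptotics at infinity and at the origin *)

Section KobAsymptotics.
Variable R : realType.
Local Notation mu := (@lebesgue_measure R).
Variables (al s b : R[i]).
Hypotheses (al0 : 0 < Re al) (b0 : 0 <= Re b) (bn0 : b != 0).
Implicit Types (z w B : R[i]) (v u c : R).

Definition gamma_fun v : R[i] := cpow v%:C (al - 1) * cexp (- v%:C).

Lemma cmeas_gamma_fun : cmeas (posline R) gamma_fun.
Proof.
apply: (@cmeas_ext _ _ _ _ (fun v => cexp ((al - 1) * (ln v)%:C) * cexp (- v%:C))).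
  apply: cmeasM; apply: cmeas_cexp; first exact: cmeas_ln.
  apply: (@cmeas_ext _ _ _ _ (fun v => (- 1) * v%:C)); last by move=> v _; rewrite mulN1r.
  by apply: cmeasM; [exact: cmeas_cst|exact: cmeas_real].
by move=> v /poslineP v0; rewrite /gamma_fun cpow_real.
Qed.

Lemma cGammaE : cGamma al = cintegral (posline R) gamma_fun.
Proof. by rewrite /cGamma cintegral_halfline//; exact: cmeas_gamma_fun. Qed.

(** The substitution that factors [u ^ (s - 1)] out of the shifted power. *)
Lemma kob_fun_scale v u : 0 < v -> 0 < u ->
  cpow u%:C (1 - s) * kob_fun al s (b * u%:C) v%:C =
  gamma_fun v * cpow (b + (v / u)%:C) (s - 1).
Proof.
move=> v0 u0; have un0 := real_neq0 u0.
have q0 : 0 <= v / u by rewrite divr_ge0 ?ltW.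
rewrite kob_funE//; last first.
  by rewrite ReD/= ltr_pwDl// Re_mul_real_ge0// ltW.
have -> : v%:C + b * u%:C = u%:C * (b + (v / u)%:C).
  rewrite mulrDr addrC [b * _]mulrC; congr (_ + _).
  by rewrite -rmorphM/= mulrC divfK ?gt_eqF.
rewrite cpowMr ?addr_real_neq0// /gamma_fun -opprB cpowN//.
by field; rewrite cpow_neq0.
Qed.

(** As [u] grows, [kob (b u)] behaves like [(b u) ^ (s - 1) Gamma al], because
    the ratio [v / u] in the rescaled integrand tends to zero. *)
Lemma kob_cvg_infty (u : nat -> R) : 0 <= Re s - 1 -> (forall n, 1 <= u n) ->
  (fun n => (u n)^-1) @ \oo --> 0 ->
  ccvg (fun n => cpow (u n)%:C (1 - s) * kob al s (b * (u n)%:C))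
    (cGamma al * cpow b (s - 1)).
Proof.
move=> s1 u1 cu; have mp := measurable_posline R.
have u0 n : 0 < u n by apply: lt_le_trans (u1 n).
have kn n : cintegrable (posline R) (fun v => kob_fun al s (b * (u n)%:C) v%:C).
  apply: kob_fun_int => //; first by rewrite Re_mul_real_ge0// ltW.
  by rewrite mulf_neq0// real_neq0.
set p := Re s - 1.
have [C C0 hC] := exp_decay_powR p (@half_gt0 R).
pose K := expR (pi * `|Im s|) * ((1 + cmod b) `^ p * C).
have K0 : 0 <= K by rewrite !mulr_ge0 ?expR_ge0 ?powR_ge0 ?(ltW C0).
have qc v : (fun n => v / u n) @ \oo --> 0.
  by rewrite -(mulr0 v); apply: cvgM => //; exact: cvg_cst.
have q0 v n : 0 < v -> 0 <= v / u n by move=> v0; rewrite divr_ge0 ?ltW.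
have [] := @cdominated R (posline R) (fun n v => cpow (u n)%:C (1 - s) * kob_fun al s (b *
  (u n)%:C) v%:C)
  (fun v => cpow b (s - 1) * gamma_fun v)
  (fun v => K * (v `^ (Re al - 1) * expR (- (2^-1 * v)))) mp.
- by move=> n; apply: cmeasM; [exact: cmeas_cst|exact: cintegrable_cmeas].
- move=> v /poslineP v0; rewrite mulrC.
  apply: ccvg_ext (ccvgM (ccvg_cst (gamma_fun v)) (ccvg_cpow_right (s - 1) b0 bn0 _ (qc v))) _.
    by move=> n; exact: q0.
  by move=> n; rewrite kob_fun_scale.
- exact: rintZ mp (gamma_density_int al0 (@half_gt0 R)).
- move=> n v /poslineP v0; rewrite kob_fun_scale// !cmodM cmod_cexp cmod_cpow_real// ReN/=.
  rewrite ReD/=.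
  have v1 : 0 < v + 1 by rewrite addr_gt0.
  have h1 := cmod_cpow_le (s - 1) (addr_real_neq0 b0 bn0 (q0 v n v0)).
  rewrite !ReD !ImD /= oppr0 addr0 in h1.
  have h2 : cmod (b + (v / u n)%:C) `^ p <= (1 + cmod b) `^ p * (v + 1) `^ p.
    rewrite -powRM ?addr_ge0 ?cmod_ge0 ?(ltW v0)// ge0_ler_powR ?nnegrE ?cmod_ge0//.
      by rewrite mulr_ge0 ?addr_ge0 ?cmod_ge0// ltW.
    apply: le_trans (cmodD _ _) _; rewrite cmod_real ger0_norm ?q0//.
    have : v / u n <= v by rewrite ler_pdivrMr// ler_peMr// ltW.
    by have := cmod_ge0 b; nra.
  have -> : expR (- v) = expR (- (2^-1 * v)) * expR (- (2^-1 * v)).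
    by rewrite -expRD; congr expR; field.
  have e0 := expR_ge0 (- (2^-1 * v)).
  have w0 := powR_ge0 v (Re al - 1).
  apply: (@le_trans _ _ (v `^ (Re al - 1) * (expR (- (2^-1 * v)) * expR (- (2^-1 * v))) *
    (expR (pi * `|Im s|) * ((1 + cmod b) `^ p * (v + 1) `^ p)))).
    by rewrite ler_wpM2l ?mulr_ge0// (le_trans h1)// ler_wpM2l ?expR_ge0.
  have -> : v `^ (Re al - 1) * (expR (- (2^-1 * v)) * expR (- (2^-1 * v))) *
    (expR (pi * `|Im s|) * ((1 + cmod b) `^ p * (v + 1) `^ p)) =
    expR (pi * `|Im s|) * (1 + cmod b) `^ p * (v `^ (Re al - 1) * expR (- (2^-1 * v))) *
    ((v + 1) `^ p * expR (- (2^-1 * v))) by ring.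
  have -> : K * (v `^ (Re al - 1) * expR (- (2^-1 * v))) =
    expR (pi * `|Im s|) * (1 + cmod b) `^ p * (v `^ (Re al - 1) * expR (- (2^-1 * v))) * C.
    by rewrite /K; ring.
  by rewrite ler_wpM2l ?hC ?(ltW v0)// !mulr_ge0 ?expR_ge0 ?powR_ge0.
move=> ig cg.
have bn := cpow_neq0 (s - 1) bn0.
have gi : cintegrable (posline R) gamma_fun.
  apply: (cintegrable_ext mp (cintegrableZ (cpow b (s - 1))^-1 mp ig)) => v _.
  exact: mulKf.
move: cg; rewrite (cintegralZ _ mp gi) -cGammaE mulrC => cg.
apply: ccvg_ext cg _ => n; exact: cintegralZ.
Qed.

(** Turns nonzero limits into lower bounds: if there were none, values below
    [n^-1] would occur beyond every [n], and form a sequence tending to zero. *)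
Lemma eventually_bounded_below (g : R -> R) :
  (forall u : nat -> R, (forall n, 1 <= u n) -> (fun n => (u n)^-1) @ \oo --> 0 ->
     ~ (fun n => g (u n)) @ \oo --> 0) ->
  (forall v, 0 <= g v) ->
  exists2 c, 0 < c & exists2 U, 0 < U & forall v, U <= v -> c <= g v.
Proof.
move=> H g0; apply: contrapT => N.
have /choice[u hu] : forall n : nat, exists u, n.+1%:R <= u /\ g u < n.+1%:R^-1.
  move=> n; apply: contrapT => N2; apply: N.
  exists n.+1%:R^-1; first by rewrite invr_gt0 ltr0n.
  exists n.+1%:R; first by rewrite ltr0n.
  by move=> v hv; rewrite leNgt; apply/negP => hg; apply: N2; exists v.
have hh := @cvg_harmonic R.
have u1 n : 1 <= u n by have [h _] := hu n; rewrite (le_trans _ h)// ler1n.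
apply: (H u) => //.
  apply: (squeeze_cvgr _ (cvg_cst 0) hh); apply: nearW => n.
  have u0 : 0 < u n by apply: lt_le_trans (u1 n).
  by rewrite invr_ge0 (ltW u0)/= lef_pV2 ?posrE ?ltr0n//; have [] := hu n.
apply: (squeeze_cvgr _ (cvg_cst 0) hh); apply: nearW => n.
by rewrite g0/=; have [_ /ltW] := hu n.
Qed.

(** The leading coefficient [Gamma al b ^ (s - 1)] is not zero. *)
Lemma kob_lower_infty : 0 <= Re s - 1 -> cGamma al != 0 ->
  exists2 c, 0 < c & exists2 U, 0 < U & forall u, U <= u ->
  c * u `^ (Re s - 1) <= cmod (kob al s (b * u%:C)).
Proof.
move=> s1 G0.
pose g u := cmod (cpow u%:C (1 - s) * kob al s (b * u%:C)).
have [u u1 cu c0|u|c c0 [U U0 hU]] := @eventually_bounded_below g.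
- have := ccvg_cmod (kob_cvg_infty s1 u1 cu) => c1.
  have /esym/eqP : 0 = cmod (cGamma al * cpow b (s - 1)) by exact: cvg_unique c0 c1.
  by rewrite cmod_eq0 mulf_eq0 (negbTE G0) (negbTE (cpow_neq0 _ bn0)).
- exact: cmod_ge0.
- exists c => //; exists U => // u Uu; have u0 : 0 < u by exact: lt_le_trans Uu.
  have := hU u Uu; rewrite /g cmodM cmod_cpow_real// ReD ReN/= => h.
  have -> : Re s - 1 = - (1 - Re s) by ring.
  by rewrite powRN ler_pdivrMr ?powR_gt0// mulrC.
Qed.

Section SmallS.
Hypothesis as1 : Re al + Re s < 1.

Local Notation q := (1 - s - al).

Lemma Re_beta_param : 0 < Re q.
Proof. by rewrite !ReD !ReN (_ : Re 1 = 1 :> R)// -addrA -opprD subr_gt0 addrC. Qed.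

(** The Laplace kernel with shift [1] is dominated, uniformly in [B] up to the
    imaginary axis, by a beta density; this needs [Re al + Re s < 1]. *)
Lemma cmod_lap_fun_le B v : 0 <= Re B -> 0 < v ->
  cmod (lap_fun al s B 1 v) <= v `^ (Re al - 1) * (v + 1) `^ (- (Re al + Re q)).
Proof.
move=> B0 v0; rewrite cmod_lap_fun ?addr_gt0//.
have -> : Re s - 1 = - (Re al + Re q) by rewrite !ReD !ReN (_ : Re 1 = 1 :> R)//; ring.
rewrite ler_wpM2r ?powR_ge0// ler_piMr ?powR_ge0//.
by rewrite -expR0 ler_expR oppr_le0 mulr_ge0// ltW.
Qed.

Lemma lap_cvg (B_ : nat -> R[i]) B : (forall n, 0 <= Re (B_ n)) -> ccvg B_ B ->
  ccvg (fun n => cintegral (posline R) (lap_fun al s (B_ n) 1))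
       (cintegral (posline R) (lap_fun al s B 1)).
Proof.
move=> Bn cB; have mp := measurable_posline R.
apply: (cdominated mp _ _ (beta_density_int al0 Re_beta_param) _).2.
- by move=> n; exact: cmeas_lap_fun.
- move=> v _; apply: ccvg_cexp; apply: ccvgD; last exact: ccvg_cst.
  apply: ccvgD; first exact: ccvg_cst.
  apply: (@ccvg_ext _ (fun n => (- v%:C) * B_ n)); last by move=> n; ring.
  by rewrite (_ : - (B * v%:C) = - v%:C * B); [apply: ccvgM cB; exact: ccvg_cst|ring].
- by move=> n v /poslineP v0; exact: cmod_lap_fun_le.
Qed.

(** The rotation formula persists on the imaginary axis, where the integral
    still converges absolutely. *)
Lemma kob_lap B : 0 <= Re B -> B != 0 ->
  kob al s B = cpow B (al + s - 1) * cintegral (posline R) (lap_fun al s B 1).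
Proof.
move=> B0 Bn0.
have n0 n : (0 : R) <= n.+2%:R^-1 by rewrite invr_ge0.
have cB := ccvg_addr_real B (@invn_cvg0 R).
have Re_n n : 0 < Re (B + (n.+2%:R^-1)%:C) by rewrite ReD/= ltr_wpDl// invr_gt0.
have c1 : ccvg (fun n => kob al s (B + (n.+2%:R^-1)%:C)) (kob al s B).
  apply: kob_cvg => //; first by move=> n; exact: ltW.
    move=> n; rewrite ler_wsqrtr// !ReImE/= addr0 lerD2r.
    by rewrite lerXn2r ?nnegrE ?lerDl ?addr_ge0.
  exists (cmod B + 1) => n; apply: le_trans (cmodD _ _) _.
  by rewrite lerD2l cmod_real ger0_norm// invf_le1 ?ler1n.
apply: ccvg_unique c1 _.
apply: ccvg_ext (ccvgM (ccvg_cpow_right (al + s - 1) B0 Bn0 n0 (@invn_cvg0 R)) (lap_cvg _ cB)) _.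
  by move=> n; exact: ltW.
by move=> n; rewrite -(kob_rotation s al0 (Re_n n) ltr01) mulr1.
Qed.

Lemma kob_upper_zero : exists2 C, 0 <= C & forall z, 0 <= Re z -> z != 0 ->
  cmod (kob al s z) <= C * cmod z `^ (Re al + Re s - 1).
Proof.
have mp := measurable_posline R.
have i := beta_density_int al0 Re_beta_param.
set I := \int[mu]_(v in posline R) (v `^ (Re al - 1) * (v + 1) `^ (- (Re al + Re q))).
have I0 : 0 <= I by apply: Rintegral_ge0 => v _; rewrite mulr_ge0 ?powR_ge0.
exists (expR (pi * `|Im (al + s - 1)|) * (2 * I)).
  by rewrite !mulr_ge0 ?expR_ge0.
move=> z z0 zn0; rewrite kob_lap// cmodM mulrAC; apply: ler_pM; rewrite ?cmod_ge0//.
  by have := cmod_cpow_le (al + s - 1) zn0; rewrite !ReD.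
apply: cmod_cintegral_le => //; last by move=> v /poslineP v0; exact: cmod_lap_fun_le.
apply: (cintegrable_le mp (cmeas_lap_fun al s z 1 mp) i) => v /poslineP v0.
exact: cmod_lap_fun_le.
Qed.

(** By [kob_lap] the quotient of [kob (b u)] by [(b u) ^ (al + s - 1)] tends to
    a beta integral as [u] tends to zero, and beta integrals do not vanish. The
    condition is stated in terms of [u^-1] so that the lemma on families at
    infinity applies. *)
Lemma kob_lower_zero : exists2 c, 0 < c & exists2 U, 0 < U & forall u, 0 < u -> u^-1 >= U ->
  c * u `^ (Re al + Re s - 1) <= cmod (kob al s (b * u%:C)).
Proof.
pose g u := cmod (cintegral (posline R) (lap_fun al s (b * (u^-1)%:C) 1)).
have [u u1 cu c0|u|c c0 [U U0 hU]] := @eventually_bounded_below g.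
- have cB : ccvg (fun n => b * ((u n)^-1)%:C) 0.
    by rewrite -(mulr0 b); apply: ccvgM; [exact: ccvg_cst|exact: ccvg_real cu].
  have := ccvg_cmod (lap_cvg _ cB) => /(_ _)/wrap[n|c1].
    by rewrite Re_mul_real_ge0// invr_ge0 (le_trans _ (u1 n)).
  have /esym/eqP : 0 = cmod (cintegral (posline R) (lap_fun al s 0 1)).
    exact: cvg_unique c0 c1.
  rewrite cmod_eq0; apply/negP.
  have -> : cintegral (posline R) (lap_fun al s 0 1) = cbeta al q.
    apply: cintegral_ext => v _; rewrite /lap_fun /beta_fun mul0r subr0; congr cexp.
    by ring.
  by apply: cbeta_neq0 => //; exact: Re_beta_param.
- exact: cmod_ge0.
- set k := expR (- (pi * `|Im (al + s - 1)|)) * cmod b `^ (Re al + Re s - 1).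
  have k0 : 0 < k by apply: mulr_gt0; [exact: expR_gt0|rewrite powR_gt0// cmod_gt0].
  exists (k * c); first exact: mulr_gt0.
  exists U => // u u0 Uu; have := hU _ Uu; rewrite /g invrK => h.
  have bu : b * u%:C != 0 by rewrite mulf_neq0// real_neq0.
  rewrite kob_lap ?Re_mul_real_ge0 ?(ltW u0)// cmodM mulrAC.
  apply: ler_pM => //; rewrite ?mulr_ge0 ?(ltW k0) ?powR_ge0 ?(ltW c0)//.
  apply: le_trans (cmod_cpow_ge _ bu); rewrite cmod_mul_real ?(ltW u0)//.
  by rewrite powRM ?cmod_ge0 ?(ltW u0)// mulrA !ReD.
Qed.

End SmallS.
End KobAsymptotics.

(** * The critical exponent: comparison with a power of modulus 1 / v *)

Section NearOne.
Variable R : realType.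
Implicit Types (p z : R[i]).

Lemma MVT_bound (f df : R -> R) (M : R) :
  (forall t : R, 0 <= t <= 1 -> is_derive t 1 f (df t)) ->
  (forall t : R, 0 <= t <= 1 -> `|df t| <= M) -> `|f 1 - f 0| <= M.
Proof.
move=> dfE dfM.
have [||c cI ->] := @MVT R f df 0 1 ltr01.
- by move=> x /[!in_itv]/= /andP[h1 h2]; apply: dfE; rewrite !ltW.
- apply: derivable_within_continuous => x; rewrite in_itv/= => h.
  by have [] := dfE x h.
- by rewrite subr0 mulr1; apply: dfM; move: cI; rewrite in_itv/= => /andP[h1 h2]; rewrite !ltW.
Qed.

Lemma cmod_cexp_plog_le p z : 0 < Re z ->
  cmod (cexp (p * plog z)) <= expR (pi * `|Im p|) * cmod z `^ Re p.
Proof.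
by move=> z0; rewrite -clog_plog// -cpowE ?Re_gt0_neq0// cmod_cpow_le// Re_gt0_neq0.
Qed.

Lemma plog1 : plog (1 : R[i]) = 0.
Proof. by rewrite -clog_plog/= ?ltr01// (@clog_real R 1) ?ltr01// ln1. Qed.

(** The mean value theorem along the segment from [1] to [1 + z], which stays in
    the half plane where [plog] is smooth. *)
Lemma cpow_lipschitz_one p : exists2 C, 0 <= C & forall z, 0 <= Re z -> cmod z <= 1 ->
  cmod (cexp (p * plog (1 + z)) - 1) <= C * cmod z.
Proof.
pose K := expR (pi * `|Im p|) * (1 `^ Re p + 2 `^ Re p).
have K0 : 0 <= K by rewrite mulr_ge0 ?expR_ge0 ?addr_ge0 ?powR_ge0.
exists (2 * (cmod p * K)); first by rewrite !mulr_ge0 ?cmod_ge0.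
move=> z z0 z1.
pose w t := 1 + z * t%:C.
have Rw t : 0 <= t <= 1 -> 1 <= Re (w t).
  by move=> /andP[t0 _]; rewrite ReD ReM/= mulr0 subr0 lerDl mulr_ge0.
have w1 t : 0 <= t <= 1 -> 1 <= cmod (w t).
  by move=> t0; apply: le_trans (Rw t t0) (Re_le_cmod _).
have w2 t : 0 <= t <= 1 -> cmod (w t) <= 2.
  move=> /andP[t0 t1]; apply: le_trans (cmodD _ _) _.
  rewrite cmod1 cmodM cmod_real ger0_norm//; have := cmod_ge0 z; nra.
pose l t := p * (z / w t) * cexp (p * plog (w t)).
have dw t : cderiv w t z.
  apply: cderiv_ext (cderivD (cderiv_cst 1 t) (cderivZ z (cderiv_id t))) _ _ => //.
  by rewrite add0r mulr1.
have d t : 0 <= t <= 1 -> cderiv (fun t => cexp (p * plog (w t))) t (l t).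
  move=> h; apply: cderiv_cexp; apply: cderivZ; apply: cderiv_plog (dw t).
  exact: lt_le_trans (Rw t h).
have lM t : 0 <= t <= 1 -> cmod (l t) <= cmod p * K * cmod z.
  move=> h; have wt0 : 0 < cmod (w t) by apply: lt_le_trans (w1 t h).
  rewrite !cmodM cmodV mulrAC; apply: ler_pM; rewrite ?mulr_ge0 ?invr_ge0 ?cmod_ge0//.
    rewrite ler_wpM2l ?cmod_ge0//.
    apply: (le_trans (cmod_cexp_plog_le _ (lt_le_trans ltr01 (Rw t h)))).
    by rewrite ler_wpM2l ?expR_ge0// powR_between ?w1 ?w2.
  by rewrite ler_pdivrMr// ler_peMr ?cmod_ge0// w1.
have e0 : cexp (p * plog (w 0)) = 1.
  by rewrite /w mulr0 addr0 plog1 mulr0 cexp0.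
have -> : 1 + z = w 1 by rewrite /w mulr1.
rewrite -[X in _ - X]e0.
have b1 := MVT_bound (fun t h => (d t h).1) (fun t h => le_trans (normr_Re_le _) (lM t h)).
have b2 := MVT_bound (fun t h => (d t h).2) (fun t h => le_trans (normr_Im_le _) (lM t h)).
apply: le_trans (cmod_le_ReIm _) _; rewrite ReD ImD ReN ImN.
by rewrite -mulrA mulrDl mul1r; exact: lerD.
Qed.

Lemma plog_scale (v : R) z : 0 < v -> 0 <= Re z ->
  plog (v%:C + z) = (ln v)%:C + plog (1 + z * (v^-1)%:C).
Proof.
move=> v0 z0; have q0 : 0 < Re (1 + z * (v^-1)%:C).
  by rewrite ReD ReM/= mulr0 subr0 ltr_pwDl// mulr_ge0// invr_ge0 ltW.
rewrite -(clog_plog (Re_real_add v0 z0)) -(clog_plog q0) -clogMr ?Re_gt0_neq0//.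
congr clog.
rewrite mulrDr mulr1 mulrCA -rmorphM/= mulfV ?gt_eqF// mulr1//.
Qed.

Lemma plog_real (v : R) : 0 < v -> plog v%:C = (ln v)%:C.
Proof. by move=> v0; rewrite -clog_plog// clog_real. Qed.

(** Scaling the Lipschitz estimate at [1] to the point [v]. *)
Lemma cpow_shift_le p : exists2 C, 0 <= C & forall v r : R, 0 < v -> 0 <= r -> r <= v ->
  cmod (cexp (p * (ln (v + r))%:C) - cexp (p * (ln v)%:C)) <= C * v `^ Re p * (r / v).
Proof.
have [C C0 hC] := cpow_lipschitz_one p; exists C => // v r v0 r0 rv.
have vr : 0 < v + r by rewrite ltr_pwDl.
have q0 : 0 <= r / v by rewrite divr_ge0// ltW.
have -> : (ln (v + r))%:C = (ln v)%:C + plog (1 + (r / v)%:C).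
  rewrite -plog_real// rmorphD/= plog_scale//; congr (_ + plog (1 + _)).
  by rewrite -rmorphM.
rewrite mulrDr cexpD -{2}[cexp (p * (ln v)%:C)]mulr1 -mulrBr cmodM.
have -> : cmod (cexp (p * (ln v)%:C)) = v `^ Re p.
  by rewrite cmod_cexp ReM/= mulr0 subr0 powR_exp.
have h := hC (r / v)%:C q0; rewrite cmod_real ger0_norm// in h.
rewrite [C * _]mulrC -mulrA ler_wpM2l ?powR_ge0// h//.
by rewrite ler_pdivrMr// mul1r.
Qed.

End NearOne.

Section CriticalCase.
Variable R : realType.
Local Notation mu := (@lebesgue_measure R).
Variables (al s : R[i]).
Hypotheses (al0 : 0 < Re al) (as1 : Re al + Re s = 1).
Implicit Types (z : R[i]) (v r : R).

Local Notation p := (al + s - 1 - 1).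
Local Notation a := (Re al).

Lemma Re_crit : Re p = - 1.
Proof. by rewrite !ReD !ReN (_ : Re 1 = 1 :> R)//; have := as1; lra. Qed.

Lemma Re_crit1 : Re (al + s - 1) = 0.
Proof. by rewrite !ReD !ReN (_ : Re 1 = 1 :> R)// as1 subrr. Qed.

Lemma cmod_crit v : 0 < v -> cmod (cexp (p * (ln v)%:C)) = v^-1.
Proof.
by move=> v0; rewrite cmod_cexp ReM/= mulr0 subr0 Re_crit mulN1r expRN lnK.
Qed.

(** When [Re al + Re s = 1] the integrand behaves like [v ^ (al + s - 2)], of
    modulus [1 / v], between the scales [r = |z|] and [1], so that [kob] may be
    unbounded at the origin. This function has the same behaviour, and its
    integral can be computed. *)
Definition crit_fun r v : R[i] := cexp (p * (ln (v + r))%:C) - cexp (p * (ln (v + 1))%:C).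

(** The three summands correspond to the ranges [v <= r], [r <= v] and [1 <= v];
    the first two have a mass bounded independently of [r]. *)
Definition crit_bound r v : R :=
  ratio_density a r v + ratio_density 1 r v + (v + 1) `^ (- 1 - 1).

Lemma ratio_density1 r v : 0 < r -> 0 < v -> ratio_density 1 r v = r / (v + r) ^+ 2.
Proof.
move=> r0 v0; have vr : 0 < v + r by rewrite addr_gt0.
rewrite /ratio_density powRr1 ?divr_ge0 ?ltW//; field.
by rewrite !lt0r_neq0.
Qed.

Lemma tail_density1 v : 0 < v -> (v + 1) `^ (- 1 - 1) = ((v + 1) ^+ 2)^-1.
Proof.
move=> v0; have -> : (- 1 - 1 : R) = - 2%:R by ring.
by rewrite powR_invn// addr_ge0// ltW.
Qed.

Lemma cmod_kob_crit_le z v r : 0 < v -> 0 <= Re z -> 0 < r -> r <= cmod (v%:C + z) ->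
  cmod (kob_fun al s z v%:C) <= arg_bound al s * (v `^ (a - 1) * expR (- v) * r `^ (- a)).
Proof.
move=> v0 z0 r0 rz; apply: le_trans (cmod_kob_fun_real_le al s v0 z0) _.
rewrite ler_wpM2l ?(ltW (arg_bound_gt0 _ _))// ler_wpM2l ?mulr_ge0 ?powR_ge0 ?expR_ge0//.
have -> : Re s - 1 = - a by have := as1; lra.
have z1 : 0 < cmod (v%:C + z) by apply: lt_le_trans rz.
by rewrite !powR_exp// ler_expR ler_wnM2l ?oppr_le0 ?(ltW al0)// ler_ln ?posrE.
Qed.

(** Below the scale [r] the two functions are bounded separately; between [r] and
    [1] both are compared with [v ^ (al + s - 2)]; above [1] the exponential
    decay of one and the cancellation in the other suffice. *)
Lemma kob_crit_fun_le : exists2 C, 0 <= C & forall z, 0 <= Re z -> z != 0 -> cmod z <= 1 ->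
  forall v, 0 < v ->
  cmod (kob_fun al s z v%:C - crit_fun (cmod z) v) <= C * crit_bound (cmod z) v.
Proof.
have [Cs Cs0 hs] := cpow_lipschitz_one (s - 1).
have [Cp Cp0 hp] := cpow_shift_le p.
have [C4 C40 h4] := exp_decay_powR (1 + 1) (@ltr01 R).
set K := arg_bound al s.
have K0 : 0 <= K by exact: ltW (arg_bound_gt0 _ _).
have A0 : 0 <= 2 `^ (a + 1) :> R by exact: powR_ge0.
pose C := K * 2 `^ (a + 1) + 4 * (Cs + Cp) + 6 + K * C4 + 8 * Cp.
have C1' : 0 <= K * 2 `^ (a + 1) by rewrite mulr_ge0.
have C2' : 0 <= K * C4 by rewrite mulr_ge0// ltW.
have C0 : 0 <= C by rewrite /C; lra.
exists C => // z z0 zn0 z1 v v0; set r := cmod z.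
have r0 : 0 < r by rewrite cmod_gt0.
have r1 : r <= 1 by exact: z1.
have vr : 0 < v + r by rewrite addr_gt0.
have v1 : 0 < v + 1 by rewrite addr_gt0.
have [h1 h2] := @cmod_addr_ge _ v%:C z (ltW v0) erefl z0.
have ra0 := ratio_density_ge0 a r0 v0.
have r10 := ratio_density_ge0 1 r0 v0.
have t0 : 0 <= (v + 1) `^ (- 1 - 1) by exact: powR_ge0.
have cvr := cmod_crit vr; have cv1 := cmod_crit v1; have cv := cmod_crit v0.
have CB (x y t : R) : 0 <= x -> 0 <= y -> 0 <= t -> x <= C -> y <= C -> t <= C ->
    x * ratio_density a r v + y * ratio_density 1 r v + t * (v + 1) `^ (- 1 - 1) <=
    C * crit_bound r v.
  by move=> *; rewrite /crit_bound !mulrDr; do 2 ?apply: lerD; rewrite ler_wpM2r.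
have t1E := tail_density1 v0; have r1E := ratio_density1 r0 v0.
have [vler|rltv] := leP v r.
  apply: le_trans (CB (K * 2 `^ (a + 1)) 2 2 _ _ _ _ _ _) => //; try (rewrite /C; lra).
  apply: le_trans (cmodB _ _) _; rewrite -addrA; apply: lerD.
    apply: le_trans (cmod_kob_crit_le v0 z0 r0 h2) _.
    rewrite -[leRHS]mulrA ler_wpM2l// ratio_densityE//.
    have -> : v `^ (a - 1) * expR (- v) * r `^ (- a) = v `^ (a - 1) * (expR (- v) * r `^ (- a)).
      by rewrite mulrA.
    have -> : 2 `^ (a + 1) * (v `^ (a - 1) * r * (v + r) `^ (- a - 1)) =
      v `^ (a - 1) * (2 `^ (a + 1) * r * (v + r) `^ (- a - 1)) by ring.
    rewrite ler_wpM2l ?powR_ge0//.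
    apply: (@le_trans _ _ (r `^ (- a))).
      by rewrite ler_piMl ?powR_ge0// -expR0 ler_expR oppr_le0 ltW.
    apply: (@le_trans _ _ (2 `^ (a + 1) * r * (2 * r) `^ (- a - 1))); last first.
      rewrite ler_wpM2l ?mulr_ge0 ?(ltW r0)// !powR_exp ?mulr_gt0// ler_expR.
      rewrite ler_wnM2l//; first by have := al0; lra.
      by rewrite ler_ln ?posrE ?mulr_gt0//; lra.
    rewrite -{2}[r](@lnK R) ?posrE// !powR_exp ?mulr_gt0// lnM ?posrE// -!expRD ler_expR.
    lra.
  apply: le_trans (cmodB _ _) _; rewrite cvr cv1 r1E t1E; apply: lerD.
    by rewrite mulrA ler_pdivlMr ?exprn_gt0// expr2 mulKf ?gt_eqF//; lra.
  by rewrite ler_pdivlMr ?exprn_gt0// expr2 mulKf ?gt_eqF//; lra.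
have hY := hp v r v0 (ltW r0) (ltW rltv).
have vRe : v `^ Re p = v^-1 by rewrite Re_crit powR_inv1// ltW.
rewrite vRe in hY.
have rv2 : r / (v * v) <= 4 * ratio_density 1 r v.
  rewrite r1E mulrA ler_pdivrMr ?mulr_gt0// mulrAC ler_pdivlMr ?exprn_gt0// expr2.
  rewrite -[4 * r * _]mulrAC [4 * _ * r]mulrC ler_wpM2l ?(ltW r0)//; nra.
have [vle1|vgt1] := leP v 1.
  apply: le_trans (CB 0 (4 * (Cs + Cp)) 6 _ _ _ _ _ _) => //; try (rewrite /C; nra).
  rewrite mul0r add0r.
  set E := cexp (p * (ln v)%:C) in hY cv *.
  set X := cexp ((s - 1) * plog (1 + z * (v^-1)%:C)).
  have hX : cmod (X - 1) <= Cs * (r / v).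
    apply: le_trans (hs _ _ _) _.
    - by rewrite Re_mul_real_ge0 ?invr_ge0 ?(ltW v0).
    - by rewrite cmod_mul_real ?invr_ge0 ?(ltW v0)// -/r ler_pdivrMr// mul1r ltW.
    - by rewrite cmod_mul_real ?invr_ge0 ?(ltW v0).
  have kE : kob_fun al s z v%:C = E * (cexp (- v%:C) * X).
    rewrite /kob_fun plog_real// plog_scale// /E /X -!cexpD; congr cexp; ring.
  have kb : cmod (kob_fun al s z v%:C - E) <= v^-1 * (Cs * (r / v) + v).
    rewrite kE -{2}[E]mulr1 -mulrBr cmodM cv ler_wpM2l ?invr_ge0 ?(ltW v0)//.
    have -> : cexp (- v%:C) * X - 1 = cexp (- v%:C) * (X - 1) + (cexp (- v%:C) - 1) by ring.
    apply: le_trans (cmodD _ _) _; apply: lerD.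
      rewrite cmodM cmod_cexp ReN/=; apply: le_trans hX.
      by rewrite ler_piMl ?cmod_ge0// -expR0 ler_expR oppr_le0 ltW.
    rewrite -rmorphN cexp_real -(rmorphB _ (expR (- v)) 1) cmod_real.
    have e1 : expR (- v) <= 1 by rewrite -expR0 ler_expR oppr_le0 ltW.
    by rewrite ler0_norm; have := expR_ge1Dx (- v); lra.
  have -> : kob_fun al s z v%:C - crit_fun r v = (kob_fun al s z v%:C - E) -
      ((cexp (p * (ln (v + r))%:C) - E) - cexp (p * (ln (v + 1))%:C)).
    by rewrite /crit_fun; ring.
  apply: le_trans (cmodB _ _) _.
  have hD := cmodB (cexp (p * (ln (v + r))%:C) - E) (cexp (p * (ln (v + 1))%:C)).
  rewrite cv1 in hD.
  have e2 : v^-1 * (Cs * (r / v) + v) = Cs * (r / (v * v)) + 1.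
    by field; exact: lt0r_neq0.
  have e3 : Cp * v^-1 * (r / v) = Cp * (r / (v * v)) by field; exact: lt0r_neq0.
  rewrite e2 in kb; rewrite e3 in hY.
  have k1 : Cs * (r / (v * v)) <= Cs * (4 * ratio_density 1 r v) by rewrite ler_wpM2l.
  have k2 : Cp * (r / (v * v)) <= Cp * (4 * ratio_density 1 r v) by rewrite ler_wpM2l.
  have k3 : 1 + (v + 1)^-1 <= 6 * (v + 1) `^ (- 1 - 1).
    rewrite t1E ler_pdivlMr ?exprn_gt0// mulrDl mul1r expr2 mulKf ?gt_eqF//; nra.
  have -> : 4 * (Cs + Cp) * ratio_density 1 r v =
    Cs * (4 * ratio_density 1 r v) + Cp * (4 * ratio_density 1 r v) by ring.
  lra.
apply: le_trans (CB 0 0 (K * C4 + 8 * Cp) _ _ _ _ _ _) => //; try (rewrite /C; nra).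
rewrite !mul0r !add0r mulrDl; apply: le_trans (cmodB _ _) _; apply: lerD.
  have h := cmod_kob_crit_le v0 z0 v0 (le_trans (lexx _) h1).
  apply: le_trans h _; rewrite -[leRHS]mulrA ler_wpM2l//.
  have -> : v `^ (a - 1) * expR (- v) * v `^ (- a) = v^-1 * expR (- v).
    rewrite mulrAC -powRD ?(lt0r_neq0 v0) ?implybT//; congr (_ * _).
    by rewrite (_ : a - 1 - a = - 1) ?powR_inv1 ?ltW//; ring.
  have h5 := h4 v (ltW v0); rewrite mul1r in h5.
  apply: (@le_trans _ _ (expR (- v))).
    by rewrite ler_piMl ?expR_ge0// invf_le1// ltW.
  rewrite (_ : - 1 - 1 = - (1 + 1) :> R); last by ring.
  by rewrite powRN ler_pdivlMr ?powR_gt0// mulrC.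
have hY1 := hp v 1 v0 ler01 (ltW vgt1); rewrite vRe in hY1.
have -> : crit_fun r v = (cexp (p * (ln (v + r))%:C) - cexp (p * (ln v)%:C)) -
   (cexp (p * (ln (v + 1))%:C) - cexp (p * (ln v)%:C)) by rewrite /crit_fun; ring.
apply: le_trans (cmodB _ _) _.
have e3 : Cp * v^-1 * (r / v) = Cp * (r / (v * v)) by field; exact: lt0r_neq0.
have e4 : Cp * v^-1 * (1 / v) = Cp * (1 / (v * v)) by field; exact: lt0r_neq0.
rewrite e3 in hY; rewrite e4 in hY1.
have k1 : Cp * (r / (v * v)) <= Cp * (1 / (v * v)).
  by rewrite ler_wpM2l// ler_wpM2r// invr_ge0 mulr_ge0 ?ltW.
have k2 : Cp * (1 / (v * v)) <= Cp * (4 * (v + 1) `^ (- 1 - 1)).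
  rewrite ler_wpM2l// t1E mul1r ler_pdivlMr ?exprn_gt0// mulrC ler_pdivrMr ?mulr_gt0// expr2.
  nra.
have -> : 8 * Cp * (v + 1) `^ (- 1 - 1) = Cp * (4 * (v + 1) `^ (- 1 - 1)) +
  Cp * (4 * (v + 1) `^ (- 1 - 1)) by ring.
lra.
Qed.

Lemma crit_bound_int r : 0 < r -> rint (posline R) (crit_bound r).
Proof.
move=> r0; have mp := measurable_posline R.
by apply: (rintD mp (rintD mp (ratio_density_int al0 r0).1 (ratio_density_int ltr01 r0).1));
  exact: tail_density_int.
Qed.

Lemma crit_bound_integral r : 0 < r ->
  \int[mu]_(v in posline R) crit_bound r v <=
  a^-1 + 1 + \int[mu]_(v in posline R) (v + 1) `^ (- 1 - 1).
Proof.
move=> r0; have mp := measurable_posline R.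
have [i1 b1] := ratio_density_int al0 r0; have [i2 b2] := ratio_density_int (@ltr01 R) r0.
have i3 := tail_density_int (@ltr01 R).
rewrite /crit_bound RintegralD//; last exact: rintD.
rewrite RintegralD// lerD2r; apply: lerD => //.
by move: b2; rewrite invr1.
Qed.

Lemma crit_fun_int r : 0 < r -> r <= 1 -> cintegrable (posline R) (crit_fun r).
Proof.
move=> r0 r1; have mp := measurable_posline R.
have [C C0 hC] := kob_crit_fun_le.
have rn0 := real_neq0 r0.
have cr : cmod r%:C = r by rewrite cmod_real gtr0_norm.
have ki := @kob_fun_int _ al s al0 r%:C (ltW r0) rn0.
have mc : cmeas (posline R) (crit_fun r).
  apply: (@cmeas_ext _ _ _ _ (fun v => cexp (p * (ln (v + r))%:C) +
    (- 1) * cexp (p * (ln (v + 1))%:C))); last by move=> v _; rewrite mulN1r.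
  apply: cmeasD; last (apply: cmeasM; first exact: cmeas_cst);
    by apply: cmeas_cexp; apply: cmeas_ln; exact: measurable_funD.
have di : cintegrable (posline R) (fun v => kob_fun al s r%:C v%:C - crit_fun r v).
  apply: (cintegrable_le mp _ (rintZ C mp (crit_bound_int r0))).
    apply: (@cmeas_ext _ _ _ _ (fun v => kob_fun al s r%:C v%:C + (- 1) * crit_fun r v)).
      by apply: cmeasD; [exact: cintegrable_cmeas|apply: cmeasM => //; exact: cmeas_cst].
    by move=> v _; rewrite mulN1r.
  move=> v /poslineP v0; have := hC r%:C (ltW r0) rn0; rewrite cr => /(_ r1 v v0).
  exact.
apply: (cintegrable_ext mp (cintegrableD mp ki (cintegrableZ (-1) mp di))) => v _.
by ring.
Qed.

(** Up to a bounded error [kob al s z] depends on [|z|] only. *)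
Lemma kob_crit_near : exists2 C, 0 <= C & forall z, 0 <= Re z -> z != 0 -> cmod z <= 1 ->
  cmod (kob al s z - cintegral (posline R) (crit_fun (cmod z))) <= C.
Proof.
have mp := measurable_posline R.
have [C C0 hC] := kob_crit_fun_le.
set T := a^-1 + 1 + \int[mu]_(v in posline R) (v + 1) `^ (- 1 - 1).
have T0 : 0 <= T.
  rewrite !addr_ge0 ?invr_ge0 ?(ltW al0)//; apply: Rintegral_ge0 => v _.
  exact: powR_ge0.
exists (2 * (C * T)); first by rewrite !mulr_ge0.
move=> z z0 zn0 z1; have r0 : 0 < cmod z by rewrite cmod_gt0.
have ki := kob_fun_int s al0 z0 zn0.
have ci := cintegrableZ (- 1) mp (crit_fun_int r0 z1).
have e : kob al s z - cintegral (posline R) (crit_fun (cmod z)) =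
    cintegral (posline R) (fun v => kob_fun al s z v%:C + (- 1) * crit_fun (cmod z) v).
  by rewrite cintegralD// cintegralZ ?mulN1r//; exact: crit_fun_int.
rewrite e; apply: le_trans (cmod_cintegral_le mp _ (rintZ C mp (crit_bound_int r0)) _) _.
- exact: cintegrableD.
- by move=> v /poslineP v0; rewrite mulN1r; exact: hC.
- rewrite RintegralZl//; last exact: crit_bound_int.
  by rewrite ler_wpM2l// ler_wpM2l// crit_bound_integral.
Qed.

Lemma ccont_crit_fun r v : 0 < v -> 0 < r -> ccont (crit_fun r) v.
Proof.
move=> v0 r0.
have D q (x : R) : 0 < x -> cderiv (fun v => cexp (q * (ln (v + x))%:C)) v
    (q * (v + x)^-1%:C * cexp (q * (ln (v + x))%:C)).
  move=> x0; have vx : 0 < v + x by rewrite addr_gt0.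
  have d := cderivZ q (cderiv_real (@is_derive_comp1 _ (@ln R) (fun v => v + x) _ _ _
    (is_derive1_ln vx) (is_derive_shift1 x v))).
  by apply: cderiv_ext (cderiv_cexp d) _ _ => //; rewrite mulr1.
apply: cderiv_ccont; apply: cderiv_ext (cderivD (D p r r0) (cderivZ (-1) (D p 1 ltr01))) _ erefl.
by move=> t; rewrite mulN1r.
Qed.

End CriticalCase.

(** * Domination of the perturbed kernel *)

Section CriticalValue.
Variable R : realType.
Local Notation mu := (@lebesgue_measure R).
Variables (al s : R[i]).
Hypotheses (al0 : 0 < Re al) (as1 : Re al + Re s = 1).
Implicit Types (z : R[i]) (v r x : R).

Local Notation p := (al + s - 1 - 1).
Local Notation q := (al + s - 1).

Lemma cderiv_cexp_ln (k : R[i]) v x : 0 < v + x ->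
  cderiv (fun v => cexp (k * (ln (v + x))%:C)) v (k * cexp ((k - 1) * (ln (v + x))%:C)).
Proof.
move=> vx.
have d := cderivZ k (cderiv_real (@is_derive_comp1 _ (@ln R) (fun v => v + x) _ _ _
  (is_derive1_ln vx) (is_derive_shift1 x v))).
apply: cderiv_ext (cderiv_cexp d) _ _ => //.
rewrite mulr1 -mulrA; congr (_ * _).
rewrite mulrBl mul1r cexpD cexpN cexp_real lnK// mulrC; congr (_ * _).
by rewrite fmorphV.
Qed.

(** The primitive is [((v + r) ^ q - (v + 1) ^ q) / q], whose two terms have
    modulus [1] because [q] is purely imaginary. *)
Lemma crit_integral_bounded : q != 0 -> exists C, forall r, 0 < r -> r <= 1 ->
  cmod (cintegral (posline R) (crit_fun al s r)) <= C.
Proof.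
move=> qn0; exists (cmod q^-1 * 2) => r r0 r1.
have [C C0 hC] := cpow_shift_le q.
have Rq := Re_crit1 as1.
pose P v := q^-1 * (cexp (q * (ln (v + r))%:C) - cexp (q * (ln (v + 1))%:C)).
have dP v : 0 <= v -> cderiv P v (crit_fun al s r v).
  move=> v0; have vr : 0 < v + r by rewrite ltr_wpDl.
  have v1 : 0 < v + 1 by rewrite ltr_wpDl.
  have d := cderivD (cderiv_cexp_ln q vr) (cderivZ (-1) (cderiv_cexp_ln q v1)).
  apply: cderiv_ext (cderivZ q^-1 d) _ _ => [t|].
    by rewrite /P mulN1r.
  by rewrite /crit_fun; field.
have one x : 0 < x -> cmod (cexp (q * (ln x)%:C)) = 1.
  by move=> x0; rewrite cmod_cexp ReM/= mulr0 subr0 Rq mul0r expR0.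
rewrite (@cintegral_of_primitive _ _ P (P 0) 0).
- rewrite sub0r cmodN cmodM ler_wpM2l ?cmod_ge0// (le_trans (cmodB _ _))//.
  by rewrite !one ?add0r ?ltr01//; lra.
- by move=> v v0; apply: dP; exact: ltW.
- by move=> v v0; exact: ccont_crit_fun.
- exact: crit_fun_int.
- exact: ccont_ccvg (cderiv_ccont (dP 0 (lexx _))) (@invn_cvg0 R).
- apply: (@ccvg_squeeze _ _ (fun n => cmod q^-1 * (2 * C) * n.+2%:R^-1)); last first.
    by rewrite -(mulr0 (cmod q^-1 * (2 * C))); apply: cvgM; [exact: cvg_cst|exact: invn_cvg0].
  move=> n; have n0 : (0 : R) < n.+2%:R by rewrite ltr0n.
  have n1 : (1 : R) <= n.+2%:R by rewrite ler1n.
  rewrite cmodM -mulrA ler_wpM2l ?cmod_ge0//.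
  have h1 := hC n.+2%:R r n0 (ltW r0) (le_trans r1 n1).
  have h2 := hC n.+2%:R 1 n0 ler01 n1.
  rewrite Rq powRr0 mulr1 in h1 h2; rewrite mul1r in h2.
  have h3 : C * (r / n.+2%:R) <= C * n.+2%:R^-1.
    by rewrite ler_wpM2l// ler_piMl// invr_ge0 ltW.
  have -> : cexp (q * (ln (n.+2%:R + r))%:C) - cexp (q * (ln (n.+2%:R + 1))%:C) =
    (cexp (q * (ln (n.+2%:R + r))%:C) - cexp (q * (ln n.+2%:R)%:C)) -
    (cexp (q * (ln (n.+2%:R + 1))%:C) - cexp (q * (ln n.+2%:R)%:C)) by ring.
  have -> : 2 * C / n.+2%:R = C / n.+2%:R + C / n.+2%:R by ring.
  by apply: le_trans (cmodB _ _) _; apply: lerD => //; exact: le_trans h3.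
Qed.

(** For [q = 0] the comparison integral is unbounded, but it decreases in [r]:
    again a smaller argument gives a larger value. *)
Lemma crit_integral_log r : q = 0 -> 0 < r -> r <= 1 ->
  cintegral (posline R) (crit_fun al s r) = (- ln r)%:C.
Proof.
move=> q0 r0 r1.
pose P v : R[i] := (ln (v + r) - ln (v + 1))%:C.
have dP v : 0 <= v -> cderiv P v (crit_fun al s r v).
  move=> v0; have vr : 0 < v + r by rewrite ltr_wpDl.
  have v1 : 0 < v + 1 by rewrite ltr_wpDl.
  have d x : 0 < v + x -> is_derive v 1 (fun v => ln (v + x)) (v + x)^-1.
    move=> vx; apply: is_derive_ext (@is_derive_comp1 _ (@ln R) (fun v => v + x) _ _ _
      (is_derive1_ln vx) (is_derive_shift1 x v)) _ _ => //.
    by rewrite mulr1.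
  apply: cderiv_ext (cderiv_real (is_deriveD1 (d _ vr) (is_deriveN1 (d _ v1)))) _ _ => //.
  have e x : 0 < x -> cexp (p * (ln x)%:C) = (x^-1)%:C.
    move=> x0; rewrite q0 sub0r mulN1r cexpN cexp_real lnK//.
    by rewrite fmorphV.
  by rewrite /crit_fun !e// rmorphB.
rewrite (@cintegral_of_primitive _ _ P (P 0) 0).
- by rewrite sub0r /P !add0r ln1 subr0 rmorphN.
- by move=> v v0; apply: dP; exact: ltW.
- by move=> v v0; exact: ccont_crit_fun.
- exact: crit_fun_int.
- exact: ccont_ccvg (cderiv_ccont (dP 0 (lexx _))) (@invn_cvg0 R).
- apply: (@ccvg_squeeze _ _ (fun n => n.+2%:R^-1)); last exact: invn_cvg0.
  move=> n; have n0 : (0 : R) < n.+2%:R by rewrite ltr0n.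
  have nr : 0 < n.+2%:R + r by rewrite addr_gt0.
  have n1 : 0 < n.+2%:R + 1 :> R by rewrite addr_gt0.
  have le : ln (n.+2%:R + r) <= ln (n.+2%:R + 1) by rewrite ler_ln ?posrE// lerD2l.
  rewrite cmod_real ler0_norm ?subr_le0// opprB -ln_div ?posrE//.
  have -> : (n.+2%:R + 1) / (n.+2%:R + r) = 1 + (1 - r) / (n.+2%:R + r).
    have nr0 := lt0r_neq0 nr.
    by apply: (mulIf nr0); rewrite divfK// mulrDl mul1r divfK//; ring.
  have q1 : 0 <= (1 - r) / (n.+2%:R + r) by rewrite divr_ge0 ?subr_ge0// ltW.
  apply: le_trans (le_ln1Dx _) _; first lra.
  rewrite ler_pdivrMr// mulrDr mulVf ?gt_eqF//.
  have : 0 <= n.+2%:R^-1 * r by rewrite mulr_ge0 ?invr_ge0 ?ltW.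
  by move: (_^-1 * r) => w w0; move: r0; lra.
Qed.

End CriticalValue.

Section Domination.
Variable R : realType.
Local Notation mu := (@lebesgue_measure R).
Variables (al s : R[i]).
Hypotheses (al0 : 0 < Re al).
Implicit Types (z : R[i]) (v u M : R).

Lemma cmod_kob_le z (g : R -> R) : 0 <= Re z -> z != 0 -> rint (posline R) g ->
  (forall v, 0 < v -> cmod (kob_fun al s z v%:C) <= g v) ->
  cmod (kob al s z) <= 2 * \int[mu]_(v in posline R) g v.
Proof.
move=> z0 zn0 ig kg; apply: cmod_cintegral_le => //; first exact: measurable_posline.
  exact: kob_fun_int.
by move=> v /poslineP v0; exact: kg.
Qed.

Lemma kob_bounded_far : Re s <= 1 -> exists2 C, 0 <= C &
  forall z, 0 <= Re z -> 1 <= cmod z -> cmod (kob al s z) <= C.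
Proof.
move=> s1; have mp := measurable_posline R.
have i := rintZ (arg_bound al s) mp (gamma_density_int al0 (@ltr01 R)).
eexists; last first.
  move=> z z0 z1; have zn0 : z != 0 by rewrite -cmod_gt0 (lt_le_trans _ z1).
  apply: (cmod_kob_le z0 zn0 i) => v v0.
  apply: le_trans (cmod_kob_fun_real_le al s v0 z0) _.
  rewrite mul1r ler_wpM2l ?(ltW (arg_bound_gt0 _ _))// ler_piMr ?mulr_ge0 ?powR_ge0 ?expR_ge0//.
  have [_ h] := @cmod_addr_ge _ v%:C z (ltW v0) erefl z0.
  by rewrite -[leRHS](powRr0 (cmod (v%:C + z))) ler_powR ?subr_le0// (le_trans z1).
rewrite mulr_ge0//; apply: Rintegral_ge0 => v _.
by rewrite !mulr_ge0 ?powR_ge0 ?expR_ge0 ?(ltW (arg_bound_gt0 _ _)).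
Qed.

Lemma kob_bounded : Re s <= 1 -> 1 < Re al + Re s -> exists2 C, 0 <= C &
  forall z, 0 <= Re z -> z != 0 -> cmod (kob al s z) <= C.
Proof.
move=> s1 as1; have mp := measurable_posline R.
have a1 : 0 < Re al + Re s - 1 by rewrite subr_gt0.
have i := rintZ (arg_bound al s) mp (gamma_density_int a1 (@ltr01 R)).
eexists; last first.
  move=> z z0 zn0; apply: (cmod_kob_le z0 zn0 i) => v v0.
  apply: le_trans (cmod_kob_fun_real_le al s v0 z0) _.
  rewrite mul1r ler_wpM2l ?(ltW (arg_bound_gt0 _ _))//.
  have [h _] := @cmod_addr_ge _ v%:C z (ltW v0) erefl z0.
  have vz : 0 < cmod (v%:C + z) by apply: lt_le_trans h.
  rewrite mulrAC ler_wpM2r ?expR_ge0//.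
  rewrite !powR_exp// -expRD ler_expR.
  have -> : (Re al + Re s - 1 - 1) * ln v = (Re al - 1) * ln v + (Re s - 1) * ln v by ring.
  by rewrite lerD2l ler_wnM2l ?subr_le0// ler_ln ?posrE.
rewrite mulr_ge0//; apply: Rintegral_ge0 => v _.
by rewrite !mulr_ge0 ?powR_ge0 ?expR_ge0 ?(ltW (arg_bound_gt0 _ _)).
Qed.

Lemma kob_upper_infty : 0 <= Re s - 1 -> exists2 C, 0 <= C &
  forall z, 0 <= Re z -> z != 0 -> cmod (kob al s z) <= C * (1 + cmod z) `^ (Re s - 1).
Proof.
move=> s1; have mp := measurable_posline R.
have [C C0 hC] := exp_decay_powR (Re s - 1) (@half_gt0 R).
have i := gamma_density_int al0 (@half_gt0 R).
set I := \int[mu]_(v in posline R) (v `^ (Re al - 1) * expR (- (2^-1 * v))).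
have I0 : 0 <= I by apply: Rintegral_ge0 => v _; rewrite mulr_ge0 ?powR_ge0 ?expR_ge0.
have A0 := ltW (arg_bound_gt0 al s).
exists (2 * (arg_bound al s * C * I)); first by rewrite !mulr_ge0// ltW.
move=> z z0 zn0; set W := (1 + cmod z) `^ (Re s - 1).
have W0 : 0 <= W by exact: powR_ge0.
have -> : 2 * (arg_bound al s * C * I) * W = 2 * (arg_bound al s * C * W * I) by ring.
rewrite -RintegralZl//.
apply: cmod_kob_le => //; first exact: rintZ.
move=> v v0; apply: le_trans (cmod_kob_fun_real_le al s v0 z0) _.
have v1 : 0 < v + 1 by rewrite addr_gt0.
have k : cmod (v%:C + z) `^ (Re s - 1) <= W * (v + 1) `^ (Re s - 1).
  rewrite /W -powRM ?addr_ge0 ?cmod_ge0 ?(ltW v0)//.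
  rewrite ge0_ler_powR ?nnegrE ?cmod_ge0//.
    by rewrite mulr_ge0 ?addr_ge0 ?cmod_ge0 ?(ltW v0).
  apply: le_trans (cmodD _ _) _; rewrite cmod_real gtr0_norm//.
  by have := cmod_ge0 z; nra.
have -> : expR (- v) = expR (- (2^-1 * v)) * expR (- (2^-1 * v)).
  by rewrite -expRD; congr expR; field.
have e0 := expR_ge0 (- (2^-1 * v)).
have w0 := powR_ge0 v (Re al - 1).
apply: (@le_trans _ _ (arg_bound al s * (v `^ (Re al - 1) * (expR (- (2^-1 * v)) *
  expR (- (2^-1 * v))) * (W * (v + 1) `^ (Re s - 1))))).
  by rewrite ler_wpM2l// ler_wpM2l ?mulr_ge0.
have -> : arg_bound al s * (v `^ (Re al - 1) * (expR (- (2^-1 * v)) *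
  expR (- (2^-1 * v))) * (W * (v + 1) `^ (Re s - 1))) =
  arg_bound al s * W * (v `^ (Re al - 1) * expR (- (2^-1 * v))) *
  ((v + 1) `^ (Re s - 1) * expR (- (2^-1 * v))) by ring.
have -> : arg_bound al s * C * W * (v `^ (Re al - 1) * expR (- (2^-1 * v))) =
  arg_bound al s * W * (v `^ (Re al - 1) * expR (- (2^-1 * v))) * C by ring.
by rewrite ler_wpM2l ?hC ?(ltW v0)// !mulr_ge0.
Qed.

(** Near the origin [kob] is, up to bounded terms, either bounded or the
    decreasing function [- ln |z|]; in both cases enlarging the modulus of the
    argument does not increase it essentially. *)
Lemma kob_dominated_critical : Re al + Re s = 1 -> exists2 C, 0 <= C &
  forall z z', 0 <= Re z -> 0 <= Re z' -> z != 0 -> cmod z <= cmod z' ->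
  cmod (kob al s z') <= C * (1 + cmod (kob al s z)).
Proof.
move=> as1.
have [C1 C10 h1] := kob_crit_near al0 as1.
have [C2 C20 h2] : exists2 C, 0 <= C &
    forall z, 0 <= Re z -> 1 <= cmod z -> cmod (kob al s z) <= C.
  by apply: kob_bounded_far; have := al0; lra.
have [C3 C30 h3] : exists2 C, 0 <= C & forall r r', 0 < r -> r <= r' -> r' <= 1 ->
    cmod (cintegral (posline R) (crit_fun al s r')) <=
    C + cmod (cintegral (posline R) (crit_fun al s r)).
  have [q0|qn0] := eqVneq (al + s - 1) 0.
    exists 0 => // r r' r0 rr r1; have r'0 := lt_le_trans r0 rr.
    rewrite !(crit_integral_log al0 as1 q0)// ?(le_trans rr)// !cmod_real !normrN add0r.
    have l' : ln r' <= 0 by rewrite ln_le0.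
    have l : ln r <= ln r' by rewrite ler_ln ?posrE.
    by rewrite !ler0_norm ?lerN2// (le_trans l).
  have [C hC] := crit_integral_bounded al0 as1 qn0.
  exists C; first exact: le_trans (cmod_ge0 _) (hC 1 ltr01 (lexx _)).
  move=> r r' r0 rr r1; apply: le_trans (hC r' (lt_le_trans r0 rr) r1) _.
  by rewrite lerDl cmod_ge0.
exists (C2 + (C1 + C3 + C1) + 1); first by rewrite !addr_ge0.
move=> z z' z0 z'0 zn0 zz'.
set k := cmod (kob al s z); have k0 : 0 <= k by exact: cmod_ge0.
have r0 : 0 < cmod z by rewrite cmod_gt0.
have z'n0 : z' != 0 by rewrite -cmod_gt0 (lt_le_trans r0).
have big : (C2 + (C1 + C3 + C1) + 1) * (1 + k) =
    C2 + (C1 + C3 + C1) + 1 + k + (C2 + (C1 + C3 + C1)) * k by ring.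
have big0 : 0 <= (C2 + (C1 + C3 + C1)) * k by rewrite mulr_ge0 ?addr_ge0.
rewrite big.
have [z'1|z'1] := leP 1 (cmod z'); first by have := h2 z' z'0 z'1; lra.
have z1 := le_trans zz' (ltW z'1).
have e1 := h1 z' z'0 z'n0 (ltW z'1).
have e2 := h1 z z0 zn0 z1.
have e3 := h3 _ _ r0 zz' (ltW z'1).
set L' := cintegral (posline R) (crit_fun al s (cmod z')) in e1 e3.
set L := cintegral (posline R) (crit_fun al s (cmod z)) in e2 e3.
have t1 : cmod (kob al s z') <= cmod (kob al s z' - L') + cmod L'.
  by rewrite -{1}[kob al s z'](subrK L') cmodD.
have t2 : cmod L <= cmod (kob al s z - L) + k.
  by rewrite cmod_subC -{1}[L](subrK (kob al s z)) cmodD.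
apply: (@le_trans _ _ (C1 + (C3 + (C1 + k)))).
  apply: le_trans t1 _; apply: lerD e1 _; apply: le_trans e3 _.
  by rewrite lerD2l; apply: le_trans t2 _; rewrite lerD2r.
move: big0; move: (_ * k) => X X0; clear - C10 C20 C30 k0 X0; lra.
Qed.

(** The kernel at a perturbed argument is controlled by the kernel at the
    unperturbed one: this is what makes the existence of the right-hand side
    of the transform formula usable as a domination hypothesis. For [1 < Re s]
    the kernel is of exact order [|z| ^ (Re s - 1)] at infinity and bounded
    elsewhere; for [Re s <= 1] it is bounded at infinity, and near the origin it
    is bounded, logarithmic or of exact order [|z| ^ (Re al + Re s - 1)],
    according to the sign of [Re al + Re s - 1]. *)
Lemma kob_dominated (b : R[i]) M : 0 <= Re b -> b != 0 -> cGamma al != 0 ->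
  exists2 C, 0 <= C & forall u z, 0 < u -> 0 <= Re z ->
  cmod b * u <= cmod z -> cmod z <= M * (u + 1) ->
  cmod (kob al s z) <= C * (1 + cmod (kob al s (b * u%:C))).
Proof.
move=> b0 bn0 G0; have cb0 : 0 < cmod b by rewrite cmod_gt0.
have zn0 u z : 0 < u -> cmod b * u <= cmod z -> z != 0.
  by move=> u0 h; rewrite -cmod_gt0; apply: lt_le_trans h; rewrite mulr_gt0.
have one_le (C : R) (k : R) : 0 <= C -> 0 <= k -> C <= C * (1 + k).
  by move=> C0 k0; rewrite ler_peMr// lerDl.
have [s1|s1] := ltP 1 (Re s).
  have p0 : 0 <= Re s - 1 by rewrite subr_ge0 ltW.
  have mono (x y : R) : 0 <= x -> x <= y -> x `^ (Re s - 1) <= y `^ (Re s - 1).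
    by move=> x0 xy; rewrite ge0_ler_powR ?nnegrE// (le_trans x0).
  have [C C0 hC] := kob_upper_infty p0.
  have [c c0 [U U0 hU]] := kob_lower_infty al0 b0 bn0 p0 G0.
  pose N := Num.max M 0.
  have N0 : 0 <= N by rewrite le_max lexx orbT.
  have MN : M <= N by rewrite le_max lexx.
  pose D := (1 + N) / U + N.
  have D0 : 0 <= D by rewrite addr_ge0// divr_ge0 ?addr_ge0// ltW.
  pose C' := C * (1 + N * (U + 1)) `^ (Re s - 1) + C * (D `^ (Re s - 1) / c).
  have C'0 : 0 <= C' by rewrite !addr_ge0 ?mulr_ge0 ?powR_ge0 ?invr_ge0// ltW.
  exists C' => // u z u0 z0 bz zM.
  have zN : cmod z <= N * (u + 1).
    by apply: le_trans zM _; rewrite ler_wpM2r ?addr_ge0// ltW.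
  apply: le_trans (hC z z0 (zn0 u z u0 bz)) _.
  set k := cmod (kob al s (b * u%:C)); have k0 : 0 <= k by exact: cmod_ge0.
  have [uU|uU] := leP u U.
    apply: le_trans (one_le _ k C'0 k0).
    apply: (@le_trans _ _ (C * (1 + N * (U + 1)) `^ (Re s - 1))); last first.
      by rewrite lerDl mulr_ge0 ?divr_ge0 ?powR_ge0// ltW.
    rewrite ler_wpM2l// mono ?addr_ge0 ?cmod_ge0// lerD2l.
    by rewrite (le_trans zN)// ler_wpM2l// lerD2r.
  apply: (@le_trans _ _ (C * (D `^ (Re s - 1) / c) * k)).
    rewrite -mulrA ler_wpM2l// mulrAC -mulrA.
    apply: (@le_trans _ _ (D `^ (Re s - 1) * u `^ (Re s - 1))); last first.
      rewrite ler_wpM2l ?powR_ge0// ler_pdivlMr// mulrC.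
      by apply: hU; exact: ltW.
    rewrite -powRM ?(ltW u0)// mono ?addr_ge0 ?cmod_ge0//.
    rewrite /D mulrDl.
    have h : 1 + N <= (1 + N) / U * u.
      by rewrite mulrAC ler_pdivlMr// ler_wpM2l ?addr_ge0// ltW.
    by rewrite mulrDr mulr1 in zN; lra.
  apply: le_trans (_ : C' * k <= _).
    by rewrite ler_wpM2r// lerDr mulr_ge0 ?powR_ge0.
  by rewrite ler_wpM2l// lerDr.
have [as1|as1|as1] := ltgtP (Re al + Re s) 1; last first.
- have [C C0 hC] := kob_dominated_critical as1.
  exists C => // u z u0 z0 bz _.
  apply: hC => //; first by rewrite Re_mul_real_ge0// ltW.
    by rewrite mulf_neq0// real_neq0.
  by rewrite cmod_mul_real// ltW.
- have [C C0 hC] := kob_bounded s1 as1.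
  exists C => // u z u0 z0 bz _; apply: le_trans (hC z z0 (zn0 u z u0 bz)) _.
  by rewrite one_le// cmod_ge0.
have [C C0 hC] := kob_upper_zero al0 as1.
have [c c0 [U U0 hU]] := kob_lower_zero al0 b0 bn0 as1.
set e := Re al + Re s - 1 in hC hU.
have e0 : e <= 0 by rewrite /e; lra.
pose C1 := C * cmod b `^ e.
have C10 : 0 <= C1 by rewrite mulr_ge0 ?powR_ge0.
pose C' := C1 * (U^-1) `^ e + C1 / c.
have C'0 : 0 <= C' by rewrite addr_ge0 ?mulr_ge0 ?powR_ge0 ?invr_ge0// ltW.
have le_neg (x y : R) : 0 < x -> x <= y -> y `^ e <= x `^ e.
  move=> x0 xy; have y0 := lt_le_trans x0 xy.
  by rewrite !powR_exp// ler_expR ler_wnM2l// ler_ln ?posrE.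
exists C' => // u z u0 z0 bz _.
set k := cmod (kob al s (b * u%:C)); have k0 : 0 <= k by exact: cmod_ge0.
apply: le_trans (hC z z0 (zn0 u z u0 bz)) _.
apply: (@le_trans _ _ (C1 * u `^ e)).
  rewrite -mulrA ler_wpM2l// -powRM ?(ltW u0) ?(ltW cb0)//.
  by apply: le_neg => //; rewrite mulr_gt0.
have [Uu|uU] := leP U u^-1.
  apply: (@le_trans _ _ (C1 / c * k)).
    rewrite -mulrA ler_wpM2l// mulrC ler_pdivlMr// mulrC.
    exact: hU.
  apply: le_trans (_ : C' * k <= _).
    by rewrite ler_wpM2r// lerDr mulr_ge0 ?powR_ge0.
  by rewrite ler_wpM2l// lerDr.
apply: le_trans (one_le _ k C'0 k0).
apply: (@le_trans _ _ (C1 * U^-1 `^ e)); last by rewrite lerDl mulr_ge0// invr_ge0 ltW.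
rewrite ler_wpM2l// le_neg ?invr_gt0//.
by rewrite -[u]invrK lef_pV2 ?posrE ?invr_gt0// ltW.
Qed.

End Domination.

(** * Translation invariance and the Fubini theorem *)

Section Translation.
Variable R : realType.
Local Notation mu := (@lebesgue_measure R).

Definition translate (c : R) (x : measurableTypeR R) : measurableTypeR R := x + c.

Lemma measurable_translate c : measurable_fun [set: measurableTypeR R] (translate c).
Proof. by apply: measurable_funD => //; exact: measurable_cst. Qed.

HB.instance Definition _ c :=
  isMeasurableFun.Build _ _ _ _ (translate c) (measurable_translate c).

Lemma lebesgue_measure_translate c (A : set (measurableTypeR R)) : measurable A ->
  pushforward mu (translate c) A = mu A.
Proof.
move=> mA; apply/esym/lebesgue_measure_unique => //= _ [[a b]] _ <-.
have -> : pushforward mu (translate c) `]a, b]%classic = mu `]a - c, b - c]%classic.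
  rewrite /pushforward; congr (lebesgue_measure _); apply/seteqP; split=> x /=;
    by rewrite /translate !in_itv/= ltrBlDr lerBrDr.
by rewrite !lebesgue_measure_itv/= !lte_fin ltrD2r EFinN -!EFinB opprD opprK addrACA addNr addr0.
Qed.

Lemma ge0_integral_translate (g : R -> \bar R) c : measurable_fun [set: measurableTypeR R] g ->
  (forall x, 0 <= g x)%E -> (\int[mu]_x g (x + c)%R = \int[mu]_x g x)%E.
Proof.
move=> mg g0.
transitivity (\int[pushforward mu (translate c)]_x g x)%E.
  by rewrite ge0_integral_pushforward// preimage_setT.
by apply: eq_measure_integral => A mA _; exact: lebesgue_measure_translate.
Qed.

Lemma integral_translate (g : R -> \bar R) c : measurable_fun [set: measurableTypeR R] g ->
  (\int[mu]_x g (x + c)%R = \int[mu]_x g x)%E.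
Proof.
move=> mg; rewrite integralE [RHS]integralE; congr (_ - _)%E.
  rewrite -[RHS](@ge0_integral_translate _ c)//; last exact: measurable_funepos.
  by apply: eq_integral => x _; rewrite !funeposE.
rewrite -[RHS](@ge0_integral_translate _ c)//; last exact: measurable_funeneg.
by apply: eq_integral => x _; rewrite !funenegE.
Qed.

Lemma cintegral_translate (g : R -> R[i]) c : cmeas [set: measurableTypeR R] g ->
  cintegral setT (fun x => g (x + c)) = cintegral setT g.
Proof.
move=> [a b]; rewrite /cintegral /Rintegral; congr (fine _ +i* fine _).
  by apply: (@integral_translate (fun x => (Re (g x))%:E)); exact/measurable_EFinP.
by apply: (@integral_translate (fun x => (Im (g x))%:E)); exact/measurable_EFinP.
Qed.

End Translation.

Section ZeroExtension.
Variable R : realType.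
Local Notation mu := (@lebesgue_measure R).
Implicit Types (D : set (measurableTypeR R)) (f : R -> R[i]).

(** Extension by zero turns the convolution on the half line into one on the
    line, where translation invariance and Fubini's theorem apply without
    bookkeeping of domains. *)
Definition czext D f (x : R) : R[i] := if x \in D then f x else 0.

Lemma czext_in D f x : D x -> czext D f x = f x.
Proof. by move=> Dx; rewrite /czext mem_set. Qed.

Lemma czext_out D f x : ~ D x -> czext D f x = 0.
Proof. by move=> Dx; rewrite /czext memNset. Qed.

Lemma Re_czext D f : (fun x => Re (czext D f x)) = (fun x => Re (f x)) \_ D.
Proof. by apply/funext => x; rewrite /czext patchE; case: ifP. Qed.

Lemma Im_czext D f : (fun x => Im (czext D f x)) = (fun x => Im (f x)) \_ D.
Proof. by apply/funext => x; rewrite /czext patchE; case: ifP. Qed.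

Lemma cintegral_czext D f : cintegral setT (czext D f) = cintegral D f.
Proof.
by rewrite /cintegral Re_czext Im_czext -!Rintegral_mkcond.
Qed.

Lemma cmeas_czext D f : measurable D -> cmeas D f ->
  cmeas [set: measurableTypeR R] (czext D f).
Proof.
move=> mD [a b]; split.
  by rewrite Re_czext; apply/(measurable_restrictT _ mD).
by rewrite Im_czext; apply/(measurable_restrictT _ mD).
Qed.

Lemma cintegrable_czext D f : measurable D ->
  cintegrable D f <-> cintegrable setT (czext D f).
Proof.
move=> mD.
have h (p q : R -> R) : q = p \_ D -> mu.-integrable D (EFin \o p) <->
    mu.-integrable setT (EFin \o q).
  by move=> ->; rewrite (integrable_mkcond _ mD) restrict_EFin.
have [h1 h1'] := h _ _ (Re_czext D f); have [h2 h2'] := h _ _ (Im_czext D f).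
by split=> -[a b]; split; [exact: h1|exact: h2|exact: h1'|exact: h2'].
Qed.

End ZeroExtension.

Section ComplexFubini.
Variable R : realType.
Local Notation mu := (@lebesgue_measure R).
Local Notation T := (measurableTypeR R).
Implicit Types (h : T * T -> R).

(** The inner integrals are real numbers here, with the value [0] on the null set
    where they do not exist, instead of extended real numbers. *)
Lemma Rfubini h : (mu \x mu)%E.-integrable setT (EFin \o h) ->
  [/\ {ae mu, forall x, mu.-integrable setT (fun y => (h (x, y))%:E)},
      mu.-integrable setT (fun x => (\int[mu]_y h (x, y))%:E),
      mu.-integrable setT (fun y => (\int[mu]_x h (x, y))%:E) &
      \int[mu]_x \int[mu]_y h (x, y) = \int[mu]_y \int[mu]_x h (x, y)].
Proof.
move=> ih.
have ae1 := ae_integrable1 ih.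
have mh := measurable_int _ ih.
have mh' : measurable_fun setT ((EFin \o h) \o (fun z : T * T => (z.2, z.1))).
  by apply: measurableT_comp => //; apply: measurable_fun_pair;
    [exact: measurable_snd|exact: measurable_fst].
have ih' : (mu \x mu)%E.-integrable setT ((EFin \o h) \o (fun z : T * T => (z.2, z.1))).
  by apply/integrable12ltyP => //; move/integrable21ltyP : (ih) => /(_ mh).
have i1 := integrable_fubini_F ih; have i2 := integrable_fubini_F ih'.
have mfine (g : T -> \bar R) : measurable_fun setT g ->
    measurable_fun setT (fun x => (fine (g x))%:E).
  by move=> mg; apply/measurable_EFinP; exact: measurableT_comp.
have ae_fine (g : T -> \bar R) : mu.-integrable setT g ->
    ae_eq mu setT g (fun x => (fine (g x))%:E).
  move=> ig; have := integrable_ae measurableT ig.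
  by apply: filterS => x h0 _; rewrite fineK// h0.
have int_fine (g : T -> \bar R) : mu.-integrable setT g ->
    mu.-integrable setT (fun x => (fine (g x))%:E).
  move=> ig; have mg := measurable_int _ ig.
  apply: le_integrable ig => //; first exact: mfine.
  by move=> x _; case: (g x) => [r| |] //=; rewrite normr0 leey.
split=> //.
- exact: (int_fine _ i1).
- exact: (int_fine _ i2).
- rewrite /Rintegral; congr fine.
  have E (g : T -> \bar R) : mu.-integrable setT g ->
      (\int[mu]_x (fine (g x))%:E = \int[mu]_x g x)%E.
    move=> ig; have mg := measurable_int _ ig.
    by apply/esym/ae_eq_integral => //; [exact: mfine|exact: ae_fine].
  by rewrite (E _ i1) (E _ i2); exact: (Fubini ih).
Qed.

Lemma cfubini (H : T * T -> R[i]) (G : T * T -> R) :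
  cmeas setT H -> (mu \x mu)%E.-integrable setT (EFin \o G) ->
  (forall x, cmod (H x) <= G x) ->
  [/\ {ae mu, forall x, cintegrable setT (fun y => H (x, y))},
      cintegrable setT (fun x => cintegral setT (fun y => H (x, y))),
      cintegrable setT (fun y => cintegral setT (fun x => H (x, y))) &
      cintegral setT (fun x => cintegral setT (fun y => H (x, y))) =
      cintegral setT (fun y => cintegral setT (fun x => H (x, y)))].
Proof.
move=> [m1 m2] iG HG.
have i (p : T * T -> R) : measurable_fun setT p -> (forall x, `|p x| <= cmod (H x)) ->
    (mu \x mu)%E.-integrable setT (EFin \o p).
  move=> mp pH; apply: le_integrable iG => //; first exact/measurable_EFinP.
  by move=> x _; rewrite /= lee_fin (le_trans (pH x))// (le_trans (HG x))// ler_norm.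
have [a1 b1 c1 d1] := Rfubini (i _ m1 (fun x => normr_Re_le _)).
have [a2 b2 c2 d2] := Rfubini (i _ m2 (fun x => normr_Im_le _)).
split.
- by apply: filterS2 a1 a2 => x.
- by split.
- by split.
- by apply: complex_ext.
Qed.

End ComplexFubini.

(** * The regularised identity *)

Lemma cintegral0 (R : realType) (D : set (measurableTypeR R)) :
  cintegral D (fun=> 0 : R[i]) = 0.
Proof. by apply: complex_ext; rewrite /cintegral /Rintegral/= integral0. Qed.

Lemma ae_eq_cintegral (R : realType) (f g : R -> R[i]) :
  cmeas [set: measurableTypeR R] f -> cmeas [set: measurableTypeR R] g ->
  {ae (@lebesgue_measure R), forall x, f x = g x} -> cintegral setT f = cintegral setT g.
Proof.
move=> [a b] [c d] fg; rewrite /cintegral /Rintegral; congr (fine _ +i* fine _).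
  apply: ae_eq_integral => //; [exact/measurable_EFinP|exact/measurable_EFinP|].
  by apply: (@filterS _ _ (ae_filter_ringOfSetsType _) _ _ _ fg) => x -> .
apply: ae_eq_integral => //; [exact/measurable_EFinP|exact/measurable_EFinP|].
by apply: (@filterS _ _ (ae_filter_ringOfSetsType _) _ _ _ fg) => x -> .
Qed.

Lemma lap_fun_int (R : realType) (al s B : R[i]) (x : R) :
  0 < Re al -> 0 < Re B -> 0 < x -> cintegrable (posline R) (lap_fun al s B x).
Proof.
move=> al0 B0 x0; have mp := measurable_posline R.
have h0 : 0 < 2^-1 * Re B by rewrite mulr_gt0// half_gt0.
have [C1 C10 h1] := powR_shift_le (Re s - 1) x0.
have [C2 C20 h2] := exp_decay_powR (Re s - 1) h0.
apply: (cintegrable_le mp (cmeas_lap_fun al s B x mp) (rintZ (C1 * C2) mp (gamma_density_int al0 h0))).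
move=> v /poslineP v0; rewrite cmod_lap_fun ?addr_gt0//.
have -> : expR (- (Re B * v)) = expR (- (2^-1 * Re B * v)) * expR (- (2^-1 * Re B * v)).
  by rewrite -expRD; congr expR; field.
set E := expR _; set p := v `^ _.
have E0 : 0 <= E by exact: expR_ge0.
have p0 : 0 <= p by exact: powR_ge0.
have := h1 v (ltW v0); have := h2 v (ltW v0); rewrite -/E.
set q := (v + 1) `^ _; set q' := (v + x) `^ _ => hq hq'.
have -> : p * (E * E) * q' = p * E * (E * q') by ring.
have -> : C1 * C2 * (p * E) = p * E * (C1 * C2) by ring.
rewrite ler_wpM2l ?mulr_ge0//.
apply: (@le_trans _ _ (E * (C1 * q))); first by rewrite ler_wpM2l.
by rewrite mulrCA [E * q]mulrC ler_wpM2l.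
Qed.

Section Regularisation.
Variable R : realType.
Local Notation mu := (@lebesgue_measure R).
Local Notation T := (measurableTypeR R).
Variables (f : R -> R[i]) (al be s : R[i]) (e d : R).
Hypotheses (al0 : 0 < Re al) (be0 : 0 <= Re be) (e0 : 0 < e) (d0 : 0 <= d).
Hypothesis sd : Re s <= 1 -> 0 < d.
Hypothesis fi : cintegrable (posline R) f.

(** A substitute for [t ^ (s - 1)] that decays exponentially and, when [0 < d],
    has no singularity at the origin. *)
Definition reg_weight (t : R) : R[i] := cexp (- (e * t)%:C + (s - 1) * (ln (t + d))%:C).

Definition conv_kernel (v : R) : R[i] := cexp ((al - 1) * (ln v)%:C - be * v%:C).

Definition conv_power (t : R) : R[i] := cintegral `[0, t]
  (fun u => cpow (t - u)%:C (al - 1) * cexp (- be * (t - u)%:C) * f u).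

Local Notation W := (czext (posline R) reg_weight).
Local Notation K := (czext (posline R) conv_kernel).
Local Notation F := (czext (posline R) f).

Lemma cmeas_reg_weight D : measurable D -> cmeas D reg_weight.
Proof.
move=> mD; apply: cmeas_cexp; apply: cmeasD.
  apply: (@cmeas_ext _ _ _ _ (fun t => (- (e * t))%:C)); last by move=> t _; rewrite rmorphN.
  by apply: cmeas_real; do 2![apply: measurableT_comp => //].
by apply: cmeas_ln; exact: measurable_funD.
Qed.

Lemma cmeas_conv_kernel D : measurable D -> cmeas D conv_kernel.
Proof.
move=> mD; apply: cmeas_cexp; apply: cmeasD; first exact: cmeas_ln.
apply: (@cmeas_ext _ _ _ _ (fun v : R => - be * v%:C)); last by move=> v _; rewrite mulNr.
by apply: cmeasM; [exact: cmeas_cst|exact: cmeas_real].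
Qed.

Lemma cmeas_W : cmeas [set: T] W.
Proof. by apply: cmeas_czext; [|apply: cmeas_reg_weight]; exact: measurable_posline. Qed.

Lemma cmeas_K : cmeas [set: T] K.
Proof. by apply: cmeas_czext; [|apply: cmeas_conv_kernel]; exact: measurable_posline. Qed.

Lemma cmeas_F : cmeas [set: T] F.
Proof. by apply: cmeas_czext; [exact: measurable_posline|exact: cintegrable_cmeas fi]. Qed.

Lemma reg_weight_le : exists2 C, 0 <= C & forall t, 0 < t ->
  cmod (reg_weight t) <= C * expR (- (2^-1 * e * t)).
Proof.
have h0 : 0 < 2^-1 * e by rewrite mulr_gt0// half_gt0.
have [C2 C20 h2] := exp_decay_powR (Re s - 1) h0.
have [C1 C10 h1] : exists2 C, 0 <= C & forall t, 0 < t ->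
    (t + d) `^ (Re s - 1) <= C * (t + 1) `^ (Re s - 1).
  have [s1|s1] := leP (Re s) 1.
    have [C C0 hC] := powR_shift_le (Re s - 1) (sd s1).
    by exists C => // t t0; apply: hC; exact: ltW.
  have [C C0 hC] := powR_shift_le (Re s - 1) (ltr_wpDl d0 (@ltr01 R)).
  exists C => // t t0; apply: le_trans (hC t (ltW t0)).
  rewrite ge0_ler_powR ?nnegrE ?subr_ge0 ?(ltW s1) ?addr_ge0 ?(ltW t0)//.
  by rewrite lerD2l lerDl.
exists (C1 * C2) => [|t t0]; first by rewrite mulr_ge0// ltW.
rewrite /reg_weight cexpD cmodM !cmod_cexp !ReImE /= !mulr0 !subr0.
rewrite -powR_exp ?ltr_wpDr//.
have -> : expR (- (e * t)) = expR (- (2^-1 * e * t)) * expR (- (2^-1 * e * t)).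
  by rewrite -expRD; congr expR; field.
have := h1 t t0; have := h2 t (ltW t0).
set E := expR _; set q := (t + 1) `^ _; set q' := (t + d) `^ _ => hq hq'.
have E0 : 0 <= E by exact: expR_ge0.
rewrite -mulrA [leRHS]mulrC ler_wpM2l//.
apply: (@le_trans _ _ (E * (C1 * q))); first by rewrite ler_wpM2l.
by rewrite mulrCA [E * q]mulrC ler_wpM2l.
Qed.

Lemma cmod_conv_kernel_le v : 0 < v -> cmod (conv_kernel v) <= v `^ (Re al - 1).
Proof.
move=> v0; rewrite /conv_kernel cexpD cmodM !cmod_cexp !ReImE /= !mulr0 !subr0.
rewrite -powR_exp// ler_piMr ?powR_ge0// -expR0 ler_expR oppr_le0.
by rewrite mulr_ge0// ltW.
Qed.

Definition conv_prod (z : T * T) : R[i] := W z.1 * (K (z.1 - z.2) * F z.2).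

Lemma cmeas_conv_prod : cmeas setT conv_prod.
Proof.
apply: cmeasM; first exact: cmeas_comp cmeas_W measurable_fst.
apply: cmeasM; last exact: cmeas_comp cmeas_F measurable_snd.
apply: cmeas_comp cmeas_K _.
by apply: measurable_funB; [exact: measurable_fst|exact: measurable_snd].
Qed.

Local Notation P := (fun v : R => v `^ (Re al - 1) * expR (- (2^-1 * e * v))).
Local Notation Pz := (P \_ (posline R)).

Lemma density_ext_int : mu.-integrable [set: T] (EFin \o Pz).
Proof.
rewrite -restrict_EFin; apply/(integrable_mkcond _ (measurable_posline R)).
by apply: gamma_density_int => //; rewrite mulr_gt0// half_gt0.
Qed.

Lemma density_ext_ge0 v : 0 <= Pz v.
Proof. by rewrite patchE; case: ifP => // _; rewrite mulr_ge0 ?powR_ge0 ?expR_ge0. Qed.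

(** By Tonelli's theorem and translation invariance the integral of the majorant
    is a product of two finite integrals. *)
Lemma conv_majorant_int C : 0 <= C ->
  (mu \x mu)%E.-integrable setT
    (EFin \o (fun z : T * T => C * cmod (F z.2) * Pz (z.1 - z.2))).
Proof.
move=> C0.
have mP : measurable_fun [set: T] Pz.
  by apply/measurable_EFinP; have := measurable_int _ density_ext_int.
apply/integrable21ltyP.
  apply/measurable_EFinP; apply: measurable_funM.
    apply: measurable_funM => //.
    apply: measurable_cmod; exact: cmeas_comp cmeas_F measurable_snd.
  apply: (measurableT_comp mP).
  by apply: measurable_funB; [exact: measurable_fst|exact: measurable_snd].
set I := \int[mu]_v Pz v.
have IE : (\int[mu]_v (Pz v)%:E = I%:E)%E.
  by rewrite /I /Rintegral fineK//; exact: integrable_fin_num density_ext_int.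
have iF := (cintegrable_czext f (measurable_posline R)).1 fi.
have i := rintZ (C * I) measurableT (cintegrable_cmod measurableT iF).
have /integrableP[_] := i.
apply: le_lt_trans; rewrite le_eqVlt; apply/orP; left; apply/eqP.
apply: eq_integral => u _.
transitivity (\int[mu]_t ((C * cmod (F u))%:E * (Pz (t - u))%:E))%E.
  apply: eq_integral => t _ /=; rewrite -EFinM ger0_norm// mulr_ge0 ?density_ext_ge0//.
  by rewrite mulr_ge0 ?cmod_ge0.
have k0 : 0 <= C * cmod (F u) by rewrite mulr_ge0 ?cmod_ge0.
rewrite ge0_integralZl_EFin//.
- rewrite (@ge0_integral_translate _ (fun v => (Pz v)%:E) (- u)).
  + rewrite IE -EFinM /= ger0_norm; first by congr EFin; ring.
    by rewrite mulr_ge0 ?cmod_ge0// mulr_ge0// /I; apply: Rintegral_ge0 => v _; exact: density_ext_ge0.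
  + exact/measurable_EFinP.
  + by move=> v; rewrite lee_fin density_ext_ge0.
- by move=> t _; rewrite lee_fin density_ext_ge0.
- apply/measurable_EFinP; apply: (measurableT_comp mP).
  by apply: measurable_funB.
Qed.

(** For [0 < u < t] part of the decay of the weight in [t] is passed on to
    [t - u], where it makes the power kernel integrable. *)
Lemma cmod_conv_prod_le : exists2 C, 0 <= C & forall z,
  cmod (conv_prod z) <= C * cmod (F z.2) * Pz (z.1 - z.2).
Proof.
have [C C0 hC] := reg_weight_le; exists C => // -[t u] /=.
have r0 : 0 <= C * cmod (F u) * Pz (t - u).
  by rewrite mulr_ge0 ?density_ext_ge0// mulr_ge0 ?cmod_ge0.
rewrite /conv_prod /=.
have [u0|u0] := ltP 0 u; last first.
  by rewrite (_ : W t * _ = 0) ?cmod0// (czext_out f (posline_out u0)) !mulr0.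
have [tu|tu] := ltP u t; last first.
  have tu0 : t - u <= 0 by rewrite subr_le0.
  by rewrite (_ : W t * _ = 0) ?cmod0// (czext_out _ (posline_out tu0)) mul0r mulr0.
have v0 : 0 < t - u by rewrite subr_gt0.
have t0 := lt_trans u0 tu.
rewrite (@czext_in _ _ reg_weight)//; last exact/poslineP.
rewrite (@czext_in _ _ conv_kernel)//; last exact/poslineP.
rewrite patchE mem_set; last exact/poslineP.
rewrite !cmodM.
have h1 := hC t t0; have h2 := cmod_conv_kernel_le v0.
have h3 : expR (- (2^-1 * e * t)) <= expR (- (2^-1 * e * (t - u))).
  rewrite ler_expR lerN2 ler_wpM2l ?gerBl ?(ltW u0)//.
  by rewrite mulr_ge0 ?(ltW e0) ?(ltW (@half_gt0 R)).
have -> : C * cmod (F u) * ((t - u) `^ (Re al - 1) * expR (- (2^-1 * e * (t - u)))) =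
  (C * expR (- (2^-1 * e * (t - u)))) * ((t - u) `^ (Re al - 1) * cmod (F u)) by ring.
apply: ler_pM; rewrite ?mulr_ge0 ?cmod_ge0//.
  by apply: le_trans h1 _; rewrite ler_wpM2l.
by rewrite ler_wpM2r ?cmod_ge0.
Qed.

Lemma conv_power_czext t : 0 < t ->
  conv_power t = cintegral setT (fun u => K (t - u) * F u).
Proof.
move=> t0; rewrite /conv_power; set g := (fun u : R => _ * f u).
pose D : set T := `]0, t[%classic.
have mD : measurable D by exact: measurable_itv.
have DP u : D u <-> 0 < u /\ u < t by rewrite /D /= in_itv/=; split=> /andP.
have gE u : D u -> g u = K (t - u) * F u.
  move=> /DP[u0 ut]; have v0 : 0 < t - u by rewrite subr_gt0.
  rewrite !czext_in; [|exact/poslineP|exact/poslineP].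
  by rewrite /g /conv_kernel cexpD cpow_real// mulNr.
have mk : @cmeas _ T R D (fun u => K (t - u) * F u).
  apply: (@cmeas_sub _ _ _ _ setT) => //; apply: cmeasM; last exact: cmeas_F.
  by apply: (cmeas_comp cmeas_K); apply: measurable_funB.
have mg : @cmeas _ T R D g by apply: cmeas_ext mk _ => u /gE.
have -> : cintegral `[0, t] g = cintegral D g.
  have h (p : R -> R) : measurable_fun D p ->
      (\int[mu]_(u in `[0%R, t]) (p u)%:E = \int[mu]_(u in D) (p u)%:E)%E.
    move=> mp'; apply: (@integral_itv_bndoo _ 0 t (EFin \o p) true false).
    exact/measurable_EFinP.
  by have [a b] := mg; apply: complex_ext => /=; rewrite /Rintegral; congr fine; exact: h.
rewrite -cintegral_czext; apply: cintegral_ext => u _.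
have [Du|nDu] := pselect (D u); first by rewrite czext_in// gE.
rewrite czext_out//.
have [u0|u0] := ltP 0 u; last first.
  by rewrite (@czext_out _ _ f) ?mulr0//; exact: posline_out.
rewrite (@czext_out _ _ conv_kernel) ?mul0r//; move=> /poslineP; rewrite subr_gt0 => ut.
by apply: nDu; apply/DP.
Qed.

Local Notation inner u := (f u * (cexp (- (e * u)%:C) *
  cintegral (posline R) (lap_fun al s (be + e%:C) (u + d)))).

(** The substitution [t = u + v]. *)
Lemma cintegral_conv_prod u :
  cintegral setT (fun t => conv_prod (t, u)) = czext (posline R) (fun u => inner u) u.
Proof.
have [u0|u0] := ltP 0 u; last first.
  have nu := posline_out u0.
  rewrite czext_out// -[RHS](cintegral0 setT); apply: cintegral_ext => t _.
  by rewrite /conv_prod/= (czext_out f)// !mulr0.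
rewrite czext_in; last exact/poslineP.
pose g v := W (v + u) * (K v * F u).
have mg : cmeas [set: T] g.
  apply: cmeasM; first by apply: cmeas_comp cmeas_W _; exact: measurable_funD.
  by apply: cmeasM; [exact: cmeas_K|exact: cmeas_cst].
rewrite (@cintegral_ext _ _ _ (fun t => g (t + - u))); last first.
  by move=> t _; rewrite /g /conv_prod subrK.
rewrite cintegral_translate//.
have ud : 0 < u + d by rewrite ltr_wpDr.
have B0 : 0 < Re (be + e%:C) by rewrite ReD/= ltr_wpDl.
have mp := measurable_posline R.
rewrite mulrA -(cintegralZ _ mp (lap_fun_int s al0 B0 ud)) -[RHS]cintegral_czext.
apply: cintegral_ext => v _; rewrite /g.
have [v0|v0] := ltP 0 v; last first.
  have nv := posline_out v0.
  by rewrite !(@czext_out _ _ _ v)// mul0r mulr0.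
rewrite !czext_in; try by apply/poslineP; rewrite ?addr_gt0.
rewrite /reg_weight /conv_kernel /lap_fun [_ * f u]mulrC mulrCA -mulrA -!cexpD.
by rewrite [v + (u + d)]addrA; congr (_ * cexp _); rewrite !rmorphM/= rmorphD/=; ring.
Qed.

(** Fubini's theorem for the regularised Mellin transform of the convolution. The
    weight can be taken out of the inner integral only for almost every [t],
    namely when the section of the product is integrable. *)
Lemma regularised_fubini : cmeas (posline R) conv_power ->
  cintegrable (posline R) (fun u => inner u) /\
  cintegral (posline R) (fun t => reg_weight t * conv_power t) =
  cintegral (posline R) (fun u => inner u).
Proof.
move=> mc; have mp := measurable_posline R.
have [C C0 hC] := cmod_conv_prod_le.
have [aei i1 i2 E] := cfubini cmeas_conv_prod (conv_majorant_int C0) hC.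
have uE : (fun u => cintegral setT (fun t => conv_prod (t, u))) =
    czext (posline R) (fun u => inner u).
  by apply/funext => u; exact: cintegral_conv_prod.
rewrite uE in i2 E; split; first exact/cintegrable_czext.
rewrite -[RHS]cintegral_czext -E -[LHS]cintegral_czext.
apply: ae_eq_cintegral.
- by apply: cmeas_czext => //; apply: cmeasM => //; exact: cmeas_reg_weight.
- exact: cintegrable_cmeas i1.
apply: filterS aei => t; rewrite /conv_prod/= => it.
have [t0|t0] := ltP 0 t; last first.
  have nt := posline_out t0.
  rewrite czext_out// -[LHS](cintegral0 setT); apply: cintegral_ext => u _.
  by rewrite (@czext_out _ _ reg_weight)// mul0r.
have pt : posline R t by exact/poslineP.
have wE : W t = reg_weight t by exact: czext_in.
have w0 : reg_weight t != 0 by exact: cexp_neq0.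
rewrite czext_in// conv_power_czext// -cintegralZ//.
  by apply: cintegral_ext => u _; rewrite wE.
apply: (cintegrable_ext measurableT (cintegrableZ (reg_weight t)^-1 measurableT it)) => u _.
by rewrite wE mulKf.
Qed.

End Regularisation.

(** * Removal of the regularisation *)

Section RegularisationLimit.
Variable R : realType.
Implicit Types (f g : R -> R[i]) (al be s : R[i]).

Definition reg_scale n : R := n.+2%:R^-1.

(** The weight must be dominated by [t ^ (s - 1)]: a shift decreases the power
    for [Re s <= 1], where it is needed, but increases it for [1 < Re s]. *)
Definition reg_shift s n : R := if Re s <= 1 then reg_scale n else 0.

Lemma reg_scale_gt0 n : 0 < reg_scale n. Proof. by rewrite invr_gt0 ltr0n. Qed.

Lemma reg_scale_le1 n : reg_scale n <= 1.
Proof. by rewrite invf_le1 ?ltr0n// ler1n. Qed.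

Lemma reg_shift_ge0 s n : 0 <= reg_shift s n.
Proof. by rewrite /reg_shift; case: ifP => // _; exact/ltW/reg_scale_gt0. Qed.

Lemma reg_shift_gt0 s n : Re s <= 1 -> 0 < reg_shift s n.
Proof. by rewrite /reg_shift => ->; exact: reg_scale_gt0. Qed.

Lemma reg_shift_le1 s n : reg_shift s n <= 1.
Proof. by rewrite /reg_shift; case: ifP => // _; exact: reg_scale_le1. Qed.

Lemma reg_shift_cvg0 s : reg_shift s @ \oo --> 0.
Proof. by rewrite /reg_shift; case: (_ <= 1); [exact: invn_cvg0|exact: cvg_cst]. Qed.

Lemma ccvg_exp_scale (c : R) : ccvg (fun n => cexp (- (reg_scale n * c)%:C)) (1 : R[i]).
Proof.
have h : (fun n => - (reg_scale n * c)) @ \oo --> 0.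
  by rewrite -oppr0 -(mul0r c); apply: cvgN; apply: cvgM; [exact: invn_cvg0|exact: cvg_cst].
have := ccvg_cexp (ccvg_real h); rewrite cexp_real expR0 => h1.
by apply: ccvg_ext h1 _ => n; rewrite rmorphN.
Qed.

Lemma cmod_reg_weight_le s n t : 0 < t ->
  cmod (reg_weight s (reg_scale n) (reg_shift s n) t) <= cmod (cpow t%:C (s - 1)).
Proof.
move=> t0; have td : 0 < t + reg_shift s n by rewrite ltr_wpDr// reg_shift_ge0.
rewrite cmod_cpow_real// /reg_weight cexpD -cpow_real// cmodM cmod_cpow_real//.
rewrite cmod_cexp ReN/= -[leRHS]mul1r ler_pM ?expR_ge0 ?powR_ge0//.
  by rewrite -expR0 ler_expR oppr_le0 mulr_ge0 ?(ltW t0)// ltW// reg_scale_gt0.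
rewrite ReD ReN/= /reg_shift in td *; case: ifP td => s1 td; last by rewrite addr0.
rewrite !powR_exp// ler_expR ler_wnM2l//; first by rewrite subr_le0.
by rewrite ler_ln ?posrE// lerDl ltW// reg_scale_gt0.
Qed.

(** The existence of the Mellin transform at [s] provides the majorant. *)
Lemma regularised_mellin_cvg g s : cmeas (posline R) g ->
  cintegrable (posline R) (fun t => cpow t%:C (s - 1) * g t) ->
  ccvg (fun n => cintegral (posline R)
         (fun t => reg_weight s (reg_scale n) (reg_shift s n) t * g t))
       (cintegral (posline R) (fun t => cpow t%:C (s - 1) * g t)).
Proof.
move=> mg ig; have mp := measurable_posline R.
apply: (cdominated mp _ _ (cintegrable_cmod mp ig) _).2.
- by move=> n; apply: cmeasM => //; exact: cmeas_reg_weight.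
- move=> t /poslineP t0; apply: ccvgM; last exact: ccvg_cst.
  rewrite cpow_real// -[X in ccvg _ X]mul1r.
  apply: (@ccvg_ext _ (fun n => cexp (- (reg_scale n * t)%:C) *
    cexp ((s - 1) * (ln (t + reg_shift s n))%:C))); last by move=> n; rewrite -cexpD.
  apply: ccvgM; first exact: ccvg_exp_scale.
  apply: ccvg_cexp; apply: ccvgM; first exact: ccvg_cst.
  apply: ccvg_real.
  have h : (fun n => t + reg_shift s n) @ \oo --> t.
    by rewrite -[X in _ --> X]addr0; apply: cvgD; [exact: cvg_cst|exact: reg_shift_cvg0].
  by apply: continuous_cvg h; exact: continuous_ln.
- by move=> n t /poslineP t0; rewrite !cmodM ler_wpM2r ?cmod_ge0// cmod_reg_weight_le.
Qed.

(** For positive real part of [be + e n] the inner integral is the Kobayashi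
    gamma function at [(be + e n) (u + d n)] by rotation; this tends to its value
    at [be u], and [kob_dominated] provides the majorant
    [C (|f u| + |kob al s (be u) f u|)]. *)
Lemma regularised_kernel_cvg f al be s : 0 < Re al -> 0 <= Re be -> be != 0 ->
  cGamma al != 0 -> cintegrable (posline R) f ->
  cintegrable (posline R) (fun u => kob al s (be * u%:C) * f u) ->
  (forall n, cintegrable (posline R) (fun u => f u * (cexp (- (reg_scale n * u)%:C) *
    cintegral (posline R) (lap_fun al s (be + (reg_scale n)%:C) (u + reg_shift s n))))) ->
  ccvg (fun n => cintegral (posline R) (fun u => f u * (cexp (- (reg_scale n * u)%:C) *
    cintegral (posline R) (lap_fun al s (be + (reg_scale n)%:C) (u + reg_shift s n)))))
  (cpow be (- (al + s - 1)) * cintegral (posline R) (fun u => kob al s (be * u%:C) * f u)).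
Proof.
move=> al0 be0 bn0 G0 fi ki ri; have mp := measurable_posline R.
set q := - (al + s - 1).
pose B n : R[i] := be + (reg_scale n)%:C.
pose z n u : R[i] := B n * (u + reg_shift s n)%:C.
have B0 n : 0 < Re (B n) by rewrite ReD/= ltr_wpDl// reg_scale_gt0.
have Bn0 n : B n != 0 by exact: Re_gt0_neq0.
have cb0 : 0 < cmod be by rewrite cmod_gt0.
have Bge n : cmod be <= cmod (B n).
  rewrite /B addrC; apply: (cmod_addr_ge _ _ be0).2 => //=.
  exact/ltW/reg_scale_gt0.
have Ble n : cmod (B n) <= cmod be + 1.
  apply: le_trans (cmodD _ _) _; rewrite lerD2l cmod_real ger0_norm ?reg_scale_le1//.
  exact/ltW/reg_scale_gt0.
have ud n (u : R) : 0 < u -> 0 < u + reg_shift s n.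
  by move=> u0; rewrite ltr_wpDr// reg_shift_ge0.
have lapE n u : 0 < u ->
    cintegral (posline R) (lap_fun al s (B n) (u + reg_shift s n)) =
    cpow (B n) q * kob al s (z n u).
  by move=> u0; rewrite /z kob_rotation ?ud// mulrA /q cpowN// mulVf ?cpow_neq0// mul1r.
have zE n (u : R) : 0 < u -> cmod (z n u) = cmod (B n) * (u + reg_shift s n).
  by move=> u0; rewrite cmod_mul_real// ltW// ud.
have zge n (u : R) : 0 < u -> cmod be * u <= cmod (z n u).
  by move=> u0; rewrite zE// ler_pM ?cmod_ge0 ?(ltW u0)// lerDl reg_shift_ge0.
have zle n (u : R) : 0 < u -> cmod (z n u) <= (cmod be + 1) * (u + 1).
  move=> u0; rewrite zE// ler_pM ?cmod_ge0 ?(ltW (ud n u u0))//.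
  by rewrite lerD2l reg_shift_le1.
have Rez n (u : R) : 0 < u -> 0 <= Re (z n u).
  by move=> u0; rewrite Re_mul_real_ge0// ltW// ud.
have [C C0 hC] := kob_dominated s al0 (cmod be + 1) be0 bn0 G0.
pose Q := expR (pi * `|Im q|) * (cmod be `^ Re q + (cmod be + 1) `^ Re q).
have Q0 : 0 <= Q by rewrite mulr_ge0 ?expR_ge0// addr_ge0 ?powR_ge0.
have hQ n : cmod (cpow (B n) q) <= Q.
  by apply: le_trans (cmod_cpow_le q (Bn0 n)) _; rewrite ler_wpM2l ?expR_ge0// powR_between.
rewrite -cintegralZ//.
have fk := rintD mp (cintegrable_cmod mp fi) (cintegrable_cmod mp ki).
apply: (cdominated mp _ _ (rintZ (Q * C) mp fk) _).2.
- by move=> n; exact: cintegrable_cmeas (ri n).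
- move=> u /poslineP u0.
  apply: (@ccvg_ext _ (fun n => f u * (cexp (- (reg_scale n * u)%:C) *
    (cpow (B n) q * kob al s (z n u))))); last by move=> n; rewrite -lapE.
  have -> : cpow be q * (kob al s (be * u%:C) * f u) =
    f u * (1 * (cpow be q * kob al s (be * u%:C))) by ring.
  apply: ccvgM; first exact: ccvg_cst.
  apply: ccvgM; first exact: ccvg_exp_scale.
  apply: ccvgM.
    apply: ccvg_cpow_right => //; last exact: invn_cvg0.
    by move=> n; exact/ltW/reg_scale_gt0.
  apply: kob_cvg => //.
  + by rewrite Re_mul_real_ge0// ltW.
  + by rewrite mulf_neq0// real_neq0.
  + by move=> n; exact: Rez.
  + by move=> n; rewrite cmod_mul_real ?(ltW u0)// zge.
  + by exists ((cmod be + 1) * (u + 1)) => n; exact: zle.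
  apply: ccvgM; first by apply: ccvg_addr_real; exact: invn_cvg0.
  apply: ccvg_real; rewrite -[X in _ --> X]addr0.
  by apply: cvgD; [exact: cvg_cst|exact: reg_shift_cvg0].
- move=> n u /poslineP u0; rewrite lapE// !cmodM.
  have e1 : cmod (cexp (- (reg_scale n * u)%:C)) <= 1.
    rewrite cmod_cexp ReN/= -expR0 ler_expR oppr_le0 mulr_ge0 ?(ltW u0)//.
    exact/ltW/reg_scale_gt0.
  have k := hC u (z n u) u0 (Rez n u u0) (zge n u u0) (zle n u u0).
  have -> : Q * C * (cmod (f u) + cmod (kob al s (be * u%:C)) * cmod (f u)) =
    cmod (f u) * (1 * (Q * (C * (1 + cmod (kob al s (be * u%:C)))))) by ring.
  rewrite ler_wpM2l ?cmod_ge0//.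
  by rewrite !ler_pM ?mulr_ge0 ?cmod_ge0.
Qed.

End RegularisationLimit.

Theorem theorem2p14 (R : realType) (f : R -> R[i]) (alpha beta s : R[i])
  (f_L1 : cintegrable (@halfline R) f)
  (alpha_gt0 : 0 < complex.Re alpha)
  (beta_ge0 : 0 <= complex.Re beta)
  (beta_neq0 : beta != 0)
  (* the Mellin transform of the tempered integral exists at s *)
  (lhs_exists : cintegrable (@halfline R)
     (mellin_integrand (tempered_integral alpha beta f) s))
  (* the integral transform on the right-hand side exists at s *)
  (rhs_exists : cintegrable (@halfline R)
     (fun u => kobayashi_gamma (1 - s) alpha (beta * u%:C) * f u)) :
  mellin (tempered_integral alpha beta f) s =
  (cpow beta (alpha + s - 1) * cGamma alpha)^-1 *
  cintegral (@halfline R)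
    (fun u => kobayashi_gamma (1 - s) alpha (beta * u%:C) * f u).
Proof.
have mp := measurable_posline R.
(* The inverse of 0 is 0, so both sides vanish if the Gamma integral does. *)
have [G0|G0] := eqVneq (cGamma alpha) 0.
  rewrite G0 mulr0 invr0 mul0r /mellin -[RHS](cintegral0 (@halfline R)).
  by apply: cintegral_ext => t _; rewrite /mellin_integrand /tempered_integral G0 invr0 mul0r mulr0.
set G := cGamma alpha in G0 *.
have fi := cintegrable_pos f_L1.
have li := cintegrable_pos lhs_exists.
have ki' := cintegrable_pos rhs_exists.
have kE u : posline R u -> kobayashi_gamma (1 - s) alpha (beta * u%:C) * f u =
    kob alpha s (beta * u%:C) * f u.
  by move=> /poslineP u0; rewrite kobayashi_gammaE// Re_mul_real_ge0// ltW.
have ki := cintegrable_ext mp ki' kE.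
rewrite /mellin (cintegral_halfline (cintegrable_cmeas li)).
rewrite (cintegral_halfline (cintegrable_cmeas ki')) (cintegral_ext kE).
have cE t : posline R t -> G * mellin_integrand (tempered_integral alpha beta f) s t =
    cpow t%:C (s - 1) * conv_power f alpha beta t.
  by move=> _; rewrite /mellin_integrand /tempered_integral mulrCA mulVKf.
have ci := cintegrable_ext mp (cintegrableZ G mp li) cE.
have mc : cmeas (posline R) (conv_power f alpha beta).
  apply: (@cmeas_ext _ _ _ _ (fun t => cexp (- ((s - 1) * (ln t)%:C)) *
      (cpow t%:C (s - 1) * conv_power f alpha beta t))).
    apply: cmeasM; last exact: cintegrable_cmeas ci.
    apply: cmeas_cexp; apply: (@cmeas_ext _ _ _ _ (fun t : R => - (s - 1) * (ln t)%:C)).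
      exact: cmeas_ln.
    by move=> t _; rewrite mulNr.
  move=> t /poslineP t0; rewrite cexpN -cpow_real// mulKf//.
  by rewrite cpow_neq0// real_neq0.
have reg n := regularised_fubini alpha_gt0 beta_ge0 (reg_scale_gt0 R n) (reg_shift_ge0 s n)
  (@reg_shift_gt0 _ s n) fi mc.
have L := regularised_mellin_cvg mc ci.
have K := regularised_kernel_cvg alpha_gt0 beta_ge0 beta_neq0 G0 fi ki (fun n => (reg n).1).
have E := ccvg_unique (ccvg_ext L (fun n => (reg n).2)) K.
rewrite -(cintegral_ext cE) cintegralZ// cpowN// in E.
by apply: (mulfI G0); rewrite E invfM [_^-1 * G^-1]mulrC -mulrA mulVKf.
Qed.
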